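(* Let $k\ge 0$ be an integer and let $M$ be a smooth Riemannian manifold of dimension $8k+4$. Then $$\left\{\widehat{L}(TM,\nabla^{TM})\,\mathrm{ch}(T_{\mathbf C}M)-16\,\widehat{L}(TM,\nabla^{TM})\right\}^{(8k+4)}=2^{14}\sum_{r=0}^{k-1}(k-r)\,2^{6(k-r-1)}\,h_r(T_{\mathbf C}M),$$ where $h_r(T_{\mathbf C}M)=\left\{\widehat{A}(TM,\nabla^{TM})\,\mathrm{ch}(b_r(T_{\mathbf C}M))\right\}^{(8k+4)}$ for $0\le r\le k$, and each $b_r(T_{\mathbf C}M)$ is the canonical integral linear combination of $B_j(T_{\mathbf C}M)$, $0\le j\le r$, specified in the context. The right-hand side is understood as $0$ when $k<1$.
   Context: Characteristic forms. $\nabla^{TM}$ is the Levi-Civita connection of $M$, $R^{TM}$ its curvature, $T_{\mathbf C}M=TM\otimes\mathbf C$ with the induced Hermitian connection, and $$\widehat{A}(TM,\nabla^{TM})={\det}^{1/2}\left(\frac{\frac{\sqrt{-1}}{4\pi}R^{TM}}{\sinh\left(\frac{\sqrt{-1}}{4\pi}R^{TM}\right)}\right),\qquad \widehat{L}(TM,\nabla^{TM})={\det}^{1/2}\left(\frac{\frac{\sqrt{-1}}{2\pi}R^{TM}}{\tanh\left(\frac{\sqrt{-1}}{4\pi}R^{TM}\right)}\right).$$ For a Hermitian bundle $E$ with Hermitian connection of curvature $R^E$, $\mathrm{ch}(E)=\mathrm{tr}[\exp(\frac{\sqrt{-1}}{2\pi}R^E)]$, extended additively to formal differences; bundles built from $T_{\mathbf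 C}M$ carry the induced connections. $\{\omega\}^{(n)}$ is the degree $n$ component of the form $\omega$. The $B_j$. For a complex bundle $E$, $\widetilde E=E-\mathbf C^{\mathrm{rk}(E)}$, $\Lambda_t(E)=\sum_i t^i\Lambda^i(E)$, $S_t(E)=\sum_i t^iS^i(E)$, extended to virtual bundles by $\Lambda_t(E-F)=\Lambda_t(E)/\Lambda_t(F)$ and $S_t(E)=1/\Lambda_{-t}(E)$. Put $$\Theta_2(T_{\mathbf C}M)=\bigotimes_{n\ge1}S_{q^n}(\widetilde{T_{\mathbf C}M})\otimes\bigotimes_{m\ge1}\Lambda_{-q^{m-1/2}}(\widetilde{T_{\mathbf C}M})=\sum_{j\ge0}B_j(T_{\mathbf C}M)\,q^{j/2}.$$ The $b_r$. Let $\theta_1=2q^{1/8}\prod_{j\ge1}(1-q^j)(1+q^j)^2$, $\theta_3=\prod_{j\ge1}(1-q^j)(1+q^{j-1/2})^2$, $\delta_2=-\frac18(\theta_1^4+\theta_3^4)$, $\varepsilon_2=\frac1{16}\theta_1^4\theta_3^4$, so that $8\delta_2=-1-24q^{1/2}-\cdots$ and $\varepsilon_2=q^{1/2}+8q+\cdots$ are power series in $q^{1/2}$ with integer coefficients. The elements $b_0(T_{\mathbf C}M),\dots,b_k(T_{\mathbf C}M)$ (which depend on $k$) are determined recursively by $$\sum_{r=0}^k b_r(T_{\mathbf C}M)\,(8\delta_2)^{2k+1-2r}\varepsilon_2^r\equiv\sum_{j=0}^kB_j(T_{\mathbf C}M)\,q^{j/2}\pmod{q^{(k+1)/2}}.$$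 For example $b_0=-1$ and $b_1=24(2k+1)-B_1(T_{\mathbf C}M)$. *)

(* Defs.v *)
From HB Require Import structures.
From mathcomp Require Import all_boot all_order all_algebra.
From mathcomp Require Import ring.

Set Implicit Arguments.
Unset Strict Implicit.
Unset Printing Implicit Defensive.

Import Order.TTheory GRing.Theory Num.Theory.

Local Open Scope ring_scope.

(* [extalg C n] is the exterior algebra over C on generators
   dx_0, ..., dx_(n-1).  The value of w at S = {s_1 < ... < s_d} is the
   coefficient of dx_(s_1) /\ ... /\ dx_(s_d) in w. *)
Definition extalg (C : comNzRingType) (n : nat) : Type :=
  {ffun {set 'I_n} -> C^o}.

HB.instance Definition _ (C : comNzRingType) (n : nat) :=
  GRing.Lmodule.copy (extalg C n) {ffun {set 'I_n} -> C^o}.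

Definition inversions (n : nat) (A B : {set 'I_n}) : nat :=
  (\sum_(x in A) \sum_(y in B) (y < x))%N.

Section ExteriorAlgebra.
Variables (C : comNzRingType) (n : nat).
Implicit Types (a b c : extalg C n) (A B S T : {set 'I_n}).

Definition ext_one : extalg C n := [ffun S : {set 'I_n} => (S == set0)%:R].

Definition ext_mul a b : extalg C n :=
  [ffun S : {set 'I_n} => \sum_(A in powerset S)
     (-1) ^+ inversions A (S :\: A) * (a A * b (S :\: A))].

Lemma sum_setU (F : 'I_n -> nat) A B : [disjoint A & B] ->
  (\sum_(x in A :|: B) F x = \sum_(x in A) F x + \sum_(x in B) F x)%N.
Proof.
by move=> dAB; rewrite -bigU //; apply: eq_bigl => x; rewrite in_setU.
Qed.

Lemma inversionsUl A B S : [disjoint A & B] ->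
  inversions (A :|: B) S = (inversions A S + inversions B S)%N.
Proof. exact: sum_setU. Qed.

Lemma inversionsUr A B S : [disjoint A & B] ->
  inversions S (A :|: B) = (inversions S A + inversions S B)%N.
Proof.
move=> dAB; rewrite /inversions -big_split; apply: eq_bigr => x _.
exact: sum_setU.
Qed.

Lemma inversions0l S : inversions set0 S = 0%N.
Proof. by rewrite /inversions big_set0. Qed.

Lemma inversions0r S : inversions S set0 = 0%N.
Proof. by rewrite /inversions big1 // => x _; rewrite big_set0. Qed.

Lemma ext_mulA : associative ext_mul.
Proof.
move=> a b c; apply/ffunP => S; rewrite !ffunE.
transitivity (\sum_(A in powerset S) \sum_(B in powerset (S :\: A))
   (-1) ^+ (inversions A (S :\: A) + inversions B (S :\: A :\: B)) *
   (a A * b B * c (S :\: A :\: B))).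
  apply: eq_bigr => A _; rewrite ffunE mulr_sumr mulr_sumr.
  apply: eq_bigr => B _; rewrite exprD -!mulrA; congr (_ * _).
  by rewrite mulrCA.
transitivity (\sum_(T in powerset S) \sum_(A in powerset T)
   (-1) ^+ (inversions T (S :\: T) + inversions A (T :\: A)) *
   (a A * b (T :\: A) * c (S :\: T))); last first.
  apply: eq_bigr => T _; rewrite ffunE mulr_suml mulr_sumr.
  by apply: eq_bigr => A _; rewrite exprD -!mulrA.
rewrite [RHS](exchange_big_dep (fun A => A \in powerset S)) /=; last first.
  by move=> T A; rewrite !inE => sTS sAT; apply: subset_trans sTS.
apply: eq_bigr => A; rewrite inE => sAS.
rewrite [RHS](reindex_onto (fun B => A :|: B) (fun T => T :\: A)) /=; last first.
  move=> T; rewrite !inE => /andP[_ sAT].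
  by rewrite setDE setUIr setUCr setIT; apply/setUidPr.
apply: eq_big => [B|B]; rewrite !inE ?subsetD.
  rewrite subUset sAS subsetUl andbT /=; congr (_ && _).
  apply/idP/eqP => [dBA|<-].
    by rewrite setDUl setDv set0U; apply/setDidPl.
  by rewrite setDE -setI_eq0 -setIA [~: A :&: A]setIC setICr setI0.
move=> /andP[sBS dBA].
have -> : (A :|: B) :\: A = B by rewrite setDUl setDv set0U; apply/setDidPl.
rewrite -setDDl.
have dAB : [disjoint A & B] by rewrite disjoint_sym.
have dBC : [disjoint B & S :\: A :\: B] by rewrite disjoint_sym disjoints_subset subDset setUCr subsetT.
have eSA : S :\: A = B :|: (S :\: A :\: B).
  by rewrite -[LHS](setID (S :\: A) B) (setIidPr _) // subsetD sBS.
rewrite [in inversions A _]eSA inversionsUr // inversionsUl //.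
by congr (_ ^+ _ * _); rewrite [RHS]addnC addnA.
Qed.

Lemma ext_mul1l : left_id ext_one ext_mul.
Proof.
move=> a; apply/ffunP => S; rewrite ffunE (bigD1 set0) ?inE ?sub0set //=.
rewrite ffunE eqxx setD0 inversions0l expr0 !mul1r big1 ?addr0 // => A.
by rewrite ffunE => /andP[_ /negPf ->]; rewrite mul0r mulr0.
Qed.

Lemma ext_mul1r : right_id ext_one ext_mul.
Proof.
move=> a; apply/ffunP => S; rewrite ffunE (bigD1 S) ?inE ?subxx //=.
rewrite setDv ffunE eqxx inversions0r expr0 mul1r mulr1.
rewrite big1 ?addr0 // => A; rewrite ffunE inE => /andP[sAS nAS].
rewrite setD_eq0 (_ : S \subset A = false) ?mulr0 //.
by apply: contraNF nAS => sSA; rewrite eqEsubset sAS.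
Qed.

Lemma ext_mulDl : left_distributive ext_mul +%R.
Proof.
move=> a b c; apply/ffunP => S; rewrite !ffunE -big_split /=.
by apply: eq_bigr => A _; rewrite ffunE mulrDl mulrDr.
Qed.

Lemma ext_mulDr : right_distributive ext_mul +%R.
Proof.
move=> a b c; apply/ffunP => S; rewrite !ffunE -big_split /=.
by apply: eq_bigr => A _; rewrite ffunE mulrDr mulrDr.
Qed.

Lemma ext_one_neq0 : ext_one != 0.
Proof. by apply/eqP => /ffunP/(_ set0)/eqP; rewrite !ffunE eqxx oner_eq0. Qed.

HB.instance Definition _ := GRing.Zmodule_isNzRing.Build (extalg C n)
  ext_mulA ext_mul1l ext_mul1r ext_mulDl ext_mulDr ext_one_neq0.

Lemma ext_scaleAl (k : C) a b : k *: (a * b) = (k *: a) * b.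
Proof.
apply/ffunP => S; rewrite !ffunE /GRing.scale /= mulr_sumr.
apply: eq_bigr => A _; rewrite ffunE -[k *: a A]/(k * a A).
by rewrite mulrCA; congr (_ * _); rewrite mulrA.
Qed.

HB.instance Definition _ := GRing.Lmodule_isLalgebra.Build C (extalg C n)
  ext_scaleAl.

Lemma ext_scaleAr (k : C) a b : k *: (a * b) = a * (k *: b).
Proof.
apply/ffunP => S; rewrite !ffunE /GRing.scale /= mulr_sumr.
apply: eq_bigr => A _; rewrite ffunE -[k *: b _]/(k * b _).
by rewrite mulrCA; congr (_ * _); rewrite mulrCA.
Qed.

HB.instance Definition _ := GRing.Lalgebra_isAlgebra.Build C (extalg C n)
  ext_scaleAr.

Definition dx (i : 'I_n) : extalg C n :=
  [ffun S : {set 'I_n} => (S == [set i])%:R].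

Definition ext_part (d : nat) a : extalg C n :=
  [ffun S : {set 'I_n} => if #|S| == d then a S else 0].

End ExteriorAlgebra.

(* The inverse of [a] whenever [(1 - a) ^+ N = 0]; for polynomials with
   constant coefficient 1, the inverse of [a] modulo ['X^N]. *)
Definition geom_inv (A : pzRingType) (N : nat) (a : A) : A :=
  \sum_(j < N) (1 - a) ^+ j.

Section CharacteristicForms.
Variables (C : numClosedFieldType) (n : nat).
Implicit Types (w : extalg C n) (m : nat).

Definition scale_formmx m (c : C) (A : 'M[extalg C n]_m) : 'M[extalg C n]_m :=
  map_mx ( *:%R c) A.

(* The arguments of the series below are matrices of forms of positive degree,
   hence their powers of exponent > n vanish and the sums are the full
   series. *)
Definition exp_formmx m (A : 'M[extalg C n]_m) : 'M[extalg C n]_m :=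
  \sum_(j < n.+1) scale_formmx (j`!%:R^-1) (A ^+ j).

Definition cosh_formmx m (A : 'M[extalg C n]_m) : 'M[extalg C n]_m :=
  \sum_(j < n.+1) scale_formmx ((2 * j)`!%:R^-1) (A ^+ (2 * j)).

(* sinh A / A *)
Definition sinhc_formmx m (A : 'M[extalg C n]_m) : 'M[extalg C n]_m :=
  \sum_(j < n.+1) scale_formmx ((2 * j).+1`!%:R^-1) (A ^+ (2 * j)).

(* A / sinh A *)
Definition x_over_sinh m (A : 'M[extalg C n]_m) : 'M[extalg C n]_m :=
  geom_inv n.+1 (sinhc_formmx A).

(* A / tanh A *)
Definition x_over_tanh m (A : 'M[extalg C n]_m) : 'M[extalg C n]_m :=
  cosh_formmx A * geom_inv n.+1 (sinhc_formmx A).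

(* The binomial coefficient of 1/2 over j. *)
Definition binom_half (j : nat) : C :=
  (\prod_(i < j) (2^-1 - i%:R)) / j`!%:R.

(* The square root of a form of even degree whose degree 0 component c is
   positive: w = c (1 + nu) with nu nilpotent, and
   w^(1/2) = c^(1/2) \sum_j binom(1/2, j) nu^j. *)
Definition sqrt_form w : extalg C n :=
  sqrtC (w set0) *:
    \sum_(j < n.+1) binom_half j *: ((w set0)^-1 *: w - 1) ^+ j.

(* The entries commute, so \det is the usual determinant. *)
Definition det_half m (A : 'M[extalg C n]_m) : extalg C n :=
  sqrt_form (\det A).

End CharacteristicForms.

From mathcomp Require Import boolp classical_sets reals topology normedtype.
From mathcomp Require Import derive trigo.
From mathcomp Require Import complex mxtens.
(* The notations of [mpoly] clash with those of MathComp-Analysis. *)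
From mathcomp Require Import -(notations) freeg mpoly.
Import numFieldTopology.Exports numFieldNormedType.Exports.

Notation form R n := (extalg R[i] n).

Section ChernWeil.
Variables (R : realType) (n : nat).
Implicit Types Om : 'M[form R n]_n.

Definition imag_over (c : R) : R[i] := 'i / c%:C%C.

Definition Ahat Om : form R n :=
  det_half (x_over_sinh (scale_formmx (imag_over (4 * pi)) Om)).

(* (i/2pi) Om / tanh ((i/4pi) Om) = 2 A / tanh A with A = (i/4pi) Om *)
Definition Lhat Om : form R n :=
  det_half (scale_formmx 2
    (x_over_tanh (scale_formmx (imag_over (4 * pi)) Om))).

Definition ch m (F : 'M[form R n]_m) : form R n :=
  \tr (exp_formmx (scale_formmx (imag_over (2 * pi)) F)).

(* A complex vector bundle with connection, seen at one point: its rank and its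
   curvature matrix F in a local frame (e_t), where F e_t = \sum_s F_st e_s. *)
Record bundle := Bundle { rank : nat; curv : 'M[form R n]_rank }.

Definition trivial_line : bundle := Bundle (0 : 'M_1).

Definition tensor (E F : bundle) : bundle :=
  Bundle (tensmx (curv E) (1%:M : 'M_(rank F))
          + tensmx (1%:M : 'M_(rank E)) (curv F)).

(* The fibre of the i-th exterior power has the frame
   e_T = e_(t_1) /\ ... /\ e_(t_i), T = {t_1 < ... < t_i}, on which the
   curvature acts as a derivation.  Replacing e_t by e_s in e_T gives 0 if
   s \in T :\ t, and otherwise e_(s |: T :\ t) up to the sign that counts the
   transpositions moving e_t to the front and e_s to its place. *)
Definition ext_index (m i : nat) : {set {set 'I_m}} :=
  [set S : {set 'I_m} | #|S| == i].

Definition ext_sign (m : nat) (T : {set 'I_m}) (t s : 'I_m) : form R n :=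
  (-1) ^+ (#|[set u in T | (u < t)%N]| + #|[set u in T | (u < s)%N]|).

Definition ext_power (i : nat) (E : bundle) : bundle :=
  @Bundle #|ext_index (rank E) i|
    (\matrix_(a, b)
       let S : {set 'I_(rank E)} := enum_val a in
       let T : {set 'I_(rank E)} := enum_val b in
       \sum_(t in T)
         \sum_(s | (s \notin T :\ t) && (S == s |: (T :\ t)))
            ext_sign (T :\ t) t s * curv E s t).

End ChernWeil.

(* Formal differences of bundles built from a bundle E of rank n: integral
   combinations of tensor products of the exterior powers of E.  The variable
   of index i stands for the (i+1)-st exterior power, the monomial
   \prod_i X_i^(m i) for the tensor product of these bundles, and 1 for the
   trivial line bundle. *)
Definition virtual (n : nat) : comNzRingType := mpoly n int.

Section Virtual.
Variable n : nat.

Definition Lambda (i : nat) : virtual n :=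
  if i is j.+1 then
    if insub j is Some o then mpolyX int (mnm1 o) else 0
  else 1.

Definition monomial_bundle (R : realType) (d : nat) (E : bundle R d)
    (m : multinom n) : bundle R d :=
  foldr (@tensor R d) (trivial_line R d)
    (flatten [seq nseq (m i) (ext_power i.+1 E) | i <- enum 'I_n]).

Definition ch_virtual (R : realType) (d : nat) (E : bundle R d)
    (p : virtual n) : form R d :=
  \sum_(m <- msupp p) (mcoeff m p)%:~R *: ch (curv (monomial_bundle E m)).

(* Power series in q^(1/2), the indeterminate being 'X, are computed modulo
   'X^N, with [t] a polynomial without constant term. *)

Definition Lambda_series (t : {poly virtual n}) : {poly virtual n} :=
  \sum_(i < n.+1) (Lambda i)%:P * t ^+ i.

(* \Lambda_t(E - C^n) = \Lambda_t(E) / (1 + t)^n *)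
Definition Lambda_tilde (N : nat) (t : {poly virtual n}) : {poly virtual n} :=
  Lambda_series t * geom_inv N ((1 + t) ^+ n).

Definition S_tilde (N : nat) (t : {poly virtual n}) : {poly virtual n} :=
  geom_inv N (Lambda_tilde N (- t)).

(* The omitted factors are 1 modulo 'X^N. *)
Definition Theta2 (N : nat) : {poly virtual n} :=
  \prod_(1 <= m < N.+1) S_tilde N 'X^(2 * m) *
  \prod_(1 <= m < N.+1) Lambda_tilde N (- 'X^(2 * m - 1)).

Definition B_class (j : nat) : virtual n := (Theta2 j.+1)`_j.

End Virtual.

(* theta_1 = 2 q^(1/8) theta1_red *)
Definition theta1_red (N : nat) : {poly int} :=
  \prod_(1 <= j < N.+1) ((1 - 'X^(2 * j)) * (1 + 'X^(2 * j)) ^+ 2).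

Definition theta3 (N : nat) : {poly int} :=
  \prod_(1 <= j < N.+1) ((1 - 'X^(2 * j)) * (1 + 'X^(2 * j - 1)) ^+ 2).

(* theta_1^4 = 16 q^(1/2) theta1_red^4 *)
Definition delta2_8 (N : nat) : {poly int} :=
  - (16%:P * 'X * theta1_red N ^+ 4 + theta3 N ^+ 4).

Definition eps2 (N : nat) : {poly int} :=
  'X * theta1_red N ^+ 4 * theta3 N ^+ 4.

Definition bcoef (k r j : nat) : int :=
  (delta2_8 k.+1 ^+ (2 * k + 1 - 2 * r) * eps2 k.+1 ^+ r)`_j.

(* Comparing the coefficients of 'X^r determines b_r, as bcoef k r j is 0 for
   j < r and -1 for j = r. *)
Fixpoint b_seq (n k r : nat) : seq (virtual n) :=
  if r is r'.+1 then
    let s := b_seq n k r' in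
    rcons s (\sum_(i < r') s`_i * (bcoef k i r')%:~R - B_class n r')
  else [::].

Definition b_class (n k r : nat) : virtual n := (b_seq n k r.+1)`_r.

Lemma b_class_congr (n k j : nat) : (j <= k)%N ->
  (\sum_(r < k.+1) (b_class n k r)%:P *
     map_poly intr (delta2_8 k.+1 ^+ (2 * k + 1 - 2 * r) * eps2 k.+1 ^+ r))`_j
  = B_class n j.
Proof.
have size_b r : size (b_seq n k r) = r.
  by elim: r => //= r IH; rewrite size_rcons IH.
have nth_b r i : (i < r)%N -> (b_seq n k r)`_i = b_class n k i.
  elim: r => //= r IH; rewrite ltnS leq_eqVlt nth_rcons size_b.
  case/orP => [/eqP->|lt_ir]; last by rewrite lt_ir IH.
  by rewrite /b_class /= nth_rcons size_b.
have th1 (N : nat) : (theta1_red N)`_0 = 1.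
  rewrite -horner_coef0 horner_prod big_nat big1 // => -[//|i] _.
  rewrite mulnS !addSn ?subn1 /= !hornerE /= !exprS.
  by rewrite !(mul0r, subr0, addr0, mulr1).
have th3 (N : nat) : (theta3 N)`_0 = 1.
  rewrite -horner_coef0 horner_prod big_nat big1 // => -[//|i] _.
  rewrite mulnS !addSn ?subn1 /= !hornerE /= !exprS.
  by rewrite !(mul0r, subr0, addr0, mulr1).
have bc r i : (r <= k)%N -> (i <= r)%N ->
    bcoef k r i = if i == r then -1 else 0.
  move=> le_rk le_ir; rewrite /bcoef /eps2 -mulrA exprMn mulrCA coefXnM.
  move: le_ir; rewrite leq_eqVlt => /orP[/eqP->|lt_ir]; last first.
    by rewrite lt_ir ltn_eqF.
  rewrite ltnn eqxx subnn -horner_coef0 !hornerE /= horner_coef0 horner_coef0.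
  rewrite th1 !th3 !expr1n !mulr1 addnC -addnBA ?leq_mul2l //.
  by rewrite -mulnBr -signr_odd oddD oddM.
have b_rec : b_class n k j =
    \sum_(0 <= r < j) b_class n k r * (bcoef k r j)%:~R - B_class n j.
  rewrite {1}/b_class /= nth_rcons size_b ltnn eqxx big_mkord.
  by congr (_ - _); apply: eq_bigr => r _; rewrite nth_b.
move=> le_jk; rewrite coef_sum.
under eq_bigr => r _ do rewrite coefCM coef_map.
rewrite -(big_mkord xpredT (fun r => b_class n k r * (bcoef k r j)%:~R)).
rewrite (big_cat_nat (n := j.+1)) //= big_nat_recr //= bc // eqxx.
have -> : \sum_(j.+1 <= r < k.+1) b_class n k r * (bcoef k r j)%:~R = 0.
  rewrite big_nat big1 // => r /andP[lt_jr le_rk].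
  by rewrite bc ?(ltnW lt_jr) // (ltn_eqF lt_jr) mulr0.
by rewrite addr0 {1}b_rec mulrN1 opprB addrCA subrr addr0.
Qed.

Local Open Scope classical_set_scope.

Section LocalGeometry.
Variables (R : realType) (n : nat).
Implicit Types (U : set 'rV[R]_n) (f : 'rV[R]_n -> R) (g : 'rV[R]_n -> 'M[R]_n).

Definition partial (i : 'I_n) f : 'rV[R]_n -> R :=
  fun x => 'D_(delta_mx 0 i) f x.

Fixpoint C_class (m : nat) U f : Prop :=
  (forall x, U x -> {for x, continuous f}) /\
  (if m is m'.+1 then
     forall i : 'I_n, (forall x, U x -> derivable f x (delta_mx 0 i)) /\
       C_class m' U (partial i f)
   else True).

Definition smooth U f : Prop := forall m, C_class m U f.

Definition christoffel g (l j k : 'I_n) (x : 'rV[R]_n) : R :=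
  2^-1 * \sum_m invmx (g x) l m *
    (partial j (fun y => g y m k) x + partial k (fun y => g y m j) x
     - partial m (fun y => g y j k) x).

Lemma partial_sym g U x (i j k : 'I_n) :
  open U -> U x -> (forall y, U y -> (g y)^T = g y) ->
  partial i (fun y => g y j k) x = partial i (fun y => g y k j) x.
Proof.
move=> oU Ux gT; apply: near_eq_derive.
by near=> y; rewrite -[in LHS]gT ?mxE //; near: y; exact: open_nbhs_nbhs.
Unshelve. all: by end_near. Qed.

(* The two properties that characterize the Levi-Civita connection. *)
Lemma christoffel_torsion_free g U x (l j k : 'I_n) :
  open U -> U x -> (forall y, U y -> (g y)^T = g y) ->
  christoffel g l j k x = christoffel g l k j x.
Proof.
move=> oU Ux gT; congr (_ * _); apply: eq_bigr => m _; congr (_ * _).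
by rewrite (partial_sym m j k oU Ux gT) [X in X - _]addrC.
Qed.

Lemma christoffel_metric g U x (i j k : 'I_n) :
  open U -> U x -> (forall y, U y -> (g y)^T = g y) -> g x \in unitmx ->
  partial i (fun y => g y j k) x =
  \sum_l (christoffel g l i j x * g x l k + christoffel g l i k x * g x j l).
Proof.
move=> oU Ux gT gU.
have lower a b c : \sum_l christoffel g l b c x * g x a l =
    2^-1 * (partial b (fun y => g y a c) x + partial c (fun y => g y a b) x
            - partial a (fun y => g y b c) x).
  under eq_bigr => l _ do rewrite -mulrA mulr_suml.
  rewrite -mulr_sumr; congr (_ * _); rewrite exchange_big /=.
  transitivity (\sum_m (1%:M : 'M[R]_n) a m *
    (partial b (fun y => g y m c) x + partial c (fun y => g y m b) x
     - partial m (fun y => g y b c) x)).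
    apply: eq_bigr => m _; rewrite -(mulmxV gU) mxE mulr_suml.
    by apply: eq_bigr => l _; rewrite mulrC mulrA.
  rewrite (bigD1 a) //= mxE eqxx mul1r big1 ?addr0 // => m /negPf am.
  by rewrite mxE eq_sym am mul0r.
rewrite big_split /= lower.
under eq_bigr => l _ do rewrite -(gT x Ux) mxE.
rewrite lower (partial_sym i k j oU Ux gT) (partial_sym k j i oU Ux gT).
rewrite (partial_sym j k i oU Ux gT).
by field.
Qed.

(* lc_form is the matrix omega^l_k = \sum_i Gamma^l_ik dx_i of connection forms
   of the Levi-Civita connection in the coordinate frame, and the curvature is
   d omega + omega /\ omega. *)
Definition lc_form g (x : 'rV[R]_n) : 'M[form R n]_n :=
  \matrix_(l, k) \sum_i (christoffel g l i k x)%:C%C *: dx R[i] i.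

Definition d_lc_form g (x : 'rV[R]_n) : 'M[form R n]_n :=
  \matrix_(l, k) \sum_i \sum_j
    (partial i (christoffel g l j k) x)%:C%C *: (dx R[i] i * dx R[i] j).

Definition lc_curvature g (x : 'rV[R]_n) : 'M[form R n]_n :=
  d_lc_form g x + lc_form g x *m lc_form g x.

End LocalGeometry.

Record riemannianManifold (R : realType) (n : nat) := RiemannianManifold {
  points :> topologicalType;
  points_hausdorff : hausdorff_space points;
  points_second_countable : @second_countable points;
  chart : Type;
  chart_dom : chart -> set points;
  chart_cod : chart -> set 'rV[R]_n;
  coords : chart -> points -> 'rV[R]_n;
  coords_inv : chart -> 'rV[R]_n -> points;
  open_chart_dom : forall c, open (chart_dom c);
  open_chart_cod : forall c, open (chart_cod c);
  coordsP : forall c p, chart_dom c p -> chart_cod c (coords c p);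
  coords_invP : forall c x, chart_cod c x -> chart_dom c (coords_inv c x);
  coordsK : forall c p, chart_dom c p -> coords_inv c (coords c p) = p;
  coords_invK : forall c x, chart_cod c x -> coords c (coords_inv c x) = x;
  coords_continuous :
    forall c p, chart_dom c p -> {for p, continuous (coords c)};
  coords_inv_continuous :
    forall c x, chart_cod c x -> {for x, continuous (coords_inv c)};
  chart_cover : forall p, exists c, chart_dom c p;
  transition_smooth : forall (c c' : chart) (i : 'I_n),
    smooth [set x | chart_cod c x /\ chart_dom c' (coords_inv c x)]
      (fun x => coords c' (coords_inv c x) 0 i);
  metric : chart -> 'rV[R]_n -> 'M[R]_n;
  metric_smooth : forall c i j, smooth (chart_cod c) (fun x => metric c x i j);
  metric_sym : forall c x, chart_cod c x -> (metric c x)^T = metric c x;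
  metric_pos : forall c x (v : 'rV[R]_n), chart_cod c x -> v != 0 ->
    0 < (v *m metric c x *m v^T) 0 0;
  metric_transition : forall c c' p, chart_dom c p -> chart_dom c' p ->
    let J : 'M[R]_n := \matrix_(i, j)
      partial i (fun x => coords c' (coords_inv c x) 0 j) (coords c p) in
    metric c (coords c p) = J *m metric c' (coords c' p) *m J^T
}.

(* The curvature of the Levi-Civita connection of TM at p, a matrix of 2-forms
   in the coordinate frame of the chart c; it is also the curvature of T_C M
   with the induced connection. *)
Definition curvature (R : realType) (n : nat) (M : riemannianManifold R n)
    (c : chart M) (p : M) : 'M[form R n]_n :=
  lc_curvature (metric c) (coords c p).

Definition tangentC (R : realType) (n : nat) (Om : 'M[form R n]_n) :
    bundle R n := Bundle Om.

Definition h_form (R : realType) (n k : nat) (Om : 'M[form R n]_n) (r : nat) :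
    form R n :=
  ext_part n (Ahat Om * ch_virtual (tangentC Om) (b_class n k r)).

(* Main.v *)
Require Import Defs.
From HB Require Import structures.
From mathcomp Require Import all_boot all_order all_algebra.
From mathcomp Require Import ring zify.
From mathcomp Require Import qpoly.
From mathcomp Require Import reals topology normedtype derive trigo complex.
From mathcomp Require Import mxtens.
From mathcomp Require Import -(notations) freeg mpoly.

Set Implicit Arguments.
Unset Strict Implicit.
Unset Printing Implicit Defensive.

Import Order.TTheory GRing.Theory Num.Theory.

Local Open Scope ring_scope.

(** At a point, the curvature is a matrix [Om] of 2-forms, and both sides are built from the traces
    of its powers. A multiplicative genus with characteristic series x / F(x), F = x + ..., is
    determined by the coefficients of F. Suppose that F solves Jacobi's equation F'^2 = 1 - (d/4)
    F^2 + e F^4. The equation determines F recursively, and its coefficients are polynomials in d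
    and e, homogeneous when d has weight 4 and e has weight 8. Hence the component of degree 8k+4 of
    the genus is the sum over 0 <= r <= k of c_r d^(2k+1-2r) e^r, where the c_r depend on the
    curvature but not on d and e ([elliptic_rel], [log_der_rel], [trace_rel], [log_der_frel],
    [hrelP]).

    Two solutions are compared. Put p = q^(1/2), modulo p^(k+1). The theta quotient whose genus is
    Ahat ch(Theta_2) solves the equation with d = 8 delta_2 and e = eps_2 ([Theta_elliptic]). Its
    coefficients in p are the top parts of Ahat ch(B_j), and the triangular system that defines the
    b_r gives c_r = h_r. Over the dual numbers, q^2 = 0, the function 2 tanh(x/2) (1 - 2q (e^x +
    e^(-x) - 2)) solves it with d = 2 + 48q and e = 1/16 - q ([sign_elliptic]). Its genus is Lhat,
    rescaled to have constant term 1, times 1 + 2q (ch(T_C M) - n), where n = 8k+4. The coefficients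
    of 1 and q express the top parts of Lhat and Lhat ch(T_C M) through the same c_r, and in the
    combination with -16 the weight of c_r collapses to a multiple of k - r ([weight_identity]). The
    differential equation thus does the work of the modular transformation between the two cusps.

    The equation of the theta quotient ([theta_ode]) rests on the triple product, on two quadratic
    identities of Jacobi ([jacobi_phi], [jacobi_theta]) and on the Wronskian of two theta functions
    ([wronski_phi_theta]). All of this happens in rings where p is nilpotent, so every sum and
    product is finite.

    No Chern roots are used. Even forms are a commutative ring with the derivation [edeg] that
    multiplies a form by its degree, and a form with constant term 1 is determined by its
    logarithmic derivative. For square roots of determinants this derivative comes from Jacobi's
    formula ([log_der_det], [log_der_esqrt]), for exterior powers from a trace over the Fock space
    ([log_der_fock_trace]). Tangent roots come in pairs x, -x; in terms of traces this says that
    those of odd powers of the curvature vanish ([trace_curvature_lift_odd]), which follows from the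
    skew symmetry of the curvature. *)

Lemma sum_support (T : eqType) (V : nmodType) (s1 s2 : seq T) (G : T -> V) :
  uniq s1 -> uniq s2 -> (forall x, G x != 0 -> (x \in s1) && (x \in s2)) ->
  \sum_(x <- s1) G x = \sum_(x <- s2) G x.
Proof.
move=> u1 u2 H.
have red s : \sum_(x <- s) G x = \sum_(x <- [seq x <- s | G x != 0]) G x.
  rewrite big_filter (bigID (fun x => G x == 0)) /= big1 ?add0r //.
  by move=> x /eqP.
rewrite (red s1) (red s2); apply/perm_big/uniq_perm; rewrite ?filter_uniq // => x.
rewrite !mem_filter; case: (boolP (G x == 0)) => //= nz.
by have /andP[-> ->] := H _ nz.
Qed.

(** * Bilateral sums over the integers, truncated to a box *)

Definition zbox (B : nat) : seq int := [seq i%:Z - B%:Z | i <- iota 0 B.*2.+1].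
Arguments zbox : simpl never.

Lemma mem_zbox (B : nat) (x : int) : (x \in zbox B) = (`|x| <= B)%N.
Proof.
apply/mapP/idP => [[i Hi ->]|le_xB].
  move: Hi; rewrite mem_iota add0n ltnS -addnn => /andP[_ H].
  by case: (leqP B i) => h; lia.
exists (absz (x + B%:Z)); last by lia.
by rewrite mem_iota add0n ltnS -addnn; lia.
Qed.

Lemma zbox_uniq (B : nat) : uniq (zbox B).
Proof.
rewrite map_inj_uniq; first exact: iota_uniq.
by move=> i j /addIr [].
Qed.

(** As long as the support stays inside the box before and after, a truncated sum can be reindexed
    like a sum over all integers. *)
Lemma sum_zbox_map (V : nmodType) (B : nat) (s : int -> int) (G : int -> V) :
  injective s ->
  (forall x, G x != 0 -> (`|x| <= B)%N /\ exists2 y, (`|y| <= B)%N & x = s y) ->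
  \sum_(x <- zbox B) G (s x) = \sum_(x <- zbox B) G x.
Proof.
move=> s_inj H; rewrite -(big_map s xpredT G).
apply: sum_support; first by rewrite map_inj_uniq ?zbox_uniq.
  exact: zbox_uniq.
by move=> x /H[xB [y yB e]]; rewrite [in X in X && _]e map_f mem_zbox.
Qed.

(** Pairs with m + n even are those of the form (a+b, a-b), pairs with m + n odd those of the form
    (a+b+1, a-b). This change of variables drives every quadratic theta identity below. *)
Lemma sum_zbox_pair (V : nmodType) (B : nat) (F : int -> int -> V) :
  (forall m n, F m n != 0 -> (`|m| < B)%N && (`|n| < B)%N) ->
  \sum_(m <- zbox B) \sum_(n <- zbox B) F m n =
  \sum_(a <- zbox B) \sum_(b <- zbox B) F (a + b) (a - b) +
  \sum_(a <- zbox B) \sum_(b <- zbox B) F (a + b + 1) (a - b).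
Proof.
move=> H; pose bx := [seq (m, n) | m <- zbox B, n <- zbox B].
have pairE G : \sum_(m <- zbox B) \sum_(n <- zbox B) G m n =
    \sum_(x <- bx) G x.1 x.2 :> V by rewrite big_allpairs.
pose h1 x : int * int := (x.1 + x.2, x.1 - x.2).
pose h2 x : int * int := (x.1 + x.2 + 1, x.1 - x.2).
rewrite (pairE F) (pairE (fun a b => F (a + b) (a - b))).
rewrite (pairE (fun a b => F (a + b + 1) (a - b))).
rewrite -(big_map h1 xpredT (fun x => F x.1 x.2)).
rewrite -(big_map h2 xpredT (fun x => F x.1 x.2)) -big_cat.
have ubx : uniq bx by rewrite allpairs_uniq ?zbox_uniq // => -[? ?] [? ?].
have mem_bx m n : ((m, n) \in bx) = (`|m| <= B)%N && (`|n| <= B)%N.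
  rewrite -!mem_zbox; apply/allpairsP/andP => [[[x y] [? ? [-> ->]]] //|[? ?]].
  by exists (m, n).
apply: sum_support => //.
  have i1 : injective h1 by move=> [a b] [c d] [] e1 e2; congr pair; lia.
  have i2 : injective h2 by move=> [a b] [c d] [] e1 e2; congr pair; lia.
  rewrite cat_uniq (map_inj_uniq i1) (map_inj_uniq i2) ubx andbT andTb.
  apply/hasPn => -[m n] /mapP[[a b] _ [-> ->]].
  by apply/mapP => -[[c d] _ []]; lia.
move=> [m n] /H /andP[mB nB].
have {}mB : (`|m| < B)%N := mB; have {}nB : (`|n| < B)%N := nB.
rewrite mem_bx (ltnW mB) (ltnW nB) !andTb mem_cat.
(* [a] is half of m + n, rounded down; the strict bounds on m and n keep both new coordinates in the
   box. *)
have [a e] : exists a : int, m + n = a + a \/ m + n = a + a + 1.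
  by exists ((m + n) %/ 2)%Z; lia.
have bxa (b : int) : m + n = a + a \/ m + n = a + a + 1 ->
    a + b = m \/ a + b = m - 1 -> (a, b) \in bx.
  by move=> ? ?; rewrite mem_bx; lia.
case: e => e; apply/orP; [left|right]; apply/mapP.
  exists (a, m - a); first by apply: bxa; lia.
  by congr pair; rewrite /=; lia.
exists (a, m - 1 - a); first by apply: bxa; lia.
by congr pair; rewrite /=; lia.
Qed.

(** * Gaussian binomials and the Jacobi triple product *)

Fixpoint qbinom (K : comNzRingType) (Q : K) (m i : nat) : K :=
  match m, i with
  | _, 0 => 1
  | 0, _.+1 => 0
  | m'.+1, i'.+1 => qbinom Q m' i' + Q ^+ i'.+1 * qbinom Q m' i'.+1
  end.

Definition qfact (K : comNzRingType) (Q : K) (m : nat) : K :=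
  \prod_(i < m) (1 - Q ^+ i.+1).

Section GaussianBinomial.
Variables (K : comNzRingType) (Q : K).

Lemma qbinom0 m : qbinom Q m 0 = 1. Proof. by case: m. Qed.

Lemma qbinomSl m i :
  qbinom Q m.+1 i.+1 = qbinom Q m i + Q ^+ i.+1 * qbinom Q m i.+1.
Proof. by []. Qed.

Lemma qbinom_small m i : (m < i)%N -> qbinom Q m i = 0.
Proof.
elim: m i => [|m IH] [|i] //= lt_mi.
by rewrite !IH ?mulr0 ?addr0 // ltnW.
Qed.

Lemma qbinomnn m : qbinom Q m m = 1.
Proof. by elim: m => //= m ->; rewrite qbinom_small // mulr0 addr0. Qed.

(** The mirror form of the q-Pascal rule that serves as definition; it is derived from that rule by
    induction on the upper index. *)
Lemma qbinomSr m i : (i <= m)%N ->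
  qbinom Q m.+1 i.+1 = Q ^+ (m - i) * qbinom Q m i + qbinom Q m i.+1.
Proof.
elim: m i => [|m IH] i.
  by rewrite leqn0 => /eqP ->; rewrite /= !mulr0 !addr0 expr0 mul1r.
rewrite leq_eqVlt => /orP[/eqP ->|].
  by rewrite subnn !qbinomnn qbinom_small // mulr1 addr0.
rewrite ltnS => le_im.
have step m' i' : qbinom Q m'.+1 i'.+1 =
  qbinom Q m' i' + Q ^+ i'.+1 * qbinom Q m' i'.+1 by [].
rewrite step [in LHS](IH _ le_im) [qbinom Q m.+1 i.+1 in RHS]step.
case: i le_im => [|i] le_im.
  rewrite !qbinom0 !mulr1 expr1 subn0 exprSr.
  by ring.
rewrite [in LHS](IH _ (ltnW le_im)) [qbinom Q m.+1 _]step subSS.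
have -> : (m - i = (m - i.+1).+1)%N by lia.
set e := (m - i.+1)%N.
by rewrite (exprS Q i.+1) (exprS Q i) (exprS Q e); ring.
Qed.

Lemma qfactS m : qfact Q m.+1 = qfact Q m * (1 - Q ^+ m.+1).
Proof. by rewrite /qfact big_ord_recr. Qed.

(** The quotient formula for Gaussian binomials, written without division because [Q] is an
    arbitrary ring element. *)
Lemma qbinom_fact m i : (i <= m)%N ->
  qbinom Q m i * (qfact Q i * qfact Q (m - i)) = qfact Q m.
Proof.
elim: m i => [|m IH] [|i] //= le_im.
- by rewrite /qfact big_ord0 !mul1r.
- by rewrite subn0 /qfact big_ord0 !mul1r.
have [->|lt_im] := eqVneq i m.
  by rewrite qbinomnn qbinom_small // subnn /qfact big_ord0; ring.
have {lt_im}lt_im : (i < m)%N by rewrite ltn_neqAle lt_im.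
rewrite subSS !qfactS mulrDl.
transitivity (qbinom Q m i * (qfact Q i * qfact Q (m - i)) * (1 - Q ^+ i.+1) +
  Q ^+ i.+1 * (1 - Q ^+ (m - i)) *
  (qbinom Q m i.+1 * (qfact Q i.+1 * qfact Q (m - i.+1)))).
  rewrite -(subnSK lt_im) !qfactS; ring.
rewrite (IH i (ltnW lt_im)) (IH i.+1 lt_im).
have -> : Q ^+ m.+1 = Q ^+ i.+1 * Q ^+ (m - i) by rewrite -exprD; congr (_ ^+ _); lia.
ring.
Qed.
End GaussianBinomial.
Arguments qbinom : simpl never.

(* The theta series attached to [a], [b] with [a * b = Q]: its n-th term is
   Q^(n(n-1)/2) a^n, where a^-1 stands for b / Q. *)
Definition jacobi_term (K : comNzRingType) (Q a b : K) (j : int) : K :=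
  match j with
  | Posz n => Q ^+ 'C(n, 2) * a ^+ n
  | Negz n => Q ^+ 'C(n.+1, 2) * b ^+ n.+1
  end.

Section TripleProduct.
Variables (K : comNzRingType) (Q a b : K).
Hypothesis ab : a * b = Q.
Local Notation T := (jacobi_term Q a b).

(** The ratio of two consecutive terms, of index j and j+1, is Q^j a. Both sides carry powers of [Q]
    that keep the exponents nonnegative. *)
Lemma jacobi_termSl (n i : nat) : (i <= n.*2)%N ->
  Q ^+ n * a * T (i%:Z - n%:Z) = Q ^+ (n.*2 - i) * T (i.+1%:Z - n%:Z).
Proof.
move=> le_i2n; case: (leqP n i) => [le_ni|lt_in].
  have -> : i%:Z - n%:Z = Posz (i - n) by lia.
  have -> : i.+1%:Z - n%:Z = Posz (i - n).+1 by lia.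
  rewrite /jacobi_term binS bin1 exprS.
  have -> : Q ^+ n = Q ^+ (n.*2 - i) * Q ^+ (i - n).
    by rewrite -exprD; congr (_ ^+ _); rewrite -addnn; rewrite -addnn in le_i2n; lia.
  by rewrite [in RHS]exprD; ring.
have -> : i%:Z - n%:Z = Negz (n - i).-1 by lia.
have [->|ne] := eqVneq n i.+1.
  have -> : ((i.+1).*2 - i = i.+2)%N by rewrite -addnn; lia.
  rewrite subSn // subnn subrr -[0]/(Posz 0) /jacobi_term !bin_small // !expr0.
  by rewrite expr1 !mul1r mulr1 -mulrA ab [RHS]exprSr.
have -> : i.+1%:Z - n%:Z = Negz (n - i).-2 by lia.
rewrite /jacobi_term.
have -> : ((n - i).-1 = (n - i).-2.+1)%N by lia.
rewrite [in LHS]binS bin1 exprD [b ^+ _.+2]exprS.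
have -> : Q ^+ (n.*2 - i) = Q ^+ n * Q ^+ (n - i).-2.+1 * (a * b).
  by rewrite ab -exprD -exprSr; congr (_ ^+ _); rewrite -addnn; lia.
by ring.
Qed.

Lemma jacobi_termSr (n i : nat) :
  Q ^+ n * b * T (i%:Z - n%:Z) = Q ^+ i * T (i%:Z - n.+1%:Z).
Proof.
case: (leqP i n) => [le_in|lt_ni].
  have -> : i%:Z - n.+1%:Z = Negz (n - i) by lia.
  have -> : Q ^+ n = Q ^+ i * Q ^+ (n - i).
    by rewrite -exprD; congr (_ ^+ _); lia.
  case e: (n - i)%N => [|j].
    have -> : i%:Z - n%:Z = 0 by lia.
    by rewrite /jacobi_term /= bin_small // !expr0 !expr1; ring.
  have -> : i%:Z - n%:Z = Negz j by lia.
  rewrite /jacobi_term [in RHS]binS bin1 [in RHS]exprD [b ^+ j.+2]exprS; ring.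
have -> : i%:Z - n%:Z = Posz (i - n.+1).+1 by lia.
have -> : i%:Z - n.+1%:Z = Posz (i - n.+1) by lia.
rewrite /jacobi_term binS bin1 exprD exprS.
have -> : Q ^+ i = Q ^+ n * (a * b) * Q ^+ (i - n.+1).
  by rewrite ab -exprSr -exprD; congr (_ ^+ _); lia.
by ring.
Qed.

(** Induction on n. The new factor in [a] turns row 2n of the Gaussian triangle into row 2n+1 by one
    q-Pascal rule; the new factor in [b] turns that into row 2n+2 by the other, and recentres the
    sum. *)
Lemma finite_triple_product (n : nat) :
  \prod_(m < n) ((1 + Q ^+ m * a) * (1 + Q ^+ m * b)) =
  \sum_(i < n.*2.+1) qbinom Q n.*2 i * T (i%:Z - n%:Z).
Proof.
elim: n => [|n IH].
  by rewrite big_ord0 big_ord1 /= bin_small // expr0 !mulr1.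
rewrite big_ord_recr /= {}IH mulrA.
have -> : (\sum_(i < n.*2.+1) qbinom Q n.*2 i * T (i%:Z - n%:Z)) *
    (1 + Q ^+ n * a) =
    \sum_(i < n.*2.+2) qbinom Q n.*2.+1 i * T (i%:Z - n%:Z).
  rewrite mulrDr mulr1 [in RHS]big_ord_recl /= qbinom0 mul1r.
  rewrite [X in X + _]big_ord_recl /= qbinom0 mul1r -addrA; congr (_ + _).
  rewrite big_distrl /= [RHS](eq_bigr (fun i : 'I_n.*2.+1 =>
    qbinom Q n.*2 i.+1 * T (i.+1%:Z - n%:Z) +
    qbinom Q n.*2 i * T (i%:Z - n%:Z) * (Q ^+ n * a))); last first.
    move=> i _; rewrite /bump /= add1n qbinomSr ?leq_ord // mulrDl [X in _ = _ + X]mulrC mulrCA.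
    by rewrite jacobi_termSl ?leq_ord // addrC; congr (_ + _); ring.
  rewrite big_split /=; congr (_ + _).
  by rewrite [RHS]big_ord_recr /= qbinom_small // mul0r addr0.
rewrite mulrDr mulr1 doubleS [in RHS]big_ord_recl /= qbinom0 mul1r.
rewrite big_distrl /= [X in _ + X]big_ord_recl /= qbinom0 mul1r.
rewrite mulrC jacobi_termSr expr0 mul1r addrCA; congr (_ + _).
rewrite [RHS](eq_bigr (fun i : 'I_n.*2.+2 =>
    qbinom Q n.*2.+1 i * T (i%:Z - n%:Z) +
    qbinom Q n.*2.+1 i.+1 * T (i.+1%:Z - n%:Z) * (Q ^+ n * b))); last first.
  move=> i _; rewrite /bump /= add1n.
  rewrite [qbinom _ n.*2.+2 _]qbinomSl mulrDl; congr (_ + _).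
    by congr (_ * T _); lia.
  by rewrite [RHS]mulrC mulrCA jacobi_termSr; ring.
rewrite big_split /=; congr (_ + _).
by rewrite [RHS]big_ord_recr /= qbinom_small // mul0r mul0r addr0.
Qed.
End TripleProduct.

Lemma expr_nil (K : pzRingType) (x : K) (N m : nat) :
  x ^+ N = 0 -> (N <= m)%N -> x ^+ m = 0.
Proof. by move=> xN /subnK <-; rewrite exprD xN mulr0. Qed.

Lemma one_sub_nil_inv (K : pzRingType) (x : K) (N : nat) :
  x ^+ N = 0 -> (1 - x) * \sum_(j < N) x ^+ j = 1.
Proof. by move=> xN; rewrite -opprB mulNr -subrX1 xN sub0r opprK. Qed.

Section NilpotentTripleProduct.
Variables (K : comNzRingType) (Q : K) (N : nat).
Hypothesis QN : Q ^+ N = 0.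

Lemma qfact_stable m : (N <= m)%N -> qfact Q m = qfact Q N.
Proof.
move=> /subnK <-; elim: (m - N)%N => //= d IH.
rewrite addSn qfactS IH (expr_nil QN) ?subr0 ?mulr1 //; lia.
Qed.

(** Each factor is 1 minus a nilpotent element, hence invertible by a finite geometric series. *)
Lemma qfact_inv m : exists v, qfact Q m * v = 1.
Proof.
elim: m => [|m [v IH]]; first by exists 1; rewrite /qfact big_ord0 mul1r.
exists (v * \sum_(j < N) (Q ^+ m.+1) ^+ j); rewrite qfactS mulrACA IH mul1r.
by apply: one_sub_nil_inv; rewrite -exprM (expr_nil QN) // mulSn leq_addr.
Qed.

Variables (a b : K).
Hypothesis ab : a * b = Q.
Local Notation T := (jacobi_term Q a b).

Lemma jacobi_term_nil j : (N < `|j|)%N -> T j = 0.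
Proof.
have le n : (N < n)%N -> (N <= 'C(n, 2))%N.
  by case: n => // n; rewrite ltnS binS bin1 => /leq_trans; apply; rewrite leq_addl.
by case: j => n /= lt_Nn; rewrite (expr_nil QN) ?mul0r ?le.
Qed.

(** The limit of the finite identity: the terms that survive are near the centre, where the Gaussian
    binomial has stabilized to the inverse of [qfact Q N]. *)
Lemma nilpotent_triple_product B : (N <= B)%N ->
  qfact Q N * \prod_(m < N) ((1 + Q ^+ m * a) * (1 + Q ^+ m * b)) =
  \sum_(j <- zbox B) T j.
Proof.
(* With n = 2N, both i and 2n - i are at least N whenever |i - n| <= N, so the three factorials in
   the Gaussian binomial all equal [qfact Q N]. *)
move=> le_NB; pose n := N.*2; have le_Nn : (N <= n)%N by rewrite /n -addnn leq_addl.
have -> : \prod_(m < N) ((1 + Q ^+ m * a) * (1 + Q ^+ m * b)) =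
    \prod_(m < n) ((1 + Q ^+ m * a) * (1 + Q ^+ m * b)).
  rewrite -!(big_mkord xpredT (fun m => (1 + Q ^+ m * a) * (1 + Q ^+ m * b))).
  rewrite [RHS](big_cat_nat (n := N)) //= [X in _ = _ * X]big_nat.
  rewrite [X in _ = _ * X]big1 ?mulr1 // => m /andP[le_Nm _].
  by rewrite (expr_nil QN) // !mul0r addr0 mulr1.
rewrite (finite_triple_product ab) mulr_sumr.
transitivity (\sum_(i < n.*2.+1) T (i%:Z - n%:Z)).
  apply: eq_bigr => i _; rewrite mulrA.
  case: (leqP (absz (i%:Z - n%:Z)) N) => [le_jN|/jacobi_term_nil ->]; last by rewrite !mulr0.
  have [v uv] := qfact_inv N.
  have ne : n = (N + N)%N by rewrite addnn.
  have ne2 : n.*2 = (n + n)%N by rewrite addnn.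
  have := qbinom_fact Q (m := n.*2) (i := i); rewrite -ltnS ltn_ord => /(_ isT).
  rewrite (qfact_stable (m := i)); last by lia.
  rewrite (qfact_stable (m := n.*2 - i)); last by lia.
  rewrite (qfact_stable (m := n.*2)); last by lia.
  move=> /(congr1 (fun x => x * v)); rewrite uv.
  have -> : qbinom Q n.*2 i * (qfact Q N * qfact Q N) * v =
    qfact Q N * qbinom Q n.*2 i * (qfact Q N * v) by ring.
  by rewrite uv mulr1 => ->; rewrite mul1r.
rewrite -(big_mkord xpredT (fun i => T (i%:Z - n%:Z))) /index_iota subn0.
rewrite -(big_map (fun i : nat => i%:Z - n%:Z) xpredT T).
apply: sum_support; [exact: zbox_uniq | exact: zbox_uniq |].
move=> x nz; rewrite -/(zbox n) !mem_zbox.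
by case: (leqP `|x| N) nz => [le _|/jacobi_term_nil ->]; [lia | rewrite eqxx].
Qed.
End NilpotentTripleProduct.

(** * Theta series and Jacobi's quadratic identities *)

Section IntPowers.
Variables (K : comNzRingType) (z z' : K).
Hypothesis zz' : z * z' = 1.

(** [z'] stands for the inverse of [z], so that negative exponents make sense in any commutative
    ring. *)
Definition zpow (m : int) : K :=
  match m with Posz n => z ^+ n | Negz n => z' ^+ n.+1 end.

Lemma zpow_sub (a b : nat) : zpow (a%:Z - b%:Z) = z ^+ a * z' ^+ b.
Proof.
have zz'X n : z ^+ n * z' ^+ n = 1 by rewrite -exprMn zz' expr1n.
case: (leqP b a) => [le_ba|lt_ab].
  have -> : a%:Z - b%:Z = Posz (a - b) by lia.
  by rewrite /= -{2}(subnK le_ba) exprD -mulrA zz'X mulr1.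
have -> : a%:Z - b%:Z = Negz (b - a).-1 by lia.
rewrite /= prednK ?subn_gt0 // -{2}(subnK (ltnW lt_ab)) exprD mulrCA zz'X.
by rewrite mulr1.
Qed.

Lemma zpowD (m n : int) : zpow (m + n) = zpow m * zpow n.
Proof.
have dec (x : int) : exists a b : nat, x = a%:Z - b%:Z.
  by exists (absz (x + `|x|)), (absz x); lia.
have [a [b ->]] := dec m; have [c [d ->]] := dec n.
have -> : a%:Z - b%:Z + (c%:Z - d%:Z) = (a + c)%N%:Z - (b + d)%N%:Z by lia.
by rewrite !zpow_sub !exprD mulrACA.
Qed.
End IntPowers.

Lemma zpow1 (K : comNzRingType) (m : int) : zpow (1 : K) 1 m = 1.
Proof. by case: m => n; rewrite /zpow expr1n. Qed.

Section ThetaSeries.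
Variables (K : comNzRingType) (p : K) (N : nat).
Hypothesis pN : p ^+ N = 0.
Local Notation B := N.+2.
Local Notation sg s := ((-1) ^+ s : K).

Definition ppow (e : int) : K := p ^+ absz e.

(** With nome p and z^2 = e^(2iv), these are the classical theta_3 ([s] false) and theta_4 ([s]
    true). [phi_sum] gives theta_2 ([s] false) and theta_1 ([s] true), stripped of the factor
    p^(1/4) and of a constant. *)
Definition theta_sum (s : bool) (z z' : K) : K :=
  \sum_(m <- zbox B) sg s ^+ absz m * ppow (m * m) * zpow z z' (m + m).

Definition phi_sum (s : bool) (z z' : K) : K :=
  \sum_(m <- zbox B) sg s ^+ absz m * ppow (m * (m + 1)) * zpow z z' (m + m + 1).

(** The series theta_3, and in [odd_sum] theta_2, at nome p^2 and argument z^2. Squares of all four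
    theta functions are combinations of these two. *)
Definition even_sum (z z' : K) : K :=
  \sum_(a <- zbox B) ppow (2 * (a * a)) * zpow z z' (4 * a).

Definition odd_sum (z z' : K) : K :=
  \sum_(a <- zbox B) ppow (2 * (a * (a + 1))) * zpow z z' (4 * a + 2).

Lemma ppow_nil (e : int) : (N <= absz e)%N -> ppow e = 0.
Proof. exact: expr_nil. Qed.

Lemma ppowM (x y u v : int) :
  0 <= x -> 0 <= y -> 0 <= u -> 0 <= v -> x + y = u + v ->
  ppow x * ppow y = ppow u * ppow v.
Proof. by move=> *; rewrite /ppow -!exprD; congr (_ ^+ _); lia. Qed.

Lemma mulzz_ge0 (m : int) : 0 <= m * m. Proof. by nia. Qed.
Lemma mulz2_ge0 (m : int) : 0 <= m -> 0 <= 2 * m. Proof. by lia. Qed.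
Lemma mulzS_ge0 (m : int) : 0 <= m * (m + 1). Proof. by nia. Qed.

Lemma absz_mulzz (m : int) : (`|m| <= absz (m * m)%R)%N. Proof. by nia. Qed.
Lemma absz_mulzS (m : int) : (`|m| <= (absz (m * (m + 1))%R).+1)%N.
Proof. by nia. Qed.

Lemma theta_supp m : ppow (m * m) != 0 -> (`|m| < N)%N.
Proof.
case: (ltnP `|m| N) => // le_Nm.
by rewrite ppow_nil ?eqxx //; apply: leq_trans le_Nm (absz_mulzz m).
Qed.

Lemma phi_supp m : ppow (m * (m + 1)) != 0 -> (`|m| < N.+1)%N.
Proof.
case: (ltnP `|m| N.+1) => // le_Nm.
rewrite ppow_nil ?eqxx // -ltnS; apply: leq_trans le_Nm (absz_mulzS m).
Qed.

Lemma sgD (s : bool) (m n : int) :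
  sg s ^+ absz m * sg s ^+ absz n = sg s ^+ absz (m + n).
Proof.
case: s; last by rewrite !expr1n mulr1.
by rewrite expr1 -exprD -signr_odd -[RHS]signr_odd; congr (_ ^+ nat_of_bool _); lia.
Qed.

Lemma sg_dbl (s : bool) (a : int) : sg s ^+ absz (a + a) = 1.
Proof. by rewrite -sgD -exprMn -expr2 sqrr_sign expr1n. Qed.

Lemma mul_supp (x y : K) : x * y != 0 -> (x != 0) && (y != 0).
Proof.
case: (eqVneq x 0) => [->|_]; first by rewrite mul0r eqxx.
by case: (eqVneq y 0) => [->|_] //; rewrite mulr0 eqxx.
Qed.

Lemma sum_zbox_mul (f g : int -> K) :
  (forall m, f m != 0 -> (`|m| < B)%N) -> (forall m, g m != 0 -> (`|m| < B)%N) ->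
  (\sum_(m <- zbox B) f m) * (\sum_(n <- zbox B) g n) =
  \sum_(a <- zbox B) \sum_(b <- zbox B) f (a + b) * g (a - b) +
  \sum_(a <- zbox B) \sum_(b <- zbox B) f (a + b + 1) * g (a - b).
Proof.
move=> Hf Hg; rewrite big_distrlr (sum_zbox_pair (F := fun m n => f m * g n)) // => m n /mul_supp.
by case/andP => /Hf -> /Hg ->.
Qed.

Section Squares.
Variables (z z' : K).
Hypothesis zz' : z * z' = 1.
Local Notation Z := (zpow z z').

Lemma even_sum_shift :
  \sum_(a <- zbox B) ppow (2 * ((a + 1) * (a + 1))) * Z (4 * (a + 1)) =
  even_sum z z'.
Proof.
apply: (@sum_zbox_map _ _ (fun a => a + 1)
  (fun a => ppow (2 * (a * a)) * Z (4 * a))); first by move=> a b /addIr.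
move=> x /mul_supp/andP[nz _].
have {nz}ltxN : (`|x| < N)%N.
  apply: contraNT nz; rewrite -leqNgt => le_Nx; apply/eqP/ppow_nil.
  by have := absz_mulzz x; nia.
by split; [lia | exists (x - 1); lia].
Qed.

(** Putting (m, n) = (a+b, a-b) turns m^2 + n^2 into 2a^2 + 2b^2, and (a+b+1, a-b) gives 1 + 2a(a+1)
    + 2b(b+1). The power of [z] depends on a alone, so each double sum factors, with the sum over b
    taken at z = 1. *)
Lemma theta_sum_sqr (s : bool) :
  theta_sum s z z' ^+ 2 = even_sum 1 1 * even_sum z z' +
    sg s * p * odd_sum 1 1 * odd_sum z z'.
Proof.
rewrite expr2 sum_zbox_mul; last 2 first.
- by move=> m /mul_supp/andP[/mul_supp/andP[_ /theta_supp]]; lia.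
- by move=> m /mul_supp/andP[/mul_supp/andP[_ /theta_supp]]; lia.
congr (_ + _).
  rewrite mulrC big_distrlr /=; apply: eq_bigr => a _; apply: eq_bigr => b _.
  rewrite zpow1 mulr1.
  transitivity ((sg s ^+ absz (a + b) * sg s ^+ absz (a - b)) *
    (ppow ((a + b) * (a + b)) * ppow ((a - b) * (a - b))) *
    (Z (a + b + (a + b)) * Z (a - b + (a - b)))); first by ring.
  rewrite sgD -zpowD // (ppowM (u := 2 * (a * a)) (v := 2 * (b * b)))
    ?mulz2_ge0 ?mulzz_ge0 ?mulzS_ge0 //; last by ring.
  have -> : a + b + (a - b) = a + a by ring.
  have -> : a + b + (a + b) + (a - b + (a - b)) = 4 * a by ring.
  by rewrite sg_dbl; ring.
rewrite -mulrA [X in _ = _ * X]mulrC big_distrlr /= mulr_sumr.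
apply: eq_bigr => a _; rewrite mulr_sumr; apply: eq_bigr => b _.
rewrite zpow1 mulr1.
transitivity ((sg s ^+ absz (a + b + 1) * sg s ^+ absz (a - b)) *
  (ppow ((a + b + 1) * (a + b + 1)) * ppow ((a - b) * (a - b))) *
  (Z (a + b + 1 + (a + b + 1)) * Z (a - b + (a - b)))); first by ring.
have ep : ppow ((a + b + 1) * (a + b + 1)) * ppow ((a - b) * (a - b)) =
    p * (ppow (2 * (a * (a + 1))) * ppow (2 * (b * (b + 1)))).
  rewrite -{1}[p]expr1 -[p ^+ 1]/(ppow 1).
  rewrite /ppow -!exprD; congr (_ ^+ _).
  have := mulzz_ge0 (a + b + 1); have := mulzz_ge0 (a - b).
  have := mulz2_ge0 (mulzS_ge0 a).
  have := mulz2_ge0 (mulzS_ge0 b).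
  have : (a + b + 1) * (a + b + 1) + (a - b) * (a - b) =
    1 + 2 * (a * (a + 1)) + 2 * (b * (b + 1)) by ring.
  by lia.
rewrite sgD -zpowD // ep.
have -> : a + b + 1 + (a - b) = a + a + 1 by ring.
have -> : a + b + 1 + (a + b + 1) + (a - b + (a - b)) = 4 * a + 2 by ring.
by rewrite -sgD sg_dbl expr1; ring.
Qed.

Lemma phi_sum_sqr (s : bool) :
  phi_sum s z z' ^+ 2 = even_sum 1 1 * odd_sum z z' +
    sg s * odd_sum 1 1 * even_sum z z'.
Proof.
rewrite expr2 sum_zbox_mul; last 2 first.
- by move=> m /mul_supp/andP[/mul_supp/andP[_ /phi_supp]]; lia.
- by move=> m /mul_supp/andP[/mul_supp/andP[_ /phi_supp]]; lia.
congr (_ + _).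
  rewrite mulrC big_distrlr /=; apply: eq_bigr => a _; apply: eq_bigr => b _.
  rewrite zpow1 mulr1.
  transitivity ((sg s ^+ absz (a + b) * sg s ^+ absz (a - b)) *
    (ppow ((a + b) * (a + b + 1)) * ppow ((a - b) * (a - b + 1))) *
    (Z (a + b + (a + b) + 1) * Z (a - b + (a - b) + 1))); first by ring.
  rewrite sgD -zpowD // (ppowM (u := 2 * (a * (a + 1))) (v := 2 * (b * b)))
    ?mulz2_ge0 ?mulzz_ge0 ?mulzS_ge0 //; last by ring.
  have -> : a + b + (a - b) = a + a by ring.
  have -> : a + b + (a + b) + 1 + (a - b + (a - b) + 1) = 4 * a + 2 by ring.
  by rewrite sg_dbl; ring.
rewrite -mulrA [X in _ = _ * X]mulrC -even_sum_shift big_distrlr /= mulr_sumr.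
apply: eq_bigr => a _; rewrite mulr_sumr; apply: eq_bigr => b _.
rewrite zpow1 mulr1.
transitivity ((sg s ^+ absz (a + b + 1) * sg s ^+ absz (a - b)) *
  (ppow ((a + b + 1) * (a + b + 1 + 1)) * ppow ((a - b) * (a - b + 1))) *
  (Z (a + b + 1 + (a + b + 1) + 1) * Z (a - b + (a - b) + 1))); first by ring.
rewrite sgD -zpowD //.
rewrite (ppowM (u := 2 * ((a + 1) * (a + 1))) (v := 2 * (b * (b + 1))))
  ?mulz2_ge0 ?mulzz_ge0 ?mulzS_ge0 //; last by ring.
have -> : a + b + 1 + (a - b) = a + a + 1 by ring.
have -> : a + b + 1 + (a + b + 1) + 1 + (a - b + (a - b) + 1) = 4 * (a + 1) by ring.
by rewrite -sgD sg_dbl expr1; ring.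
Qed.

End Squares.

(** Once each square is expanded, this is a polynomial identity between [even_sum] and [odd_sum] at
    1 and at [z]. The same holds for [jacobi_theta]. *)
Lemma jacobi_phi z z' : z * z' = 1 ->
  phi_sum false z z' ^+ 2 * theta_sum true 1 1 ^+ 2 =
  phi_sum false 1 1 ^+ 2 * theta_sum true z z' ^+ 2 +
  theta_sum false 1 1 ^+ 2 * phi_sum true z z' ^+ 2.
Proof.
by move=> zz'; rewrite !phi_sum_sqr ?mulr1 // !theta_sum_sqr ?mulr1 //; ring.
Qed.

Lemma jacobi_theta z z' : z * z' = 1 ->
  theta_sum false z z' ^+ 2 * theta_sum true 1 1 ^+ 2 =
  theta_sum false 1 1 ^+ 2 * theta_sum true z z' ^+ 2 +
  p * phi_sum false 1 1 ^+ 2 * phi_sum true z z' ^+ 2.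
Proof.
by move=> zz'; rewrite !phi_sum_sqr ?mulr1 // !theta_sum_sqr ?mulr1 //; ring.
Qed.

End ThetaSeries.

(** * Derivations and logarithmic derivatives *)

Section Derivation.
Variables (K : pzRingType) (D : K -> K).

Definition derivation : Prop :=
  {morph D : x y / x + y} /\ (forall x y, D (x * y) = D x * y + x * D y).

Hypothesis DD : derivation.

Lemma der0 : D 0 = 0.
Proof. by apply: (addrI (D 0)); rewrite -DD.1 !addr0. Qed.

Lemma derN x : D (- x) = - D x.
Proof. by apply/eqP; rewrite -addr_eq0 -DD.1 addNr der0. Qed.

Lemma derB x y : D (x - y) = D x - D y.
Proof. by rewrite DD.1 derN. Qed.

Lemma der1 : D 1 = 0.
Proof. by apply: (addrI (D 1)); rewrite addr0 -[X in _ = D X]mul1r DD.2 mul1r mulr1. Qed.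

Lemma derMn x n : D (x *+ n) = D x *+ n.
Proof. by elim: n => [|n IH]; rewrite ?der0 // !mulrS DD.1 IH. Qed.

Lemma der_nat n : D n%:R = 0.
Proof. by rewrite derMn der1 mul0rn. Qed.

Lemma der_sign n : D ((-1) ^+ n) = 0.
Proof. by rewrite -signr_odd; case: (odd n); rewrite ?derN der1 ?oppr0. Qed.

Lemma der_sum (I : Type) (r : seq I) (P : pred I) (F : I -> K) :
  D (\sum_(i <- r | P i) F i) = \sum_(i <- r | P i) D (F i).
Proof. exact: (big_morph D DD.1 der0). Qed.

Lemma der_exp0 x n : D x = 0 -> D (x ^+ n) = 0.
Proof.
move=> Dx; elim: n => [|n IH]; first by rewrite expr0 der1.
by rewrite exprS DD.2 Dx IH mul0r mulr0 addr0.
Qed.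

Lemma der_cst x y : D x = 0 -> D (x * y) = x * D y.
Proof. by move=> Dx; rewrite DD.2 Dx mul0r add0r. Qed.
End Derivation.

Section ComDerivation.
Variables (K : comPzRingType) (D : K -> K).
Hypothesis DD : derivation D.

Lemma der_exp x n : D (x ^+ n.+1) = n.+1%:R * x ^+ n * D x.
Proof.
elim: n => [|n IH]; first by rewrite expr1 expr0 !mul1r.
by rewrite exprS DD.2 IH -[n.+2%:R]natr1 -[n.+1%:R * _ * _]mulrA exprS; ring.
Qed.

Lemma der_log_exp x l n : D x = l * x -> D (x ^+ n) = n%:R * l * x ^+ n.
Proof.
by case: n => [|n] Dx; [rewrite expr0 der1 // !mul0r | rewrite der_exp Dx exprS; ring].
Qed.

(* [l] is the logarithmic derivative of [x]. *)
Definition log_der (l x : K) : Prop := D x = l * x.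

Lemma log_derM l m x y : log_der l x -> log_der m y -> log_der (l + m) (x * y).
Proof. by rewrite /log_der DD.2 => -> ->; ring. Qed.

Lemma log_derV l x y : x * y = 1 -> log_der l x -> log_der (- l) y.
Proof.
rewrite /log_der => xy Dx; have := der1 DD; rewrite -xy DD.2 Dx => /eqP.
rewrite addrC addr_eq0 => /eqP e.
by rewrite -[D y]mul1r -xy [x * y]mulrC -mulrA e mulrN -mulrA xy mulr1 mulNr mulrC.
Qed.

Lemma log_der_cst x : D x = 0 -> log_der 0 x.
Proof. by rewrite /log_der mul0r. Qed.

Lemma log_der_prod (n : nat) (l x : nat -> K) :
  (forall i, (i < n)%N -> log_der (l i) (x i)) ->
  log_der (\sum_(i < n) l i) (\prod_(i < n) x i).
Proof.
elim: n => [|n IH] H; first by rewrite !big_ord0; apply/log_der_cst/der1.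
rewrite !big_ord_recr; apply: log_derM; last exact: H.
by apply: IH => i lt_in; apply: H; apply: ltnW.
Qed.
End ComDerivation.

(** * The Wronskian of theta_1 and theta_4 *)

Section Wronskian.
Variables (K : comNzRingType) (p : K) (N : nat).
Hypothesis pN : p ^+ N = 0.
Local Notation B := N.+2.
Local Notation ppow := (ppow p).
Local Notation theta := (theta_sum p N).
Local Notation phi := (phi_sum p N).

(** The common dependence on [z] of the product theta_2 theta_3 and of the Wronskian of theta_1 and
    theta_4. [wronski_cst] and [wronski_cst'] are the constants that multiply it. *)
Definition wronski_sum (z z' : K) : K :=
  \sum_(a <- zbox B) ppow (a * (2 * a + 1)) * zpow z z' (4 * a + 1) +
  \sum_(a <- zbox B) ppow ((a + 1) * (2 * a + 1)) * zpow z z' (4 * a + 3).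

Definition wronski_cst : K := \sum_(b <- zbox B) ppow (b * (2 * b + 1)).

Definition wronski_cst' : K :=
  \sum_(b <- zbox B) (4 * b + 1)%:~R * ppow (b * (2 * b + 1)).

Lemma mulz2_ge0' (b : int) : 0 <= b * (2 * b + 1).
Proof. by have := absz_mulzz b; nia. Qed.

Lemma mulz3_ge0 (b : int) : 0 <= (b + 1) * (2 * b + 1).
Proof. by have := absz_mulzz (b + 1); nia. Qed.

(** The substitution b -> -1 - b exchanges the exponents (b+1)(2b+1) and b(2b+1). *)
Lemma wronski_flip (c : int -> K) :
  \sum_(b <- zbox B) c b * ppow ((b + 1) * (2 * b + 1)) =
  \sum_(b <- zbox B) c (-1 - b) * ppow (b * (2 * b + 1)).
Proof.
rewrite -(@sum_zbox_map _ _ (fun b => - 1 - b)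
  (fun b => c b * ppow ((b + 1) * (2 * b + 1)))).
- by apply: eq_bigr => b _; congr (_ * ppow _); ring.
- by move=> a b; lia.
move=> x /mul_supp/andP[_ nz].
have {nz}ltxN : (`|x| < N.+2)%N.
  apply: contraNT nz; rewrite -leqNgt => le_Nx; apply/eqP/(ppow_nil pN).
  have -> : (x + 1) * (2 * x + 1) = 2 * ((x + 1) * (x + 1)) - (x + 1) by ring.
  by have := absz_mulzz (x + 1); have := mulzz_ge0 (x + 1); lia.
by split; [lia | exists (- 1 - x); lia].
Qed.

Section At.
Variables (z z' : K).
Hypothesis zz' : z * z' = 1.
Local Notation Z := (zpow z z').

(** The change of variables of [sum_zbox_pair] again separates a from b; the two sums over b, for
    even and odd m + n, agree by [wronski_flip]. *)
Lemma phi_theta_wronski :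
  phi false z z' * theta false z z' = wronski_cst * wronski_sum z z'.
Proof.
rewrite sum_zbox_mul; last 2 first.
- by move=> m /mul_supp/andP[/mul_supp/andP[_ /(phi_supp pN)]]; lia.
- by move=> m /mul_supp/andP[/mul_supp/andP[_ /(theta_supp pN)]]; lia.
rewrite mulrDr; congr (_ + _).
  rewrite mulrC big_distrlr /=; apply: eq_bigr => a _; apply: eq_bigr => b _.
  transitivity ((ppow ((a + b) * (a + b + 1)) * ppow ((a - b) * (a - b))) *
    (Z (a + b + (a + b) + 1) * Z (a - b + (a - b)))).
    by rewrite expr0 !expr1n; ring.
  rewrite -zpowD // (ppowM _ (u := a * (2 * a + 1)) (v := b * (2 * b + 1)))
    ?mulz2_ge0' ?mulzz_ge0 ?mulzS_ge0 //; last by ring.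
  have -> : a + b + (a + b) + 1 + (a - b + (a - b)) = 4 * a + 1 by ring.
  by ring.
have -> : wronski_cst = \sum_(b <- zbox B) 1 * ppow ((b + 1) * (2 * b + 1)).
  by rewrite (wronski_flip (fun=> 1)); apply: eq_bigr => b _; rewrite mul1r.
rewrite mulrC big_distrlr /=; apply: eq_bigr => a _; apply: eq_bigr => b _.
transitivity ((ppow ((a + b + 1) * (a + b + 1 + 1)) * ppow ((a - b) * (a - b))) *
  (Z (a + b + 1 + (a + b + 1) + 1) * Z (a - b + (a - b)))).
  by rewrite expr0 !expr1n; ring.
rewrite -zpowD // (ppowM _ (u := (a + 1) * (2 * a + 1)) (v := (b + 1) * (2 * b + 1)))
  ?mulz3_ge0 ?mulzz_ge0 ?mulzS_ge0 //; last by ring.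
have -> : a + b + 1 + (a + b + 1) + 1 + (a - b + (a - b)) = 4 * a + 3 by ring.
by ring.
Qed.

Variables (D : K -> K) (h : K).
Hypotheses (DD : derivation D) (Dp : D p = 0) (Dz : log_der D h z).

Lemma der_zpow m : D (Z m) = m%:~R * h * Z m.
Proof.
have Dz' := log_derV DD zz' Dz.
case: m => n; first by rewrite /zpow (der_log_exp DD _ Dz) -pmulrn.
rewrite /zpow (der_log_exp DD _ Dz') NegzE rmorphN /= -pmulrn.
by ring.
Qed.

(** The derivation multiplies the term (m, n) by 2m + 1 - 2n, which becomes 4b + 1 or 4b + 3 and so
    does not involve a. The sum factors with the same [wronski_sum] as theta_2 theta_3; the
    derivative of theta_1 / theta_4 is therefore proportional to theta_2 theta_3 / theta_4^2. *)
Lemma wronski_phi_theta :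
  D (phi true z z') * theta true z z' - phi true z z' * D (theta true z z') =
  h * (wronski_cst' * wronski_sum z z').
Proof.
pose f m := (-1) ^+ true ^+ absz m * ppow (m * (m + 1)) * Z (m + m + 1) : K.
pose g m := (-1) ^+ true ^+ absz m * ppow (m * m) * Z (m + m) : K.
have Dsgn n e : D ((-1) ^+ true ^+ n * ppow e) = 0.
  by rewrite DD.2 !(der_exp0 DD) ?mul0r ?mulr0 ?addr0 // derN // der1 // oppr0.
have Df m : D (f m) = (m + m + 1)%:~R * h * f m.
  by rewrite /f (der_cst DD) // der_zpow; ring.
have Dg m : D (g m) = (m + m)%:~R * h * g m.
  by rewrite /g (der_cst DD) // der_zpow; ring.
rewrite /phi_sum /theta_sum !(der_sum DD) !big_distrlr /= -sumrB.
transitivity (\sum_(m <- zbox B) \sum_(n <- zbox B)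
   h * ((m + m + 1 - (n + n))%:~R * (f m * g n))).
  apply: eq_bigr => m _; rewrite -sumrB; apply: eq_bigr => n _.
  by rewrite -/(f m) -/(g n) Df Dg rmorphB /=; ring.
rewrite (sum_zbox_pair (F := fun m n =>
   h * ((m + m + 1 - (n + n))%:~R * (f m * g n)))); last first.
  move=> m n /mul_supp/andP[_ /mul_supp/andP[_ /mul_supp/andP[]]].
  move=> /mul_supp/andP[/mul_supp/andP[_ /(phi_supp pN) lt_mN] _].
  by move=> /mul_supp/andP[/mul_supp/andP[_ /(theta_supp pN) lt_nN] _]; lia.
rewrite mulrDr [RHS]mulrDr; congr (_ + _).
  rewrite mulrC [wronski_cst' * _]mulrC big_distrlr /= mulr_suml.
  apply: eq_bigr => a _; rewrite mulr_suml; apply: eq_bigr => b _.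
  transitivity (h * ((a + b + (a + b) + 1 - (a - b + (a - b)))%:~R *
    (((-1) ^+ true ^+ absz (a + b) * (-1) ^+ true ^+ absz (a - b)) *
    (ppow ((a + b) * (a + b + 1)) * ppow ((a - b) * (a - b))) *
    (Z (a + b + (a + b) + 1) * Z (a - b + (a - b)))))); first by rewrite /f /g; ring.
  rewrite sgD -zpowD // (ppowM _ (u := a * (2 * a + 1)) (v := b * (2 * b + 1)))
    ?mulz2_ge0' ?mulzz_ge0 ?mulzS_ge0 //; last by ring.
  have -> : a + b + (a - b) = a + a by ring.
  have -> : a + b + (a + b) + 1 + (a - b + (a - b)) = 4 * a + 1 by ring.
  have -> : a + b + (a + b) + 1 - (a - b + (a - b)) = 4 * b + 1 by ring.
  by rewrite sg_dbl; ring.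
have -> : wronski_cst' =
    \sum_(b <- zbox B) - (4 * b + 3)%:~R * ppow ((b + 1) * (2 * b + 1)).
  rewrite (wronski_flip (fun b => - (4 * b + 3)%:~R)); apply: eq_bigr => b _.
  by rewrite -rmorphN; congr (_%:~R * _); ring.
rewrite mulrC [X in _ = X * _]mulrC big_distrlr /= mulr_suml.
apply: eq_bigr => a _; rewrite mulr_suml; apply: eq_bigr => b _.
transitivity (h * ((a + b + 1 + (a + b + 1) + 1 - (a - b + (a - b)))%:~R *
  (((-1) ^+ true ^+ absz (a + b + 1) * (-1) ^+ true ^+ absz (a - b)) *
  (ppow ((a + b + 1) * (a + b + 1 + 1)) * ppow ((a - b) * (a - b))) *
  (Z (a + b + 1 + (a + b + 1) + 1) * Z (a - b + (a - b))))));
  first by rewrite /f /g; ring.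
rewrite sgD -zpowD // (ppowM _ (u := (a + 1) * (2 * a + 1)) (v := (b + 1) * (2 * b + 1)))
  ?mulz3_ge0 ?mulzz_ge0 ?mulzS_ge0 //; last by ring.
have -> : a + b + 1 + (a - b) = a + a + 1 by ring.
have -> : a + b + 1 + (a + b + 1) + 1 + (a - b + (a - b)) = 4 * a + 3 by ring.
have -> : a + b + 1 + (a + b + 1) + 1 - (a - b + (a - b)) = 4 * b + 3 by ring.
by rewrite -sgD sg_dbl expr1 mul1r; ring.
Qed.
End At.
End Wronskian.

(** * Product expansions of the theta functions *)

Section ThetaProducts.
Variables (K : comNzRingType) (p : K) (N : nat).
Hypothesis pN : p ^+ N = 0.
Local Notation sg s := ((-1) ^+ nat_of_bool s : K).

Definition theta_prod (s : bool) (z z' : K) : K :=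
  \prod_(i < N) ((1 + sg s * p ^+ (2 * i).+1 * z ^+ 2) *
                 (1 + sg s * p ^+ (2 * i).+1 * z' ^+ 2)).

Definition phi_prod (s : bool) (z z' : K) : K :=
  \prod_(i < N) ((1 + sg s * p ^+ (2 * i).+2 * z ^+ 2) *
                 (1 + sg s * p ^+ (2 * i).+2 * z' ^+ 2)).

Lemma bin2_double n : (2 * 'C(n, 2) + n = n * n)%N.
Proof. by elim: n => // n IH; rewrite binS bin1; nia. Qed.

Variables (z z' : K).
Hypothesis zz' : z * z' = 1.

Lemma nil_sqr : (p ^+ 2) ^+ N = 0.
Proof. by rewrite -exprM (expr_nil pN) // leq_pmull. Qed.

(** The triple product with Q = p^2, a = +-p z^2 and b = +-p z'^2. *)
Lemma theta_sumE s :
  theta_sum p N s z z' = qfact (p ^+ 2) N * theta_prod s z z'.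
Proof.
pose a := sg s * p * z ^+ 2; pose b := sg s * p * z' ^+ 2.
have ab : a * b = p ^+ 2.
  have -> : a * b = sg s ^+ 2 * p ^+ 2 * (z * z') ^+ 2 by rewrite /a /b; ring.
  by rewrite zz' sqrr_sign expr1n mul1r mulr1.
transitivity (\sum_(j <- zbox N.+2) jacobi_term (p ^+ 2) a b j).
  have term (n : nat) (y : K) : sg s ^+ n * p ^+ (n * n) * y ^+ (n + n) =
      (p ^+ 2) ^+ 'C(n, 2) * (sg s * p * y ^+ 2) ^+ n.
    by rewrite -bin2_double addnn -mul2n exprD !exprM !exprMn; ring.
  apply: eq_bigr => -[n|n] _; first exact: term.
  rewrite /jacobi_term -term /ppow abszM.
  by have -> : Negz n + Negz n = Negz (n + n.+1) by lia.
rewrite -(nilpotent_triple_product nil_sqr ab (B := N.+2)) ?leqW //.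
congr (_ * _); apply: eq_bigr => i _.
by rewrite -exprM [p ^+ _.+1]exprS; congr (_ * _); rewrite /a /b; ring.
Qed.

(** The triple product with Q = p^2, a = +-p^2 z^2 and b = +-z'^2. The factor of index 0 in b,
    multiplied by [z], gives the elementary factor z +- z'. *)
Lemma phi_sumE s :
  phi_sum p N s z z' = (z + sg s * z') * (qfact (p ^+ 2) N * phi_prod s z z').
Proof.
pose a := sg s * p ^+ 2 * z ^+ 2; pose b := sg s * z' ^+ 2.
have ab : a * b = p ^+ 2.
  have -> : a * b = sg s ^+ 2 * p ^+ 2 * (z * z') ^+ 2 by rewrite /a /b; ring.
  by rewrite zz' sqrr_sign expr1n mul1r mulr1.
transitivity (\sum_(j <- zbox N.+2) z * jacobi_term (p ^+ 2) a b j).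
  apply: eq_bigr => -[n|n] _; rewrite /jacobi_term /ppow.
    have -> : (n%:Z + n%:Z + 1 = (2 * n).+1%N%:Z)%R by lia.
    have -> : absz (n%:Z * (n%:Z + 1)) = (2 * 'C(n, 2) + 2 * n)%N.
      by have := bin2_double n; nia.
    by rewrite /zpow exprS exprD !exprM !exprMn; ring.
  have -> : Negz n + Negz n + 1 = Negz (2 * n) by lia.
  have -> : absz (Negz n * (Negz n + 1)) = (2 * 'C(n.+1, 2))%N.
    by have := bin2_double n.+1; nia.
  have -> : zpow z z' (Negz (2 * n)) = z * (z' ^+ 2) ^+ n.+1.
    rewrite /zpow -exprM mulnS addSn add1n [in RHS]exprS mulrA zz' mul1r.
    by [].
  by rewrite exprM !exprMn; ring.
rewrite -mulr_sumr -(nilpotent_triple_product nil_sqr ab (B := N.+2)) ?leqW //.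
rewrite mulrCA [RHS]mulrCA; congr (_ * _).
have -> : z + sg s * z' = z * (1 + b).
  by rewrite /b mulrDr mulr1 mulrCA expr2 [z * _]mulrA zz' mul1r.
rewrite -mulrA; congr (_ * _); rewrite /phi_prod !big_split /= [RHS]mulrCA.
congr (_ * _).
  by apply: eq_bigr => i _; rewrite -exprM [p ^+ _.+2]exprSr [p ^+ _.+1]exprSr /a; ring.
(* Since (p^2)^N = 0, a factor of index N can be added; removing the one of index 0 then leaves the
   range of the same length, shifted by one. *)
have e : \prod_(i < N.+1) (1 + (p ^+ 2) ^+ i * b) = \prod_(i < N) (1 + (p ^+ 2) ^+ i * b).
  by rewrite big_ord_recr /= nil_sqr mul0r addr0 mulr1.
rewrite -e big_ord_recl /= expr0 mul1r; congr (_ * _); apply: eq_bigr => i _.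
by rewrite /bump /= add1n -exprM mulnS add2n /b; ring.
Qed.
End ThetaProducts.

(** * Truncated power series, the Euler operator and exponentials *)

Notation tps C M := {poly %/ ('X^(M.+1) : {poly C})}.

Section TruncatedPowerSeries.
Variables (C : comNzRingType) (M : nat).
Implicit Types (u v : tps C M) (j : nat).

Definition tcoef u j : C := (u : {poly C})`_j.

Lemma mk_monicXS : mk_monic ('X^(M.+1) : {poly C}) = 'X^(M.+1).
Proof. by rewrite mk_monic_Xn. Qed.

Lemma tcoef_gt u j : (M < j)%N -> tcoef u j = 0.
Proof.
move=> lt_Mj; rewrite /tcoef nth_default //; apply: leq_trans lt_Mj.
have size_h : size (mk_monic ('X^(M.+1) : {poly C})) = M.+2.
  by rewrite mk_monicXS size_polyXn.
by rewrite -ltnS -[X in (_ < X)%N]size_h; apply: size_mk_monic.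
Qed.

Lemma tps_ext u v : (forall j, (j <= M)%N -> tcoef u j = tcoef v j) -> u = v.
Proof.
move=> H; apply/val_inj/polyP => j; case: (leqP j M) => [/H //|lt_Mj].
by rewrite [LHS](tcoef_gt u lt_Mj) [RHS](tcoef_gt v lt_Mj).
Qed.

Definition mktps (f : nat -> C) : tps C M := in_qpoly _ (\poly_(i < M.+1) f i).

Lemma tcoef_mk f j : (j <= M)%N -> tcoef (mktps f) j = f j.
Proof.
move=> le_jM; rewrite /tcoef in_qpoly_small ?coef_poly ?ltnS ?le_jM //.
by rewrite mk_monicXS size_polyXn ltnS size_poly.
Qed.

Lemma tcoefD u v j : tcoef (u + v) j = tcoef u j + tcoef v j.
Proof. by rewrite /tcoef poly_of_qpolyD coefD. Qed.

Lemma tcoef0 j : tcoef 0 j = 0.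
Proof. by rewrite /tcoef coef0. Qed.

Lemma tcoefN u j : tcoef (- u) j = - tcoef u j.
Proof. by apply/eqP; rewrite -addr_eq0 -tcoefD addNr tcoef0. Qed.

Lemma tcoefM u v j : (j <= M)%N ->
  tcoef (u * v) j = \sum_(i < j.+1) tcoef u i * tcoef v (j - i).
Proof.
move=> le_jM; rewrite /tcoef poly_of_qpolyM -coefM.
move: (qpoly.polyn u) (qpoly.polyn v) => a b; rewrite mk_monicXS.
have mon : 'X^(M.+1) \is @monic C by rewrite monicXn.
rewrite [in RHS](Pdiv.RingMonic.rdivp_eq mon (a * b)) coefD.
by rewrite coefMXn ltnS le_jM add0r.
Qed.

Definition tC (c : C) : tps C M := qpolyC _ c.

HB.instance Definition _ := GRing.isZmodMorphism.Build C (tps C M) tC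
  (qpolyC_is_zmod_morphism _).
HB.instance Definition _ := GRing.isMonoidMorphism.Build C (tps C M) tC
  (qpolyC_is_monoid_morphism _).

Lemma tcoefC c j : tcoef (tC c) j = if j == 0%N then c else 0.
Proof. by rewrite /tcoef coefC. Qed.

Lemma tcoef1 j : tcoef 1 j = (j == 0%N)%:R.
Proof. by rewrite -[1](rmorph1 tC) tcoefC; case: eqP. Qed.

Lemma tcoefCM c u j : tcoef (tC c * u) j = c * tcoef u j.
Proof.
case: (leqP j M) => [le_jM|lt_Mj]; last by rewrite !tcoef_gt ?mulr0.
rewrite tcoefM // big_ord_recl tcoefC eqxx subn0 big1 ?addr0 // => i _.
by rewrite tcoefC mul0r.
Qed.

Lemma tcoefM0 u v : tcoef (u * v) 0 = tcoef u 0 * tcoef v 0.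
Proof. by rewrite tcoefM // big_ord1. Qed.

Lemma tcoefX0 u n : tcoef (u ^+ n) 0 = tcoef u 0 ^+ n.
Proof.
elim: n => [|n IH]; first by rewrite !expr0 tcoef1.
by rewrite exprS tcoefM0 IH -exprS.
Qed.

Definition tX : tps C M := mktps (fun j => (j == 1%N)%:R).

Lemma tcoefX j : (j <= M)%N -> tcoef tX j = (j == 1%N)%:R.
Proof. exact: tcoef_mk. Qed.

Lemma tcoefXMS u j : (j < M)%N -> tcoef (tX * u) j.+1 = tcoef u j.
Proof.
move=> lt_jM; have le_1M : (1 <= M)%N by apply: leq_ltn_trans lt_jM.
rewrite tcoefM // big_ord_recl tcoefX // mul0r add0r big_ord_recl.
rewrite tcoefX //= mul1r subSS subn0 big1 ?addr0 // => i _.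
by rewrite tcoefX ?mul0r //=; exact: leq_ltn_trans (ltn_ord i) lt_jM.
Qed.

Lemma tcoefXM0 u : tcoef (tX * u) 0 = 0.
Proof. by rewrite tcoefM0 tcoef_mk // mul0r. Qed.

Lemma tps_nilp u : tcoef u 0 = 0 -> u ^+ M.+1 = 0.
Proof.
move=> u0; have low m j : (j < m)%N -> tcoef (u ^+ m) j = 0.
  elim: m j => // m IH j; rewrite ltnS => le_jm.
  case: (leqP j M) => [le_jM|lt_Mj]; last by rewrite tcoef_gt.
  rewrite exprS tcoefM // big_ord_recl u0 mul0r add0r big1 // => i _.
  by rewrite IH ?mulr0 // lift0; have := ltn_ord i; lia.
by apply: tps_ext => j le_jM; rewrite low // tcoef0.
Qed.

Lemma tps_inv u : tcoef u 0 = 1 -> exists v, u * v = 1.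
Proof.
move=> u0; exists (\sum_(j < M.+1) (1 - u) ^+ j).
have := one_sub_nil_inv (x := 1 - u) (N := M.+1).
rewrite opprB addrCA subrr addr0; apply; apply: tps_nilp.
by rewrite tcoefD tcoefN tcoef1 u0 subrr.
Qed.

(** The operator X d/dX, which unlike d/dX respects truncation. *)
Definition euler u : tps C M := mktps (fun j => j%:R * tcoef u j).

Lemma tcoef_euler u j : tcoef (euler u) j = j%:R * tcoef u j.
Proof.
case: (leqP j M) => [le_jM|lt_Mj]; first by rewrite tcoef_mk.
by rewrite !tcoef_gt // mulr0.
Qed.

Lemma euler_derivation : derivation euler.
Proof.
split=> u v; apply: tps_ext => j le_jM.
  by rewrite !(tcoefD, tcoef_euler) mulrDr.
rewrite tcoefD tcoef_euler !tcoefM // mulr_sumr -big_split.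
apply: eq_bigr => i _; rewrite !tcoef_euler.
have {1}-> : j = (i + (j - i))%N by have := ltn_ord i; lia.
by rewrite natrD /=; ring.
Qed.

Lemma eulerC c : euler (tC c) = 0.
Proof.
apply: tps_ext => j _; rewrite tcoef_euler tcoefC tcoef0.
by case: j => [|j]; rewrite ?mul0r ?mulr0.
Qed.

Lemma eulerX : euler tX = tX.
Proof.
apply: tps_ext => j le_jM; rewrite tcoef_euler tcoef_mk //.
by case: eqP => [->|_]; rewrite ?mulr0 ?mulr1.
Qed.

Hypothesis natreg : forall n (c : C), n.+1%:R * c = 0 -> c = 0.

(** As [a] has no constant term, j y_j is a combination of lower coefficients of [y]; [natreg]
    allows division by j. This proves an identity of series by comparing constant terms and
    logarithmic derivatives, as in [texpD]. *)
Lemma euler_uniq (a y : tps C M) :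
  tcoef a 0 = 0 -> tcoef y 0 = 0 -> log_der euler a y -> y = 0.
Proof.
move=> a0 y0 E; apply: tps_ext => j; rewrite tcoef0.
elim/ltn_ind: j => -[|j] IH le_jM //; apply: (@natreg j).
rewrite -tcoef_euler E tcoefM // big_ord_recl a0 mul0r add0r big1 // => i _.
by rewrite IH ?mulr0 // lift0; have := ltn_ord i; lia.
Qed.
End TruncatedPowerSeries.

Section ExponentialSeries.
Variables (F : numFieldType) (C : comNzRingType) (iota : {rmorphism F -> C}).
Variable (M : nat).
Local Notation U := (tps C M).
Local Notation X := (tX C M).

Lemma natreg_alg n (c : C) : n.+1%:R * c = 0 -> c = 0.
Proof.
move=> e; have : iota (n.+1%:R^-1) * (n.+1%:R * c) = c.
  by rewrite mulrA -(rmorph_nat iota n.+1) -rmorphM mulVf ?pnatr_eq0 // rmorph1 mul1r.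
by rewrite e mulr0.
Qed.

Definition texp (c : F) : U := mktps M (fun j => iota (c ^+ j / j`!%:R)).

Lemma texp_coef0 c : tcoef (texp c) 0 = 1.
Proof. by rewrite tcoef_mk // expr0 fact0 divr1 rmorph1. Qed.

Lemma euler_texp c : log_der (@euler C M) (tC M (iota c) * X) (texp c).
Proof.
rewrite /log_der -mulrA; apply: tps_ext => -[|j] le_jM; rewrite tcoef_euler tcoefCM.
  by rewrite mul0r tcoefXM0 mulr0.
rewrite tcoefXMS // !tcoef_mk // ?(ltnW le_jM) // -(rmorph_nat iota) -!rmorphM.
congr (iota _); rewrite exprS factS natrM.
have j0 : j.+1%:R != 0 :> F by rewrite pnatr_eq0.
have f0 : j`!%:R != 0 :> F by rewrite pnatr_eq0 -lt0n fact_gt0.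
by field; rewrite f0; have := j0; rewrite -natr1 addrC.
Qed.

Lemma texpD c d : texp (c + d) = texp c * texp d.
Proof.
apply/eqP; rewrite -subr_eq0; apply/eqP.
apply: (@euler_uniq _ _ natreg_alg (tC M (iota (c + d)) * X)).
- by rewrite mulrC tcoefXM0.
- by rewrite tcoefD tcoefN tcoefM0 !texp_coef0 mulr1 subrr.
have ED := @euler_derivation C M.
rewrite /log_der (derB ED) euler_texp (log_derM ED (euler_texp c) (euler_texp d)).
by rewrite !rmorphD /=; ring.
Qed.

Lemma texp0 : texp 0 = 1.
Proof.
apply: tps_ext => j le_jM; rewrite tcoef_mk // tcoef1 expr0n.
by case: j {le_jM} => [|j]; rewrite ?fact0 ?divr1 ?mul0r ?rmorph0 ?rmorph1.
Qed.

Lemma texpN c : texp c * texp (- c) = 1.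
Proof. by rewrite -texpD subrr texp0. Qed.

(* sinh (x/2) / (x/2) and cosh (x/2) *)
Definition tsinhc : U :=
  mktps M (fun j => if odd j then 0 else iota (2^-1 ^+ j / j.+1`!%:R)).

Definition tcosh : U :=
  mktps M (fun j => if odd j then 0 else iota (2^-1 ^+ j / j`!%:R)).

Lemma tsinhcE : X * tsinhc = texp 2^-1 - texp (- 2^-1).
Proof.
apply: tps_ext => -[|j] le_jM; rewrite tcoefD tcoefN.
  by rewrite tcoefXM0 !texp_coef0 subrr.
rewrite tcoefXMS // !tcoef_mk // ?(ltnW le_jM) // -rmorphB -mulrBl exprNn.
rewrite -signr_odd /=; case: (odd j) => /=.
  by rewrite expr0 mul1r subrr mul0r rmorph0.
by congr (iota (_ / _)); rewrite expr1 exprS; set y := _ ^+ j; field.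
Qed.

Lemma tcoshE : tC M (iota 2) * tcosh = texp 2^-1 + texp (- 2^-1).
Proof.
apply: tps_ext => j le_jM; rewrite tcoefD tcoefCM.
rewrite !tcoef_mk // -rmorphD -mulrDl exprNn -signr_odd.
case: (odd j); first by rewrite mulr0 expr1 mulN1r subrr mul0r rmorph0.
by rewrite -rmorphM; congr (iota _); rewrite expr0; set y := _ ^+ j; ring.
Qed.
End ExponentialSeries.

(** * Euler's identity and the differential equation of the theta quotient *)

Lemma inv_uniq (K : comPzRingType) (a b c : K) : a * b = 1 -> a * c = 1 -> b = c.
Proof. by move=> ab ac; rewrite -[b]mulr1 -ac mulrA [b * a]mulrC ab mul1r. Qed.

Lemma prod_inv (K : comPzRingType) (n : nat) (x : 'I_n -> K) :
  (forall i, exists y, x i * y = 1) -> exists y, (\prod_(i < n) x i) * y = 1.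
Proof.
move=> H; have [y Hy] : exists y, forall i, x i * y i = 1.
  elim: n x H => [|n IH] x H; first by exists (fun=> 0) => -[].
  have [y Hy] := IH _ (fun i => H (fintype.lift ord0 i)); have [y0 Hy0] := H ord0.
  exists (fun i => if unlift ord0 i is Some j then y j else y0) => i.
  by case: unliftP => [j|] ->.
by exists (\prod_i y i); rewrite -big_split big1 // => i _; apply: Hy.
Qed.

Section EulerIdentity.
Variables (K : comNzRingType) (Q : K) (N : nat).
Hypothesis QN : Q ^+ N = 0.

(** After multiplication by the unit [qfact Q N], the factors 1 + Q^i turn it into the product of
    the even factors 1 - Q^(2i); with the odd ones these make up [qfact Q N] again. *)
Lemma euler_identity :
  \prod_(i < N) ((1 + Q ^+ i.+1) * (1 - Q ^+ (2 * i).+1)) = 1.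
Proof.
have [v uv] := qfact_inv QN N.
have even_prod : \prod_(i < N) (1 + Q ^+ i.+1) * qfact Q N =
    \prod_(i < N) (1 - Q ^+ (2 * i).+2).
  rewrite -big_split; apply: eq_bigr => i _ /=.
  have -> : (2 * i).+2 = (i.+1 + i.+1)%N by lia.
  by rewrite exprD; ring.
have odd_prod : \prod_(i < N) (1 - Q ^+ (2 * i).+1) *
    \prod_(i < N) (1 - Q ^+ (2 * i).+2) = qfact Q N.
  rewrite -(qfact_stable QN (m := (2 * N)%N)) ?leq_pmull // -big_split /=.
  elim: N => [|n IH]; first by rewrite muln0 /qfact !big_ord0.
  by rewrite mulnS add2n 2!qfactS -IH [LHS]big_ord_recr /=; ring.
rewrite big_split /=.
set A := \prod_(i < N) _; set B := \prod_(i < N) _.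
transitivity (A * B * qfact Q N * v); first by rewrite -mulrA uv mulr1.
rewrite -[RHS]uv; congr (_ * _).
by rewrite -[RHS]odd_prod -even_prod -/A -/B; ring.
Qed.
End EulerIdentity.

Section ThetaMorphism.
Variables (K K' : comNzRingType) (e : {rmorphism K -> K'}).

Lemma rmorph_qfact Q N : e (qfact Q N) = qfact (e Q) N.
Proof.
rewrite rmorph_prod; apply: eq_bigr => i _.
by rewrite rmorphB rmorphXn rmorph1.
Qed.

Lemma rmorph_theta_prod p N s z z' :
  e (theta_prod p N s z z') = theta_prod (e p) N s (e z) (e z').
Proof.
rewrite rmorph_prod; apply: eq_bigr => i _.
by rewrite !(rmorphM, rmorphD, rmorphXn, rmorph1, rmorph_sign, rmorphN).
Qed.

Lemma rmorph_phi_prod p N s z z' :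
  e (phi_prod p N s z z') = phi_prod (e p) N s (e z) (e z').
Proof.
rewrite rmorph_prod; apply: eq_bigr => i _.
by rewrite !(rmorphM, rmorphD, rmorphXn, rmorph1, rmorph_sign, rmorphN).
Qed.
End ThetaMorphism.

Section ThetaODE.
Variables (K : comNzRingType) (p : K) (N : nat) (D : K -> K) (e : {rmorphism K -> K}).
Hypotheses (pN : p ^+ N = 0) (DD : derivation D) (Dp : D p = 0) (ep : e p = p).
Variables (X hf z z' sh : K).
Hypotheses (two_hf : 2%:R * hf = 1) (e_hf : e hf = hf).
Hypotheses (zz' : z * z' = 1) (ez : e z = 1) (ez' : e z' = 1).
Hypotheses (Dz : log_der D (hf * X) z) (Xsh : X * sh = z - z').
Hypothesis X_inj : forall a b, X * a = X * b -> e a = e b.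

Local Notation u := (qfact (p ^+ 2) N).
Local Notation theta s z z' := (theta_prod p N s z z').
Local Notation phi s z z' := (phi_prod p N s z z').

(** The term b = 0 is 1, and every other exponent b(2b+1) is positive, so the sum is 1 plus a
    nilpotent element. *)
Lemma wronski_cst_inv : exists y, wronski_cst p N * y = 1.
Proof.
have [y Hy] : exists y, wronski_cst p N = 1 + p * y.
  have mem0 : 0 \in zbox N.+2 by rewrite mem_zbox.
  rewrite /wronski_cst (bigD1_seq 0) ?zbox_uniq //= mul0r /ppow expr0.
  exists (\sum_(b <- zbox N.+2 | b != 0) p ^+ (absz (b * (2 * b + 1))%R).-1).
  rewrite mulr_sumr; congr (_ + _); apply: eq_bigr => b nz_b.
  rewrite -exprS prednK // lt0n absz_eq0 mulf_eq0 (negPf nz_b) /=.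
  by apply/eqP; lia.
exists (\sum_(j < N) (- (p * y)) ^+ j).
have := one_sub_nil_inv (x := - (p * y)) (N := N).
by rewrite opprK -Hy; apply; rewrite exprNn exprMn pN mul0r mulr0.
Qed.

(** The square of Euler's identity at p^2. It is the product form of Jacobi's derivative formula
    theta_1' = theta_2 theta_3 theta_4 and fixes the normalization below. *)
Lemma theta_at1_product : phi false 1 1 * theta false 1 1 * theta true 1 1 = 1.
Proof.
have E := euler_identity (nil_sqr pN).
transitivity ((\prod_(i < N)
   ((1 + (p ^+ 2) ^+ i.+1) * (1 - (p ^+ 2) ^+ (2 * i).+1))) ^+ 2); last first.
  by rewrite E expr1n.
rewrite -prodrXl -!big_split; apply: eq_bigr => i _ /=.
rewrite !expr1n !mulr1 expr0 expr1 !mul1r mulN1r -!exprM.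
have -> : (2 * i.+1 = (2 * i).+2)%N by lia.
have -> : (2 * (2 * i).+1 = (2 * i).+1 + (2 * i).+1)%N by lia.
by rewrite [p ^+ (_ + _)]exprD; ring.
Qed.

Lemma phi_at1 : phi true 1 1 = u ^+ 2.
Proof.
rewrite -prodrXl; apply: eq_bigr => i _; rewrite expr1 !expr1n !mulr1 -exprM.
have -> : (2 * i.+1 = (2 * i).+2)%N by lia.
by ring.
Qed.

Variables (g phi1V thetaV : K).
Hypotheses (phi1K : phi true 1 1 * phi1V = 1) (thetaK : theta true z z' * thetaV = 1).
Let f := sh * phi true z z' * phi1V * theta true 1 1 * thetaV.
Hypotheses (DXf : D (X * f) = X * g) (eg : e g = 1).

(** In the application z = e^(x/2), D = x d/dx, [e] is evaluation at x = 0, and X f is theta_1 /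
    theta_4 scaled to have derivative 1 at 0. The Wronskian gives its derivative as a multiple of
    theta_2 theta_3 / theta_4^2; squaring and using Jacobi's identities eliminates theta_2 and
    theta_3 in favour of X f. *)
Lemma theta_ode :
  D (X * f) ^+ 2 = X ^+ 2 *
    (1 + hf ^+ 2 * (u * theta false 1 1) ^+ 4 * (X * f) ^+ 2) *
    (1 + hf ^+ 2 * p * (2%:R * (u * phi false 1 1)) ^+ 4 * (X * f) ^+ 2).
Proof.
have [uV uK] := qfact_inv (nil_sqr pN) N; have [k1V k1K] := wronski_cst_inv.
have one1 : (1 : K) * 1 = 1 by rewrite mulr1.
pose s := phi_sum p N true z z'; pose t := theta_sum p N true z z'.
pose c := phi_sum p N false z z'; pose v := theta_sum p N false z z'.
pose c1 := phi_sum p N false 1 1; pose v1 := theta_sum p N false 1 1.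
pose t1 := theta_sum p N true 1 1.
pose tV := uV * thetaV; pose gam := theta true 1 1 * phi1V.
have tE : t = u * theta true z z' by exact: theta_sumE.
have tK : t * tV = 1.
  have -> : t * tV = (u * uV) * (theta true z z' * thetaV) by rewrite tE /tV; ring.
  by rewrite uK thetaK mulr1.
have FE : X * f = gam * s * tV.
  have -> : s = X * sh * (u * phi true z z').
    by rewrite /s phi_sumE // expr1 mulN1r Xsh.
  transitivity (X * f * (u * uV)); first by rewrite uK mulr1.
  by rewrite /f /gam /tV; ring.
have c1E : c1 = 2%:R * (u * phi false 1 1).
  by rewrite /c1 phi_sumE // expr0 mulr1.
have v1E : v1 = u * theta false 1 1 by exact: theta_sumE.
have t1E : t1 = u * theta true 1 1 by exact: theta_sumE.
have eE : (e c = c1) * (e v = v1) * (e t = t1).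
  rewrite /c /v /t !phi_sumE // !theta_sumE // !(rmorphM, rmorphD) /=.
  rewrite !(rmorph_qfact, rmorph_theta_prod, rmorph_phi_prod) /=.
  by rewrite rmorph_sign !rmorphXn /= ep ez ez' /c1 /v1 /t1 !theta_sumE // !phi_sumE.
have e_gam : e gam = gam.
  rewrite /gam rmorphM /= rmorph_theta_prod ep rmorph1; congr (_ * _).
  have := congr1 e phi1K; rewrite rmorphM /= rmorph_phi_prod ep rmorph1.
  by move/inv_uniq; apply.
have e_k : forall y, wronski_cst p N * y = 1 -> e y = y.
  move=> y Hy; have := congr1 e Hy; rewrite rmorphM rmorph1 rmorph_sum /=.
  rewrite (eq_bigr (fun b => ppow p (b * (2 * b + 1)))); last first.
    by move=> b _; rewrite rmorphXn /= ep.
  by move/inv_uniq; apply.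
have e_k' : e (wronski_cst' p N) = wronski_cst' p N.
  rewrite rmorph_sum; apply: eq_bigr => b _.
  by rewrite rmorphM /= rmorph_int rmorphXn /= ep.
pose k := hf * wronski_cst' p N * k1V.
(* By the quotient rule the derivative of s / t is the Wronskian over t^2, and the Wronskian is a
   constant times c v. *)
have Dgam : D (gam * s * tV) = X * (gam * k * tV ^+ 2 * c * v).
  have DthetaV a b : a * b = 1 -> D b = - (b ^+ 2 * D a).
    move=> ab; have := congr1 D ab; rewrite DD.2 (der1 DD) => /eqP.
    rewrite addrC addr_eq0 => /eqP Db.
    by rewrite -[D b]mul1r -ab [a * b]mulrC -mulrA Db; ring.
  have Dcst_prod m : D (theta_prod p m true 1 1) = 0 /\ D (phi_prod p m true 1 1) = 0.
    have Dfac n : D (1 + (-1) ^+ true * p ^+ n * 1 ^+ 2) = 0.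
      rewrite DD.1 (der1 DD) !DD.2 (der_sign DD) !(der_exp0 DD) ?(der1 DD) //.
      by rewrite !(mul0r, mulr0, addr0).
    have Dpr (x : nat -> K) : (forall i, D (x i) = 0) -> D (\prod_(i < m) x i) = 0.
      move=> Dx; elim: m => [|m IH]; first by rewrite big_ord0 der1.
      by rewrite big_ord_recr DD.2 IH Dx mul0r mulr0 addr0.
    pose w n : K := 1 + (-1) ^+ true * p ^+ n * 1 ^+ 2.
    have Dw n : D (w n * w n) = 0 by rewrite DD.2 Dfac mul0r mulr0 addr0.
    by split; [apply: (Dpr (fun i => w (2 * i).+1 * w (2 * i).+1)) |
               apply: (Dpr (fun i => w (2 * i).+2 * w (2 * i).+2))].
  have Dg : D gam = 0.
    rewrite /gam DD.2 (Dcst_prod N).1 mul0r (DthetaV _ _ phi1K) (Dcst_prod N).2.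
    by rewrite mulr0 oppr0 mulr0 addr0.
  have W := wronski_phi_theta pN zz' DD Dp Dz; rewrite -/s -/t in W.
  have CV := phi_theta_wronski pN zz'; rewrite -/c -/v in CV.
  have WE : wronski_sum p N z z' = k1V * (c * v).
    by rewrite CV mulrA [k1V * _]mulrC k1K mul1r.
  transitivity (gam * tV ^+ 2 * (D s * t - s * D t) + gam * D s * tV * (1 - t * tV)).
    by rewrite (DD.2 (gam * s)) (DD.2 gam) Dg (DthetaV _ _ tK); ring.
  by rewrite W WE tK subrr mulr0 addr0 /k; ring.
have R2 : gam * hf * c1 * v1 = 1.
  rewrite c1E v1E /gam.
  transitivity ((2%:R * hf) * (u ^+ 2 * phi1V) *
    (phi false 1 1 * theta false 1 1 * theta true 1 1)); first by ring.
  by rewrite two_hf -phi_at1 phi1K theta_at1_product !mulr1.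
have ek : e k = k by rewrite /k !rmorphM /= e_hf e_k' (e_k _ k1K).
clearbody k gam tV.
(* The constant is read off at x = 0. Multiplication by X need not be injective, but [X_inj] still
   recovers the values there. *)
have kE : k = hf * t1 ^+ 2.
  have := X_inj (etrans (esym DXf) (etrans (congr1 D FE) Dgam)).
  rewrite eg !rmorphM /= !eE e_gam ek.
  set etV := e tV; have t1K : t1 * etV = 1 by rewrite -eE -rmorphM tK rmorph1.
  move=> R1.
  transitivity (k * (gam * hf * c1 * v1) * (t1 * etV) ^+ 2 ); first by rewrite R2 t1K; ring.
  transitivity (hf * t1 ^+ 2 * (gam * k * (etV * etV) * c1 * v1)); first by ring.
  by rewrite -R1 mulr1.
have J1 := jacobi_phi pN zz'; have J2 := jacobi_theta pN zz'.
rewrite -/c -/v -/s -/t -/c1 -/v1 -/t1 in J1 J2.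
rewrite -c1E -v1E FE Dgam kE.
(* In the square, t1^4 is shared out so that c^2 t1^2 and v^2 t1^2 appear, the left sides of
   Jacobi's identities. *)
transitivity (X ^+ 2 * gam ^+ 2 * hf ^+ 2 * tV ^+ 4 * (c ^+ 2 * t1 ^+ 2) *
  (v ^+ 2 * t1 ^+ 2)); first by ring.
rewrite J1 J2.
transitivity (X ^+ 2 * ((gam * hf * c1 * v1) ^+ 2 * (t * tV) ^+ 4 +
   hf ^+ 2 * (v1 ^+ 4 + p * c1 ^+ 4) * (gam * s * tV) ^+ 2 * (t * tV) ^+ 2 +
   hf ^+ 2 * gam ^+ 2 * p * v1 ^+ 2 * c1 ^+ 2 * (s * tV) ^+ 4)); first by ring.
rewrite R2 tK !expr1n.
transitivity (X ^+ 2 * (1 + hf ^+ 2 * (v1 ^+ 4 + p * c1 ^+ 4) * (gam * s * tV) ^+ 2 +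
   hf ^+ 2 * gam ^+ 2 * p * v1 ^+ 2 * c1 ^+ 2 * (s * tV) ^+ 4 *
   (gam * hf * c1 * v1) ^+ 2)); first by rewrite R2; ring.
by ring.
Qed.
End ThetaODE.

(** * Universal weighted polynomials in the parameters of an elliptic series *)

Section WeightedRelation.
Variables (F : numFieldType) (C1 C2 : comNzRingType).
Variables (iota1 : {rmorphism F -> C1}) (iota2 : {rmorphism F -> C2}).
Variables (d1 e1 : C1) (d2 e2 : C2).

(* Pairs of values, at (d1, e1) and (d2, e2), of one polynomial over F that is
   homogeneous when d has weight 4 and e has weight 8. *)
Inductive hrel : nat -> C1 -> C2 -> Prop :=
| hrel0 w : hrel w 0 0
| hrelD w x1 x2 y1 y2 :
    hrel w x1 x2 -> hrel w y1 y2 -> hrel w (x1 + y1) (x2 + y2)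
| hrel_monomial c a b : hrel (4 * a + 8 * b)
    (iota1 c * d1 ^+ a * e1 ^+ b) (iota2 c * d2 ^+ a * e2 ^+ b).

Lemma hrelM v w x1 x2 y1 y2 :
  hrel v x1 x2 -> hrel w y1 y2 -> hrel (v + w) (x1 * y1) (x2 * y2).
Proof.
elim=> [{}v|{}v u1 u2 {}x1 {}x2 _ IHu _ IHx|c a b] Hy.
- by rewrite !mul0r; apply: hrel0.
- by rewrite !mulrDl; apply: hrelD; [apply: IHu | apply: IHx].
elim: Hy => [{}w|{}w u1 u2 {}y1 {}y2 _ IHu _ IHy|c' a' b'].
- by rewrite !mulr0; apply: hrel0.
- by rewrite !mulrDr; apply: hrelD.
have -> : (4 * a + 8 * b + (4 * a' + 8 * b') = 4 * (a + a') + 8 * (b + b'))%N by lia.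
have mon (C : comNzRingType) (iota : {rmorphism F -> C}) (d e : C) :
    iota c * d ^+ a * e ^+ b * (iota c' * d ^+ a' * e ^+ b') =
    iota (c * c') * d ^+ (a + a') * e ^+ (b + b').
  by rewrite rmorphM !exprD; ring.
by rewrite !mon; apply: hrel_monomial.
Qed.

Lemma hrel_cst c : hrel 0 (iota1 c) (iota2 c).
Proof. by have := hrel_monomial c 0 0; rewrite !expr0 !mulr1. Qed.

Lemma hrel1 : hrel 0 1 1.
Proof. by have := hrel_cst 1; rewrite !rmorph1. Qed.

Lemma hrelZ c w x1 x2 : hrel w x1 x2 -> hrel w (iota1 c * x1) (iota2 c * x2).
Proof. exact: hrelM (hrel_cst c). Qed.

Lemma hrelN w x1 x2 : hrel w x1 x2 -> hrel w (- x1) (- x2).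
Proof. by move/(hrelZ (-1)); rewrite !rmorphN1 !mulN1r. Qed.

Lemma hrelB w x1 x2 y1 y2 :
  hrel w x1 x2 -> hrel w y1 y2 -> hrel w (x1 - y1) (x2 - y2).
Proof. by move=> Hx /hrelN; apply: hrelD. Qed.

Lemma hrel_nat n w x1 x2 : hrel w x1 x2 -> hrel w (n%:R * x1) (n%:R * x2).
Proof. by move/(hrelZ n%:R); rewrite !rmorph_nat. Qed.

Lemma hrel_sum (I : Type) (r : seq I) (P : pred I) w (x1 : I -> C1) (x2 : I -> C2) :
  (forall i, P i -> hrel w (x1 i) (x2 i)) ->
  hrel w (\sum_(i <- r | P i) x1 i) (\sum_(i <- r | P i) x2 i).
Proof.
move=> H; elim: r => [|i r IH]; first by rewrite !big_nil; apply: hrel0.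
by rewrite !big_cons; case: ifP => Pi //; apply: hrelD => //; apply: H.
Qed.

Lemma hrel_d : hrel 4 d1 d2.
Proof. by have := hrel_monomial 1 1 0; rewrite !expr0 !expr1 !rmorph1 !mulr1 !mul1r. Qed.

Lemma hrel_e : hrel 8 e1 e2.
Proof. by have := hrel_monomial 1 0 1; rewrite !expr0 !expr1 !rmorph1 !mulr1 !mul1r. Qed.

(** A monomial d^a e^b of weight 8k+4 has a = 2k+1-2b and b <= k, so a homogeneous polynomial of
    this weight is given by k+1 scalars. The same scalars serve both pairs of parameters, which is
    how one side of the theorem reaches the other. *)
Lemma hrelP k x1 x2 : hrel (8 * k + 4) x1 x2 ->
  exists c : nat -> F,
    x1 = \sum_(r < k.+1) iota1 (c r) * (d1 ^+ (2 * k + 1 - 2 * r) * e1 ^+ r) /\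
    x2 = \sum_(r < k.+1) iota2 (c r) * (d2 ^+ (2 * k + 1 - 2 * r) * e2 ^+ r).
Proof.
move: (erefl (8 * k + 4)%N); move: {1 3}(8 * k + 4)%N => w we H.
elim: H we => {w} [w|w x1' x2' y1 y2 _ IHx _ IHy|c a b] we.
- by exists (fun=> 0); split; rewrite big1 // => r _; rewrite rmorph0 mul0r.
- have [cx [-> ->]] := IHx we; have [cy [-> ->]] := IHy we.
  exists (fun r => cx r + cy r).
  by split; rewrite -big_split; apply: eq_bigr => r _; rewrite rmorphD mulrDl.
have lt_bk : (b < k.+1)%N by lia.
have ea : a = (2 * k + 1 - 2 * b)%N by lia.
exists (fun r => if r == b then c else 0).
by split; rewrite (bigD1 (Ordinal lt_bk)) //= eqxx ea -mulrA big1 ?addr0 // => r;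
  rewrite -val_eqE /= => /negPf->; rewrite rmorph0 mul0r.
Qed.

Section Series.
Variable M : nat.
Local Notation U1 := (tps C1 M).
Local Notation U2 := (tps C2 M).

(** The variable of the series will be a 2-form, whence weight 2j for the coefficient of index j. *)
Definition srel (m : nat) (u1 : U1) (u2 : U2) : Prop :=
  forall j, (j <= m)%N -> hrel (2 * j) (tcoef u1 j) (tcoef u2 j).

Lemma srelM m u1 u2 v1 v2 : (m <= M)%N ->
  srel m u1 u2 -> srel m v1 v2 -> srel m (u1 * v1) (u2 * v2).
Proof.
move=> le_mM Hu Hv j le_jm; rewrite !tcoefM ?(leq_trans le_jm) //.
apply: hrel_sum => i _; have lt_ij := ltn_ord i.
have -> : (2 * j = 2 * i + 2 * (j - i))%N by lia.
by apply: hrelM; [apply: Hu | apply: Hv]; lia.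
Qed.

(** Jacobi's equation F'^2 = 1 - (d/4) F^2 + e F^4 for F = X f, multiplied by X^2 because [euler]
    gives X F'. *)
Definition elliptic (C : comNzRingType) (iota : {rmorphism F -> C}) (d e : C)
    (f : tps C M) : Prop :=
  euler (tX C M * f) ^+ 2 = tX C M ^+ 2 *
    (1 - tC M (iota 4^-1 * d) * (tX C M * f) ^+ 2 + tC M e * (tX C M * f) ^+ 4).

Lemma tcoefX2 (C : comNzRingType) (u : tps C M) j : (j.+2 <= M)%N ->
  tcoef (tX C M ^+ 2 * u) j.+2 = tcoef u j.
Proof. by move=> le_jM; rewrite expr2 -mulrA !tcoefXMS // ltnW. Qed.

Lemma tcoefX2_low (C : comNzRingType) (u : tps C M) j : (j < 2)%N ->
  tcoef (tX C M ^+ 2 * u) j = 0.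
Proof.
rewrite expr2 -mulrA; case: j => [|[|//]] _; first by rewrite tcoefXM0.
case: (ltnP 0 M) => [lt_0M|le_M0]; first by rewrite tcoefXMS ?tcoefXM0.
by rewrite tcoef_gt.
Qed.

(** Cancelling the factor X^2 costs the two highest coefficients, hence the bound on j. *)
Lemma elliptic_coef (C : comNzRingType) (iota : {rmorphism F -> C}) (d e : C)
    (f : tps C M) j : elliptic iota d e f -> (j.+2 <= M)%N ->
  \sum_(i < j.+1) (i.+1%:R * tcoef f i) * ((j - i).+1%:R * tcoef f (j - i)) =
  (j == 0%N)%:R - iota 4^-1 * d * tcoef (tX C M ^+ 2 * (f * f)) j
  + e * tcoef (tX C M ^+ 2 * (tX C M ^+ 2 * (f * f * (f * f)))) j.
Proof.
set X := tX C M => E le_jM.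
have Df : euler (X * f) = X * (f + euler f).
  by rewrite (euler_derivation C M).2 eulerX mulrDr.
have cE i : tcoef (f + euler f) i = i.+1%:R * tcoef f i.
  by rewrite tcoefD tcoef_euler -[i.+1%:R]natr1; ring.
transitivity (tcoef ((f + euler f) * (f + euler f)) j).
  by rewrite tcoefM ?(leq_trans _ le_jM) 1?ltnW //; apply: eq_bigr => i _; rewrite !cE.
transitivity (tcoef (1 - tC M (iota 4^-1 * d) * (X ^+ 2 * (f * f))
     + tC M e * (X ^+ 2 * (X ^+ 2 * (f * f * (f * f))))) j); last first.
  by rewrite !tcoefD tcoefN !tcoefCM tcoef1.
rewrite -!(tcoefX2 _ le_jM) -/X; congr (tcoef _ _).
transitivity (euler (X * f) ^+ 2); first by rewrite Df; ring.
by rewrite E; ring.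
Qed.

Variables (f1 : U1) (f2 : U2).
Hypotheses (f10 : tcoef f1 0 = 1) (f20 : tcoef f2 0 = 1).
Hypotheses (E1 : elliptic iota1 d1 e1 f1) (E2 : elliptic iota2 d2 e2 f2).

(** The equation is a recursion for the coefficients of [f] in which [d] comes with a shift by two
    and [e] with a shift by four in the index. This matches the weights 4 and 8, so induction shows
    the coefficients to be the same weighted polynomials for both solutions. *)
Lemma elliptic_rel : srel (M - 2) f1 f2.
Proof.
have inv2 j (C : comNzRingType) (iota : {rmorphism F -> C}) (x : C) :
    iota ((2 * j.+1)%:R^-1) * ((2 * j.+1)%:R * x) = x.
  rewrite mulrA -(rmorph_nat iota) -rmorphM mulVf ?pnatr_eq0 //.
  by rewrite rmorph1 mul1r.
move=> j; elim/ltn_ind: j => -[|j] IH le_jM.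
  by rewrite f10 f20 muln0; apply: hrel1.
have le_jM2 : (j.+3 <= M)%N by lia.
have low2 : srel j (f1 * f1) (f2 * f2).
  by apply: srelM; [lia | |] => i le_ij; apply: IH; lia.
have low4 : srel j (f1 * f1 * (f1 * f1)) (f2 * f2 * (f2 * f2)).
  by apply: srelM => //; lia.
have shift (m : nat) (u1 : U1) (u2 : U2) : srel m u1 u2 -> (m <= M - 2)%N ->
    forall i, (i <= m.+2)%N ->
    hrel (2 * (i - 2)) (tcoef (tX C1 M ^+ 2 * u1) i) (tcoef (tX C2 M ^+ 2 * u2) i).
  move=> Hu le_mM [|[|i]] le_im; try by rewrite !tcoefX2_low //; apply: hrel0.
  rewrite !tcoefX2 //; try lia.
  by rewrite subSS subSS subn0; apply: Hu; lia.
(* The two extreme terms of the squared derivative contribute 2 (j+2) times the coefficient of index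
   j+1; everything else is of lower index. *)
have eqn (C : comNzRingType) (iota : {rmorphism F -> C}) (d e : C) (f : tps C M) :
    tcoef f 0 = 1 -> elliptic iota d e f -> tcoef f j.+1 = iota ((2 * j.+2)%:R^-1) *
    (- (iota 4^-1 * d * tcoef (tX C M ^+ 2 * (f * f)) j.+1)
    + e * tcoef (tX C M ^+ 2 * (tX C M ^+ 2 * (f * f * (f * f)))) j.+1
    - \sum_(i < j) (i.+2%:R * tcoef f i.+1) * ((j - i).+1%:R * tcoef f (j - i))).
  move=> f0 E; have := elliptic_coef E (j := j.+1) le_jM2.
  rewrite big_ord_recl big_ord_recr /= subn0 f0 subnn f0 sub0r.
  move=> /(congr1 (fun x => x - \sum_(i < j) (i.+2%:R * tcoef f i.+1) *
    ((j - i).+1%:R * tcoef f (j - i)))) <-.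
  rewrite -[LHS](inv2 j.+1 _ iota) mul2n -addnn natrD; congr (_ * _).
  have -> : \sum_(i < j) (bump 0 i).+1%:R * tcoef f (bump 0 i) *
      ((j.+1 - bump 0 i).+1%:R * tcoef f (j.+1 - bump 0 i)) =
      \sum_(i < j) (i.+2%:R * tcoef f i.+1) * ((j - i).+1%:R * tcoef f (j - i)).
    by apply: eq_bigr => i _; rewrite /bump /= add1n subSS.
  by rewrite /bump /= add1n; ring.
rewrite (eqn _ _ _ _ _ f10 E1) (eqn _ _ _ _ _ f20 E2).
apply: hrelZ; apply: hrelB; last first.
  apply: hrel_sum => i _; have lt_ij := ltn_ord i.
  have -> : (2 * j.+1 = 2 * i.+1 + 2 * (j - i))%N by lia.
  by apply: hrelM; apply: hrel_nat; apply: IH; lia.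
have shift2 := shift _ _ _ low2 _ j.+1; have shift4 := shift _ _ _ low4 _.
apply: hrelD.
  apply: hrelN; case: j IH le_jM le_jM2 low2 low4 shift2 shift4 {eqn} =>
    [|j] _ le_jM _ _ _ shift2 _.
    by rewrite !tcoefX2_low // !mulr0; apply: hrel0.
  have -> : (2 * j.+2 = 4 + 2 * (j.+2 - 2))%N by lia.
  by apply: hrelM; [apply/hrelZ/hrel_d | apply: shift2; lia].
case: (ltnP j 3) => [lt_j3|le_3j].
  have z (C : comNzRingType) (f : tps C M) :
      tcoef (tX C M ^+ 2 * (tX C M ^+ 2 * f)) j.+1 = 0.
    case: j lt_j3 le_jM2 {IH le_jM low2 low4 shift2 shift4 eqn} => [|[|[|//]]] _ le.
    - by rewrite tcoefX2_low.
    - by rewrite tcoefX2 ?tcoefX2_low //; lia.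
    - by rewrite tcoefX2 ?tcoefX2_low //; lia.
  by rewrite !z !mulr0; apply: hrel0.
have -> : (j.+1 = (j - 3).+4)%N by lia.
rewrite !tcoefX2; try lia.
have -> : (2 * (j - 3).+4 = 8 + 2 * (j - 3))%N by lia.
by apply: hrelM; [apply: hrel_e | apply: low4; lia].
Qed.

(** The characteristic series of the genus is 1 / f, hence the sign. Its logarithmic derivative is
    obtained from [f] by a recursion that respects weights. *)
Lemma log_der_rel (G1 : U1) (G2 : U2) :
  log_der (@euler C1 M) (- G1) f1 -> log_der (@euler C2 M) (- G2) f2 ->
  srel (M - 2) G1 G2.
Proof.
move=> L1 L2 j; elim/ltn_ind: j => j IH le_jM.
have eqn (C : comNzRingType) (G f : tps C M) : tcoef f 0 = 1 ->
    log_der (@euler C M) (- G) f ->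
    tcoef G j = - (j%:R * tcoef f j + \sum_(i < j) tcoef G i * tcoef f (j - i)).
  move=> f0 L; rewrite -tcoef_euler L mulNr tcoefN tcoefM; last by lia.
  by rewrite big_ord_recr /= subnn f0; ring.
rewrite (eqn _ _ _ f10 L1) (eqn _ _ _ f20 L2); apply: hrelN; apply: hrelD.
  by apply/hrel_nat/elliptic_rel.
apply: hrel_sum => i _; have lt_ij := ltn_ord i.
have -> : (2 * j = 2 * i + 2 * (j - i))%N by lia.
by apply: hrelM; [apply: IH; lia | apply: elliptic_rel; lia].
Qed.
End Series.
End WeightedRelation.

(** * The two elliptic series: theta quotient and perturbed hyperbolic tangent *)

Section Instances.
Variables (F : numFieldType) (C : comNzRingType) (iota : {rmorphism F -> C}).
Variable M : nat.
Hypothesis M_gt0 : (0 < M)%N.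
Local Notation U := (tps C M).
Local Notation X := (tX C M).
Local Notation euler := (@euler C M).
Local Notation texp := (texp iota M).
Local Notation sh := (tsinhc iota M).
Local Notation ch := (tcosh iota M).
Local Notation ED := (@euler_derivation C M).

Definition tinv (u : U) : U := \sum_(j < M.+1) (1 - u) ^+ j.

Lemma tinvK (u : U) : tcoef u 0 = 1 -> u * tinv u = 1.
Proof.
move=> u0; have := one_sub_nil_inv (x := 1 - u) (N := M.+1).
rewrite opprB addrCA subrr addr0; apply; apply: tps_nilp.
by rewrite tcoefD tcoefN tcoef1 u0 subrr.
Qed.

Lemma tsinhc_coef0 : tcoef sh 0 = 1.
Proof. by rewrite tcoef_mk //= expr0 divr1 rmorph1. Qed.

Lemma tcosh_coef0 : tcoef ch 0 = 1.
Proof. by rewrite tcoef_mk //= expr0 divr1 rmorph1. Qed.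

(** The logarithmic derivative, for [euler], of (x/2) / sinh(x/2). *)
Definition ahat_log : U := - (euler sh * tinv sh).

Lemma log_der_sinhc : log_der euler (- ahat_log) sh.
Proof.
by rewrite /log_der /ahat_log opprK -mulrA [tinv sh * _]mulrC tinvK ?tsinhc_coef0 ?mulr1.
Qed.

(** For w = e^(cx), this is x t w / (1 + t w) with the geometric series cut off by the nilpotency of
    [t]; times c, it is the logarithmic derivative of 1 + t w. *)
Definition tlog (N : nat) (t : C) (w : U) : U :=
  X * (tC M t * w) * \sum_(j < N) (- (tC M t * w)) ^+ j.

Lemma tlogK (N : nat) (t : C) (w : U) : t ^+ N = 0 ->
  (1 + tC M t * w) * \sum_(j < N) (- (tC M t * w)) ^+ j = 1.
Proof.
move=> tN; have := one_sub_nil_inv (x := - (tC M t * w)) (N := N).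
by rewrite opprK; apply; rewrite exprNn exprMn -rmorphXn tN rmorph0 mul0r mulr0.
Qed.

Lemma log_der_tlog (N : nat) (t : C) (c : F) : t ^+ N = 0 ->
  log_der euler (tC M (iota c) * tlog N t (texp c)) (1 + tC M t * texp c).
Proof.
move=> tN; rewrite /log_der ED.1 (der1 ED) add0r (der_cst ED) ?eulerC //.
rewrite euler_texp /tlog.
transitivity (tC M (iota c) * X * (tC M t * texp c) *
   ((1 + tC M t * texp c) * \sum_(j < N) (- (tC M t * texp c)) ^+ j)).
  by rewrite tlogK //; ring.
by ring.
Qed.

(** Evaluation at x = 0, as an endomorphism; it serves as [e] in [theta_ode]. *)
Definition tev (u : U) : U := tC M (tcoef u 0).

Lemma tev_is_zmod_morphism : zmod_morphism tev.
Proof. by move=> u v; rewrite /tev tcoefD tcoefN rmorphB. Qed.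

Lemma tev_is_monoid_morphism : monoid_morphism tev.
Proof. by split=> [|u v]; rewrite /tev ?tcoef1 ?rmorph1 // tcoefM0 rmorphM. Qed.

HB.instance Definition _ := GRing.isZmodMorphism.Build U U tev tev_is_zmod_morphism.
HB.instance Definition _ :=
  GRing.isMonoidMorphism.Build U U tev tev_is_monoid_morphism.

Lemma tevC c : tev (tC M c) = tC M c.
Proof. by rewrite /tev tcoefC eqxx. Qed.

Lemma tev1 u : tcoef u 0 = 1 -> tev u = 1.
Proof. by rewrite /tev => ->; rewrite rmorph1. Qed.

Section Side2.
Variables (p : C) (N : nat).
Hypothesis pN : p ^+ N = 0.
Local Notation w := (texp 1).
Local Notation w' := (texp (- 1)).
Local Notation q := (qfact (p ^+ 2) N).

Definition theta_log (t : C) : U := tlog N t w - tlog N t w'.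

(** The logarithmic derivative of (x/2) / sinh(x/2) times the product over i of the factors 1 -
    p^(2i+1) e^(+-x), divided by the factors 1 - p^(2i+2) e^(+-x): the contribution of a pair of
    roots x, -x to Ahat ch(Theta_2). *)
Definition Theta_log : U := ahat_log +
  \sum_(i < N) (theta_log (- p ^+ (2 * i).+1) - theta_log (- p ^+ (2 * i).+2)).

Definition theta3_cst : C := q * theta_prod p N false 1 1.
Definition theta1_cst : C := q * phi_prod p N false 1 1.

Lemma pX_nil m : (- p ^+ m.+1) ^+ N = 0.
Proof. by rewrite exprNn -exprM (expr_nil pN) ?mulr0 // leq_pmull. Qed.

Lemma log_der_factor m :
  log_der euler (theta_log (- p ^+ m.+1))
   ((1 + (-1) ^+ true * tC M p ^+ m.+1 * texp 2^-1 ^+ 2) *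
    (1 + (-1) ^+ true * tC M p ^+ m.+1 * texp (- 2^-1) ^+ 2)).
Proof.
have half (c : F) : c + c = c *+ 2 by rewrite mulr2n.
have e1 : (2^-1 + 2^-1 = 1 :> F) by field.
have e2 : (- 2^-1 + - 2^-1 = - 1 :> F) by rewrite -opprD e1.
rewrite !expr2 -!texpD e1 e2 expr1 mulN1r -rmorphXn -rmorphN.
have := log_derM ED (log_der_tlog 1 (pX_nil m)) (log_der_tlog (- 1) (pX_nil m)).
by rewrite (rmorphN1 iota) (rmorphN1 (tC M)) !rmorph1 mul1r mulN1r.
Qed.

(** Here X f is theta_1 / theta_4 at z = e^(x/2), to which [theta_ode] applies. Expanding the
    product of the two factors found there gives d = -(16 p theta1^4 + theta3^4) and e = p theta1^4
    theta3^4. *)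
Lemma Theta_elliptic : exists f : U, [/\ tcoef f 0 = 1,
  log_der euler (- Theta_log) f &
  elliptic iota (- (16%:R * p * theta1_cst ^+ 4 + theta3_cst ^+ 4))
    (p * theta1_cst ^+ 4 * theta3_cst ^+ 4) f].
Proof.
pose z := texp 2^-1; pose z' := texp (- 2^-1); pose P := tC M p.
have PN : P ^+ N = 0 by rewrite -rmorphXn pN rmorph0.
have zz' : z * z' = 1 by exact: texpN.
have fac_inv (m : nat) (y y' : C) : exists v,
    (1 + (-1) ^+ true * p ^+ m.+1 * y ^+ 2) * (1 + (-1) ^+ true * p ^+ m.+1 * y' ^+ 2) * v = 1.
  have one (x : C) : exists v, (1 + (-1) ^+ true * p ^+ m.+1 * x ^+ 2) * v = 1.
    exists (\sum_(j < N) (p ^+ m.+1 * x ^+ 2) ^+ j).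
    rewrite expr1 mulN1r mulNr; apply: one_sub_nil_inv.
    by rewrite exprMn -exprM (expr_nil pN) ?mul0r // leq_pmull.
  have [v Hv] := one y; have [v' Hv'] := one y'.
  by exists (v * v'); rewrite mulrACA Hv Hv' mulr1.
have [phi1V phi1K] : exists v, phi_prod p N true 1 1 * v = 1 by apply: prod_inv => i.
have [th1V th1K] : exists v, theta_prod p N true 1 1 * v = 1 by apply: prod_inv => i.
have evth : tev (theta_prod P N true z z') = tC M (theta_prod p N true 1 1).
  rewrite rmorph_theta_prod /= tevC !tev1 ?texp_coef0 //.
  by rewrite rmorph_theta_prod rmorph1.
have evph : tev (phi_prod P N true z z') = tC M (phi_prod p N true 1 1).
  rewrite rmorph_phi_prod /= tevC !tev1 ?texp_coef0 //.
  by rewrite rmorph_phi_prod rmorph1.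
have tC_inj a b : tC M a = tC M b -> a = b.
  by move/(congr1 (fun u => tcoef u 0)); rewrite !tcoefC.
have [thV thK] : exists v, theta_prod P N true z z' * v = 1.
  have [v Hv] : exists v, tC M th1V * theta_prod P N true z z' * v = 1.
    apply: tps_inv; apply: tC_inj; rewrite -[LHS]/(tev _) rmorphM /= evth tevC.
    by rewrite -rmorphM mulrC th1K.
  by exists (tC M th1V * v); rewrite mulrCA mulrA.
(* The factors taken at 1 normalize [f] to the value 1 at x = 0. *)
pose f := sh * phi_prod P N true z z' * tC M phi1V * theta_prod P N true 1 1 * thV.
have f0 : tev f = 1.
  rewrite /f !rmorphM /= evph !tevC tev1 ?tsinhc_coef0 // mul1r -rmorphM phi1K.
  rewrite rmorph1 mul1r rmorph_theta_prod /= tevC rmorph1.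
  have := congr1 tev thK; rewrite rmorphM rmorph1 /= evth.
  by rewrite rmorph_theta_prod rmorph1.
exists f; split.
- by apply: tC_inj; rewrite -[LHS]/(tev f) f0 rmorph1.
- have log_phi : log_der euler (\sum_(i < N) theta_log (- p ^+ (2 * i).+2))
      (phi_prod P N true z z').
    apply: (log_der_prod ED (l := fun i => theta_log (- p ^+ (2 * i).+2))
      (x := fun i => (1 + (-1) ^+ true * P ^+ (2 * i).+2 * z ^+ 2) *
                     (1 + (-1) ^+ true * P ^+ (2 * i).+2 * z' ^+ 2))) => i _.
    exact: log_der_factor.
  have log_th : log_der euler (\sum_(i < N) theta_log (- p ^+ (2 * i).+1))
      (theta_prod P N true z z').
    apply: (log_der_prod ED (l := fun i => theta_log (- p ^+ (2 * i).+1))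
      (x := fun i => (1 + (-1) ^+ true * P ^+ (2 * i).+1 * z ^+ 2) *
                     (1 + (-1) ^+ true * P ^+ (2 * i).+1 * z' ^+ 2))) => i _.
    exact: log_der_factor.
  have c1 : log_der euler 0 (tC M phi1V) by rewrite /log_der eulerC mul0r.
  have c2 : log_der euler 0 (theta_prod P N true 1 1).
    rewrite /log_der mul0r (_ : theta_prod P N true 1 1 = tC M (theta_prod p N true 1 1)).
      exact: eulerC.
    by rewrite rmorph_theta_prod rmorph1.
  have := log_derM ED (log_derM ED (log_derM ED (log_derM ED log_der_sinhc log_phi) c1) c2)
    (log_derV ED thK log_th).
  have -> : Theta_log = ahat_log + (\sum_(i < N) theta_log (- p ^+ (2 * i).+1)
      - \sum_(i < N) theta_log (- p ^+ (2 * i).+2)).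
    by rewrite -sumrB.
  by rewrite -/f; congr (log_der _ _ _); ring.
have two_half : 2%:R * tC M (iota 2^-1) = 1.
  by rewrite -(rmorph_nat (tC M)) -(rmorph_nat iota) -!rmorphM divff ?pnatr_eq0 // !rmorph1.
have X_inj (a b : U) : X * a = X * b -> tev a = tev b.
  by move=> e; rewrite /tev -(tcoefXMS a M_gt0) e tcoefXMS.
have Df : euler (X * f) = X * (f + euler f) by rewrite ED.2 eulerX mulrDr.
have eg : tev (f + euler f) = 1.
  rewrite rmorphD /= f0 [X in _ + X](_ : _ = 0) ?addr0 //.
  by rewrite /tev tcoef_euler mul0r rmorph0.
have phi1K' : phi_prod P N true 1 1 * tC M phi1V = 1.
  have -> : phi_prod P N true 1 1 = tC M (phi_prod p N true 1 1).
    by rewrite rmorph_phi_prod rmorph1.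
  by rewrite -rmorphM phi1K rmorph1.
have Dz : log_der euler (tC M (iota 2^-1) * X) z by exact: euler_texp.
have := @theta_ode _ P N euler tev PN ED (eulerC _ _) (tevC _) X (tC M (iota 2^-1))
  z z' sh two_half (tevC _) zz' (tev1 (texp_coef0 _ _ _)) (tev1 (texp_coef0 _ _ _))
  Dz (tsinhcE _ _) X_inj _ _ _ phi1K' thK Df eg.
rewrite -/f /elliptic => ->.
have -> : qfact (P ^+ 2) N * theta_prod P N false 1 1 = tC M theta3_cst.
  by rewrite rmorphM /= rmorph_qfact rmorph_theta_prod rmorphXn !rmorph1.
have -> : qfact (P ^+ 2) N * phi_prod P N false 1 1 = tC M theta1_cst.
  by rewrite rmorphM /= rmorph_qfact rmorph_phi_prod rmorphXn !rmorph1.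
have -> : iota 4^-1 = iota 2^-1 ^+ 2 by rewrite -rmorphXn; congr (iota _); field.
move: theta3_cst theta1_cst => a0 b0.
rewrite !(rmorph_nat, rmorphXn, rmorphN, rmorphM, rmorphD) /= -/P.
set hf := tC M (iota 2^-1) in two_half *.
move: (tC M a0) (tC M b0) (X * f) => a b g.
rewrite -mulrA; congr (_ * _).
transitivity (1 + hf ^+ 2 * a ^+ 4 * g ^+ 2 + hf ^+ 2 * P * (2%:R * b) ^+ 4 * g ^+ 2 +
  (2%:R * hf) ^+ 4 * P * b ^+ 4 * a ^+ 4 * g ^+ 4); first by ring.
by rewrite two_half; ring.
Qed.
End Side2.

Section Side1.
Variable q : C.
Hypothesis q2 : q ^+ 2 = 0.
Local Notation w := (texp 1).
Local Notation w' := (texp (- 1)).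

(** The logarithmic derivative of (x/2) / tanh(x/2). *)
Definition lhat_log : U := - (euler sh * tinv sh) + euler ch * tinv ch.

Lemma log_der_tanhc : log_der euler (- lhat_log) (sh * tinv ch).
Proof.
have Lc : log_der euler (euler ch * tinv ch) ch.
  by rewrite /log_der -mulrA [tinv ch * _]mulrC tinvK ?tcosh_coef0 ?mulr1.
have := log_derM ED log_der_sinhc (log_derV ED (tinvK tcosh_coef0) Lc).
by congr (log_der _ _ _); rewrite /lhat_log /ahat_log; ring.
Qed.

Definition sign_log : U := lhat_log + 2%:R * tC M q * X * (w - w').

(** For q = 0 the solution is F = 2 tanh(x/2), with F' = 1 - F^2/4. To first order in q the factor 1
    - 2q (e^x + e^(-x) - 2) moves (d, e) from (2, 1/16) to (2 + 48q, 1/16 - q), the expansion of the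
    elliptic parameters at the signature cusp. *)
Lemma sign_elliptic : exists f : U, [/\ tcoef f 0 = 1,
  log_der euler (- sign_log) f &
  elliptic iota (2%:R + 48%:R * q) (iota 16^-1 - q) f].
Proof.
pose z := texp 2^-1; pose z' := texp (- 2^-1); pose Q := tC M q.
have zz' : z * z' = 1 by exact: texpN.
have Q2 : Q ^+ 2 = 0 by rewrite -rmorphXn q2 rmorph0.
have e1 : (2^-1 + 2^-1 = 1 :> F) by field.
have e2 : (- 2^-1 + - 2^-1 = - 1 :> F) by rewrite -opprD e1.
have wE : w = z ^+ 2 by rewrite expr2 -texpD e1.
have w'E : w' = z' ^+ 2 by rewrite expr2 -texpD e2.
(* [b] is 4 sinh^2(x/2), that is e^x + e^(-x) - 2. *)
pose b := (z - z') ^+ 2.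
have bE : b = w + w' - 2%:R.
  by rewrite wE w'E /b; transitivity (z ^+ 2 + z' ^+ 2 - 2%:R * (z * z'));
    [ring | rewrite zz' mulr1].
pose g := 1 - 2%:R * Q * b.
have b0 : tcoef b 0 = 0.
  by rewrite tcoefX0 tcoefD tcoefN !texp_coef0 subrr expr0n.
have Db : euler b = X * (w - w').
  rewrite bE (derB ED) (der_nat ED) subr0 ED.1 !euler_texp rmorphN !rmorph1.
  by rewrite rmorphN rmorph1; ring.
exists (sh * tinv ch * g); split.
- have inv0 : tcoef (tinv ch) 0 = 1.
    have := congr1 (fun u => tcoef u 0) (tinvK tcosh_coef0).
    by rewrite tcoefM0 tcosh_coef0 mul1r tcoef1.
  rewrite !tcoefM0 tsinhc_coef0 inv0 !mul1r tcoefD tcoefN tcoef1 tcoefM0 b0.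
  by rewrite mulr0 subr0.
- have Lg : log_der euler (- (2%:R * Q * X * (w - w'))) g.
    rewrite /log_der (derB ED) (der1 ED) sub0r (der_cst ED) ?Db; last first.
      by rewrite ED.2 (der_nat ED) eulerC mul0r mulr0 addr0.
    transitivity (- (2%:R * Q * X * (w - w')) + Q ^+ 2 * (4%:R * X * (w - w') * b)).
      by rewrite Q2; ring.
    by rewrite /g; ring.
  have := log_derM ED log_der_tanhc Lg.
  by congr (log_der _ _ _); rewrite /sign_log; ring.
set kk := tC M (iota 2^-1) * tinv ch.
have kK : kk * (z + z') = 1.
  rewrite -tcoshE /kk.
  transitivity (tC M (iota 2^-1 * iota 2%:R) * (ch * tinv ch)).
    by rewrite rmorphM; ring.
  by rewrite tinvK ?tcosh_coef0 // mulr1 -rmorphM mulVf ?pnatr_eq0 // !rmorph1.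
(* [t] is tanh(x/2). With [bt] below, the claim becomes a polynomial identity in [t] and [b] modulo
   q^2. *)
pose t := (z - z') * kk.
have two_half : 2%:R * tC M (iota 2^-1) = 1.
  by rewrite -(rmorph_nat (tC M)) -(rmorph_nat iota) -!rmorphM divff ?pnatr_eq0 // !rmorph1.
have FE : X * (sh * tinv ch * g) = 2%:R * t * g.
  rewrite 2!mulrA tsinhcE /t /kk -/z -/z'.
  transitivity (2%:R * tC M (iota 2^-1) * ((z - z') * tinv ch * g)); last by ring.
  by rewrite two_half mul1r.
have bt : b * (1 - t ^+ 2) = 4%:R * t ^+ 2.
  transitivity (b * (1 - t ^+ 2) * (kk * (z + z')) ^+ 2); first by rewrite kK; ring.
  transitivity (t ^+ 2 * ((z + z') ^+ 2 - t ^+ 2 * (z + z') ^+ 2)).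
    by rewrite /b /t; ring.
  have -> : t ^+ 2 * (z + z') ^+ 2 = (z - z') ^+ 2.
    by transitivity ((z - z') ^+ 2 * (kk * (z + z')) ^+ 2);
      [rewrite /t; ring | rewrite kK; ring].
  transitivity (4%:R * t ^+ 2 * (z * z')); first by ring.
  by rewrite zz' mulr1.
have hE : tC M (iota 2^-1) * 2%:R = 1 by rewrite mulrC.
have Dt : euler t = tC M (iota 2^-1) * X * (1 - t ^+ 2).
  have Dz : euler z = tC M (iota 2^-1) * X * z by exact: euler_texp.
  have Dz' : euler z' = - (tC M (iota 2^-1) * X) * z'.
    by rewrite euler_texp rmorphN rmorphN mulNr.
  have Ls : log_der euler (tC M (iota 2^-1) * X * (z - z') * kk) (z + z').
    rewrite /log_der ED.1 Dz Dz'.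
    transitivity (tC M (iota 2^-1) * X * (z - z') * (kk * (z + z'))); last by ring.
    by rewrite kK; ring.
  have Dk := log_derV ED (etrans (mulrC _ _) kK) Ls; rewrite /log_der in Dk.
  rewrite {1}/t ED.2 (derB ED) Dz Dz' Dk.
  transitivity (tC M (iota 2^-1) * X * (kk * (z + z') - t ^+ 2)); last by rewrite kK.
  by rewrite /t; ring.
have DbE : euler b = X * (t * (b + 4%:R)).
  rewrite Db wE w'E.
  transitivity (X * ((z - z') * (z + z')) * (kk * (z + z'))); first by rewrite kK; ring.
  have -> : b + 4%:R = (z + z') ^+ 2.
    by transitivity ((z - z') ^+ 2 + 4%:R * (z * z')); [rewrite zz' mulr1 | ring].
  by rewrite /t; ring.
have Dg : euler g = - (2%:R * Q * (X * (t * (b + 4%:R)))).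
  rewrite /g (derB ED) (der1 ED) sub0r (der_cst ED) ?DbE //.
  by rewrite ED.2 (der_nat ED) eulerC mul0r mulr0 addr0.
have DF : euler (2%:R * t * g) =
    X * ((1 - t ^+ 2) * g - 4%:R * Q * t ^+ 2 * (b + 4%:R)).
  rewrite ED.2 ED.2 (der_nat ED) mul0r add0r Dt Dg.
  transitivity (X * ((tC M (iota 2^-1) * 2%:R) * ((1 - t ^+ 2) * g)
     - 4%:R * Q * t ^+ 2 * (b + 4%:R))); first by ring.
  by rewrite hE; ring.
rewrite /elliptic FE DF.
rewrite !(rmorph_nat, rmorphN, rmorphM, rmorphD, rmorphB) /= -/Q.
have -> : iota 4^-1 = iota 2^-1 ^+ 2 by rewrite -rmorphXn; congr (iota _); field.
have -> : iota 16^-1 = iota 2^-1 ^+ 4 by rewrite -rmorphXn; congr (iota _); field.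
rewrite !rmorphXn /=; set hf := tC M (iota 2^-1) in two_half hE *.
have G2 (y : U) : y * g ^+ 2 = y - 4%:R * Q * b * y.
  transitivity (y - 4%:R * Q * b * y + Q ^+ 2 * (4%:R * b ^+ 2 * y)); last first.
    by rewrite Q2; ring.
  by rewrite /g; ring.
have QQ (y : U) : Q ^+ 2 * y = 0 by rewrite Q2 mul0r.
pose c := 1 - t ^+ 2.
have lhs : (c * g - 4%:R * Q * t ^+ 2 * (b + 4%:R)) ^+ 2 =
    c ^+ 2 - 4%:R * Q * (b * c) * c - 8%:R * Q * t ^+ 2 * (b * c) - 32%:R * Q * t ^+ 2 * c.
  transitivity (c ^+ 2 - 4%:R * Q * (b * c) * c - 8%:R * Q * t ^+ 2 * (b * c)
     - 32%:R * Q * t ^+ 2 * c + Q ^+ 2 * (4%:R * b ^+ 2 * c ^+ 2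
     + 16%:R * c * b * t ^+ 2 * (b + 4%:R) + 16%:R * t ^+ 4 * (b + 4%:R) ^+ 2)).
    by rewrite /g; ring.
  by rewrite QQ addr0.
rewrite exprMn -/c lhs /c bt; congr (_ * _).
have rhs1 : (2%:R * t * g) ^+ 2 = 4%:R * t ^+ 2 - 16%:R * Q * (b * t ^+ 2).
  rewrite exprMn G2; ring.
have rhs2 : (2%:R * t * g) ^+ 4 = 16%:R * t ^+ 4 - 128%:R * Q * (b * t ^+ 2) * t ^+ 2.
  rewrite (exprM _ 2 2) rhs1.
  transitivity (16%:R * t ^+ 4 - 128%:R * Q * (b * t ^+ 2) * t ^+ 2 +
    Q ^+ 2 * (256%:R * (b * t ^+ 2) ^+ 2)); first by ring.
  by rewrite QQ addr0.
rewrite rhs1 rhs2.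
have bt2 : b * t ^+ 2 = b - 4%:R * t ^+ 2.
  by apply/eqP; rewrite -subr_eq0; apply/eqP;
    transitivity (4%:R * t ^+ 2 - b * (1 - t ^+ 2)); [ring | rewrite bt subrr].
have h4 : hf ^+ 2 * 4%:R = 1.
  by transitivity ((hf * 2%:R) ^+ 2); [ring | rewrite hE expr1n].
have h16 : hf ^+ 4 * 16%:R = 1.
  by transitivity ((hf * 2%:R) ^+ 4); [ring | rewrite hE expr1n].
transitivity (1 - (2%:R + 48%:R * Q) * ((hf ^+ 2 * 4%:R) * (t ^+ 2 - 4%:R * Q * (b * t ^+ 2)))
  + (hf ^+ 4 * 16%:R) * (t ^+ 4 - 8%:R * Q * (b * t ^+ 2) * t ^+ 2)
  - Q * (16%:R * t ^+ 4) + Q ^+ 2 * (128%:R * (b * t ^+ 2) * t ^+ 2)); last first.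
  by ring.
rewrite h4 h16 Q2 mul0r addr0 !mul1r.
transitivity (1 - (2%:R + 48%:R * Q) * t ^+ 2 + 8%:R * Q * (b * t ^+ 2)
  + t ^+ 4 - 8%:R * Q * (b * t ^+ 2) * t ^+ 2 - Q * (16%:R * t ^+ 4)
  + Q ^+ 2 * (192%:R * (b * t ^+ 2))); last by ring.
rewrite QQ addr0.
transitivity (1 - (2%:R + 48%:R * Q) * t ^+ 2 + t ^+ 4 - Q * (16%:R * t ^+ 4)
  + 8%:R * Q * t ^+ 2 * (b * (1 - t ^+ 2))); last by ring.
by rewrite bt; ring.
Qed.
End Side1.
End Instances.

(** * The commutative ring of even forms and its degree derivation *)

Section EvenForms.
Variables (C : comNzRingType) (n : nat).
Implicit Types (a b w : extalg C n) (S : {set 'I_n}).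

Definition even_form : {pred extalg C n} :=
  [pred w : extalg C n | [forall S : {set 'I_n}, odd #|S| ==> (w S == 0)]].

Lemma even_formP w :
  reflect (forall S, odd #|S| -> w S = 0) (w \in even_form).
Proof.
apply: (iffP forallP) => [H S oS|H S]; first by have /implyP/(_ oS)/eqP := H S.
by apply/implyP => /H/eqP.
Qed.

Lemma ext_mulE a b S : (a * b) S = \sum_(A in powerset S)
  (-1) ^+ inversions A (S :\: A) * (a A * b (S :\: A)).
Proof. by rewrite ffunE. Qed.

Lemma ext_oneE S : (1 : extalg C n) S = (S == set0)%:R.
Proof. by rewrite ffunE. Qed.

Lemma card_split (A S : {set 'I_n}) : A \subset S -> #|S| = (#|A| + #|S :\: A|)%N.
Proof. by move=> sAS; rewrite -(cardsID A S) (setIidPr sAS). Qed.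

Fact even_form_subring : subring_closed even_form.
Proof.
split=> [|a b /even_formP Ha /even_formP Hb|a b /even_formP Ha /even_formP Hb];
  apply/even_formP => S oS.
- by rewrite ext_oneE; case: eqP oS => // ->; rewrite cards0.
- by rewrite !ffunE Ha // Hb // subrr.
rewrite ext_mulE big1 // => A; rewrite inE => sAS.
move: oS; rewrite (card_split sAS) oddD.
case oA: (odd #|A|) => oB; first by rewrite Ha // mul0r mulr0.
by rewrite Hb // !mulr0.
Qed.

HB.instance Definition _ :=
  GRing.isSubringClosed.Build (extalg C n) even_form even_form_subring.

Record eform := EForm { eform_val :> extalg C n; _ : eform_val \in even_form }.

HB.instance Definition _ := [isSub for eform_val].
HB.instance Definition _ := [Choice of eform by <:].
HB.instance Definition _ := [SubChoice_isSubNzRing of eform by <:].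

(** Every pair of distinct indices is an inversion in exactly one of the two orders. *)
Lemma inversionsC (A S : {set 'I_n}) : [disjoint A & S] ->
  (inversions A S + inversions S A)%N = (#|A| * #|S|)%N.
Proof.
move=> dAS; rewrite /inversions [X in (_ + X)%N]exchange_big /= -big_split /=.
rewrite -sum_nat_const; apply: eq_bigr => x Ax.
rewrite -big_split /= -sum1_card; apply: eq_bigr => y Sy.
have ne : (x : nat) != y.
  by apply: contraTneq Sy => /val_inj <-; rewrite (disjointFr dAS Ax).
by case: ltngtP ne.
Qed.

(** Exchanging A with its complement in S changes the sign by (-1)^(|A| |S - A|), which is 1 when
    |A| is even; odd A contribute nothing. *)
Lemma eform_mulC : commutative (@GRing.mul eform).
Proof.
move=> a b; apply/val_inj; rewrite !rmorphM /=; apply/ffunP => S.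
rewrite !ext_mulE (reindex_onto (fun A => S :\: A) (fun A => S :\: A)) /=; last first.
  by move=> A; rewrite inE => sAS; rewrite setDDr setDv set0U; apply/setIidPr.
have sub A : (S :\: A \in powerset S) && (S :\: (S :\: A) == A) = (A \in powerset S).
  rewrite !inE subsetDl /= setDDr setDv set0U.
  by apply/eqP/idP => [<-|/setIidPr //]; apply: subsetIl.
rewrite (eq_bigl _ _ sub); apply: eq_bigr => A; rewrite inE => sAS.
have -> : S :\: (S :\: A) = A by rewrite setDDr setDv set0U; apply/setIidPr.
rewrite [eform_val b A * _]mulrC; case oA: (odd #|A|).
  by have /even_formP -> := valP b; rewrite ?mulr0.
congr (_ * _); rewrite -signr_odd -[RHS]signr_odd; congr (_ ^+ nat_of_bool _).
have dAS : [disjoint A & S :\: A].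
  by rewrite disjoint_sym disjoints_subset setDE subsetIr.
have := congr1 odd (inversionsC dAS); rewrite oddM oA oddD /=.
by case: (odd _); case: (odd _).
Qed.

HB.instance Definition _ :=
  GRing.PzRing_hasCommutativeMul.Build eform eform_mulC.
End EvenForms.

Section EvenFormTheory.
Variables (C : comNzRingType) (n : nat).
Local Notation E := (eform C n).
Implicit Types (w : E) (S : {set 'I_n}).

Definition ecoef w S : C := (\val w : extalg C n) S.

Lemma eform_ext w1 w2 : (forall S, ecoef w1 S = ecoef w2 S) -> w1 = w2.
Proof. by move=> H; apply/val_inj/ffunP. Qed.

Lemma ecoefD w1 w2 S : ecoef (w1 + w2) S = ecoef w1 S + ecoef w2 S.
Proof. by rewrite /ecoef rmorphD ffunE. Qed.

Lemma ecoef_zero S : ecoef 0 S = 0.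
Proof. by rewrite /ecoef rmorph0 ffunE. Qed.

Lemma ecoefN w S : ecoef (- w) S = - ecoef w S.
Proof. by apply/eqP; rewrite -addr_eq0 -ecoefD addNr ecoef_zero. Qed.

Lemma ecoef_sum (I : Type) (r : seq I) (P : pred I) (x : I -> E) S :
  ecoef (\sum_(i <- r | P i) x i) S = \sum_(i <- r | P i) ecoef (x i) S.
Proof.
exact: (big_morph (fun w => ecoef w S) (fun a b => ecoefD a b S) (ecoef_zero S)).
Qed.

Lemma ecoefM w1 w2 S : ecoef (w1 * w2) S = \sum_(A in powerset S)
  (-1) ^+ inversions A (S :\: A) * (ecoef w1 A * ecoef w2 (S :\: A)).
Proof. by rewrite /ecoef rmorphM ext_mulE. Qed.

Lemma ecoef1 S : ecoef 1 S = (S == set0)%:R.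
Proof. by rewrite /ecoef rmorph1 ext_oneE. Qed.

Lemma ecoefM0 w1 w2 : ecoef (w1 * w2) set0 = ecoef w1 set0 * ecoef w2 set0.
Proof.
rewrite ecoefM (bigD1 set0) ?inE ?sub0set //= setD0 inversions0l expr0 mul1r.
by rewrite big1 ?addr0 // => A; rewrite inE subset0 andbN.
Qed.

Lemma ecoef_odd w S : odd #|S| -> ecoef w S = 0.
Proof. by have /even_formP := valP w; apply. Qed.

Definition ecst0 w : C := ecoef w set0.

Lemma ecst0_is_zmod_morphism : zmod_morphism ecst0.
Proof. by move=> a b; rewrite /ecst0 ecoefD ecoefN. Qed.
Lemma ecst0_is_monoid_morphism : monoid_morphism ecst0.
Proof. by split=> [|a b]; rewrite /ecst0 ?ecoefM0 // ecoef1 eqxx. Qed.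
HB.instance Definition _ := GRing.isZmodMorphism.Build E C ecst0 ecst0_is_zmod_morphism.
HB.instance Definition _ :=
  GRing.isMonoidMorphism.Build E C ecst0 ecst0_is_monoid_morphism.

Fact eC_subproof (c : C) : (c *: 1 : extalg C n) \in @even_form C n.
Proof.
apply/even_formP => S oS; rewrite !ffunE.
by case: eqP oS => [->|_ _]; [rewrite cards0 | exact: mulr0].
Qed.

Definition eC (c : C) : E := EForm (eC_subproof c).

Lemma ecoefC c S : ecoef (eC c) S = if S == set0 then c else 0.
Proof.
rewrite /ecoef /= !ffunE /GRing.scale /=.
by case: eqP => _; [exact: mulr1 | exact: mulr0].
Qed.

Lemma ecoefCM c w S : ecoef (eC c * w) S = c * ecoef w S.
Proof.
rewrite ecoefM (bigD1 set0) ?inE ?sub0set //= setD0 inversions0l expr0 mul1r.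
rewrite ecoefC eqxx big1 ?addr0 // => A /andP[_ /negPf nA].
by rewrite ecoefC nA mul0r mulr0.
Qed.

Lemma eC_is_zmod_morphism : zmod_morphism eC.
Proof.
move=> a b; apply: eform_ext => S; rewrite ecoefD ecoefN !ecoefC.
by case: eqP; rewrite ?subr0.
Qed.
Lemma eC_is_monoid_morphism : monoid_morphism eC.
Proof.
split=> [|a b]; apply: eform_ext => S; rewrite ?ecoefCM !ecoefC ?ecoef1.
  by case: eqP.
by case: eqP; rewrite ?mulr0.
Qed.
HB.instance Definition _ := GRing.isZmodMorphism.Build C E eC eC_is_zmod_morphism.
HB.instance Definition _ := GRing.isMonoidMorphism.Build C E eC eC_is_monoid_morphism.

Fact edeg_subproof w :
  ([ffun S : {set 'I_n} => #|S|%:R * ecoef w S] : extalg C n) \in @even_form C n.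
Proof. by apply/even_formP => S oS; rewrite ffunE ecoef_odd ?mulr0. Qed.

(** The Euler operator of the exterior algebra. It plays for forms the role that [euler] plays for
    series. *)
Definition edeg w : E := EForm (edeg_subproof w).

Lemma ecoef_deg w S : ecoef (edeg w) S = #|S|%:R * ecoef w S.
Proof. by rewrite /ecoef /= ffunE. Qed.

Lemma edeg_derivation : derivation edeg.
Proof.
split=> a b; apply: eform_ext => S.
  by rewrite !(ecoefD, ecoef_deg) mulrDr.
rewrite ecoefD ecoef_deg !ecoefM mulr_sumr -big_split; apply: eq_bigr => A.
by rewrite inE => /card_split ->; rewrite !ecoef_deg natrD /=; ring.
Qed.

Lemma edegC c : edeg (eC c) = 0.
Proof.
apply: eform_ext => S; rewrite ecoef_deg ecoefC ecoef_zero.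
by case: eqP => [->|]; rewrite ?cards0 ?mul0r ?mulr0.
Qed.

(** The m-th power of a form without constant term lives in degrees at least m. *)
Lemma eform_nilp w : ecoef w set0 = 0 -> w ^+ n.+1 = 0.
Proof.
move=> w0; have low m S : (#|S| < m)%N -> ecoef (w ^+ m) S = 0.
  elim: m S => // m IH S; rewrite ltnS => le_Sm.
  rewrite exprS ecoefM big1 // => A; rewrite inE => sAS.
  have [->|nA] := eqVneq A set0; first by rewrite w0 mul0r mulr0.
  rewrite IH ?mulr0 //; move: le_Sm; rewrite (card_split sAS).
  by apply: leq_trans; rewrite -[X in (X < _)%N]add0n ltn_add2r card_gt0.
apply: eform_ext => S; rewrite low ?ecoef_zero // ltnS.
by have := max_card (mem S); rewrite card_ord.
Qed.

Hypothesis natreg : forall m (c : C), m.+1%:R * c = 0 -> c = 0.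

(** As the [l i j] have no constant term, the component of y_i on S, multiplied by |S|, involves the
    y_j only on sets smaller than S. Induction on |S| concludes. *)
Lemma edeg_uniq_fam (I : finType) (y : I -> E) (l : I -> I -> E) :
  (forall i, edeg (y i) = \sum_j l i j * y j) ->
  (forall i j, ecoef (l i j) set0 = 0) -> (forall i, ecoef (y i) set0 = 0) ->
  forall i, y i = 0.
Proof.
move=> Dy l0 y0 i; apply: eform_ext => S; rewrite ecoef_zero.
have [m] := ubnP #|S|; elim: m S i => // m IH S i; rewrite ltnS => le_Sm.
have [->//|nS] := eqVneq S set0.
have : (0 < #|S|)%N by rewrite card_gt0.
case cS: #|S| => [//|s] _; apply: (natreg (m := s)).
rewrite -cS -ecoef_deg Dy ecoef_sum big1 // => j _; rewrite ecoefM big1 // => A.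
rewrite inE => sAS; have [->|nA] := eqVneq A set0; first by rewrite l0 mul0r mulr0.
rewrite IH ?mulr0 //; apply: leq_trans le_Sm; rewrite (card_split sAS).
by rewrite -[X in (X < _)%N]add0n ltn_add2r card_gt0.
Qed.

Lemma edeg_uniq (l y : E) :
  ecoef l set0 = 0 -> ecoef y set0 = 0 -> log_der edeg l y -> y = 0.
Proof.
move=> l0 y0 Dy; apply: (edeg_uniq_fam (I := unit) (y := fun=> y) (l := fun _ _ => l)) => //.
  by move=> _; rewrite big_const card_unit /= addr0.
Qed.

Lemma edeg_hom0 m (w : E) : edeg w = m.+1%:R * w -> ecoef w set0 = 0.
Proof.
move=> Dw; apply: (natreg (m := m)).
have := congr1 (fun w => ecoef w set0) Dw.
rewrite ecoef_deg cards0 mul0r -(rmorph_nat eC) ecoefCM => <-.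
by [].
Qed.

Lemma edeg_hom m (w : E) S : edeg w = m%:R * w -> #|S| != m -> ecoef w S = 0.
Proof.
move=> Dw; have := congr1 (fun w => ecoef w S) Dw.
rewrite ecoef_deg -(rmorph_nat eC) ecoefCM => e; rewrite neq_ltn => /orP[lt|lt].
  apply: (natreg (m := (m - #|S|).-1)); rewrite prednK ?subn_gt0 //.
  by rewrite natrB ?(ltnW lt) // mulrBl -e subrr.
apply: (natreg (m := (#|S| - m).-1)); rewrite prednK ?subn_gt0 //.
by rewrite natrB ?(ltnW lt) // mulrBl -e subrr.
Qed.
End EvenFormTheory.

(** * Determinants, and power series evaluated at matrices of 2-forms *)

Section DerivationDet.
Variables (K : comNzRingType) (D : K -> K).
Hypothesis DD : derivation D.

Lemma der_prod (I : finType) (x : I -> K) :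
  D (\prod_i x i) = \sum_i \prod_j (if j == i then D (x j) else x j).
Proof.
have gen (r : seq I) : uniq r -> D (\prod_(i <- r) x i) =
    \sum_(i <- r) \prod_(j <- r) (if j == i then D (x j) else x j).
  elim: r => [|i r IH] /=; first by rewrite !big_nil der1.
  move=> /andP[ni ur]; rewrite !big_cons DD.2 IH // eqxx; congr (_ + _).
    congr (_ * _); apply: eq_big_seq => j jr.
    by rewrite (_ : j == i = false) //; apply: contraNF ni => /eqP <-.
  rewrite mulr_sumr; apply: eq_big_seq => j jr; rewrite big_cons.
  by rewrite (_ : i == j = false) //; apply: contraNF ni => /eqP ->.
by rewrite gen // index_enum_uniq.
Qed.

Lemma der_det m (Y : 'M[K]_m) :
  D (\det Y) = \sum_i \sum_j D (Y i j) * cofactor Y i j.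
Proof.
transitivity (\sum_i \det (\matrix_(k, l) (if k == i then D (Y k l) else Y k l))).
  rewrite /determinant (der_sum DD) exchange_big /=; apply: eq_bigr => s _.
  rewrite (der_cst DD) ?der_sign // der_prod mulr_sumr; apply: eq_bigr => i _.
  by congr (_ * _); apply: eq_bigr => j _; rewrite mxE.
apply: eq_bigr => i _; rewrite (expand_det_row _ i); apply: eq_bigr => j _.
rewrite mxE eqxx; congr (_ * (_ * \det _)); apply/matrixP => k l.
by rewrite !mxE eq_sym (negPf (neq_lift _ _)).
Qed.

(** Jacobi's formula: the derivative of the determinant is the trace of the adjugate times the
    derivative, and the adjugate is the determinant times the inverse. *)
Lemma log_der_det m (Y Yi : 'M[K]_m) : Y *m Yi = 1%:M ->
  log_der D (\tr (Yi *m map_mx D Y)) (\det Y).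
Proof.
move=> YK; rewrite /log_der der_det.
have adjE : \adj Y = \det Y *: Yi.
  by rewrite -[LHS]mulmx1 -YK mulmxA mul_adj_mx mul_scalar_mx.
transitivity (\tr (\adj Y *m map_mx D Y)).
  rewrite exchange_big; apply: eq_bigr => j _; rewrite mxE; apply: eq_bigr => i _.
  by rewrite !mxE mulrC.
by rewrite adjE -scalemxAl mxtraceZ mulrC.
Qed.
End DerivationDet.

Section FormMatrices.
Variables (C : comNzRingType) (n : nat).
Local Notation E := (eform C n).
Local Notation ED := (@edeg_derivation C n).
Local Notation edeg := (@edeg C n).
Local Notation eC := (@eC C n).

Definition mdeg a b (A : 'M[E]_(a, b)) : 'M[E]_(a, b) := map_mx edeg A.

Lemma mdegD a b (A B : 'M[E]_(a, b)) : mdeg (A + B) = mdeg A + mdeg B.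
Proof. by apply/matrixP => i j; rewrite !mxE ED.1. Qed.

Lemma mdeg0 a b : mdeg (0 : 'M[E]_(a, b)) = 0.
Proof. by apply/matrixP => i j; rewrite !mxE (der0 ED). Qed.

Lemma mdegB a b (A B : 'M[E]_(a, b)) : mdeg (A - B) = mdeg A - mdeg B.
Proof. by apply/matrixP => i j; rewrite !mxE (derB ED). Qed.

Lemma mdeg_sum a b (I : Type) (r : seq I) (P : pred I) (x : I -> 'M[E]_(a, b)) :
  mdeg (\sum_(i <- r | P i) x i) = \sum_(i <- r | P i) mdeg (x i).
Proof. exact: (big_morph _ (@mdegD a b) (@mdeg0 a b)). Qed.

Lemma mdegM a b c (A : 'M[E]_(a, b)) (B : 'M[E]_(b, c)) :
  mdeg (A *m B) = mdeg A *m B + A *m mdeg B.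
Proof.
apply/matrixP => i j; rewrite !mxE (der_sum ED) -big_split; apply: eq_bigr => k _.
by rewrite ED.2 !mxE.
Qed.

Lemma mdegZ a b c (A : 'M[E]_(a, b)) : mdeg (eC c *: A) = eC c *: mdeg A.
Proof. by apply/matrixP => i j; rewrite !mxE (der_cst ED) ?edegC. Qed.

Lemma mdeg_scalar m c : mdeg ((eC c)%:M : 'M[E]_m) = 0.
Proof.
by apply/matrixP => i j; rewrite !mxE (derMn ED) edegC mul0rn.
Qed.

Lemma mdeg1 m : mdeg (1%:M : 'M[E]_m) = 0.
Proof. by have := mdeg_scalar m 1; rewrite rmorph1. Qed.

Lemma edeg_trace m (A : 'M[E]_m) : edeg (\tr A) = \tr (mdeg A).
Proof. by rewrite (der_sum ED); apply: eq_bigr => i _; rewrite mxE. Qed.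

(** The entries are homogeneous of degree 2, expressed by the derivation so that the property passes
    through algebraic constructions. *)
Definition hom2 a b (A : 'M[E]_(a, b)) : Prop := mdeg A = 2%:R *: A.

Lemma mdeg_expr m (A : 'M[E]_m) j : hom2 A -> mdeg (A ^+ j) = (2 * j)%:R *: A ^+ j.
Proof.
move=> A2; elim: j => [|j IH]; first by rewrite muln0 scale0r mdeg1.
rewrite exprS mdegM IH A2 -scalemxAl -scalemxAr -scalerDl -natrD.
by rewrite -mulnS.
Qed.

Hypothesis natreg : forall m (c : C), m.+1%:R * c = 0 -> c = 0.

Lemma eform_natreg m (w : E) : m.+1%:R * w = 0 -> w = 0.
Proof.
move=> e; apply: eform_ext => S; rewrite ecoef_zero; apply: (natreg (m := m)).
have := congr1 (fun w => ecoef w S) e.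
by rewrite -(rmorph_nat eC) ecoefCM ecoef_zero.
Qed.

(** Uniqueness for linear systems; it stands in for power series arguments whenever two matrix
    exponentials are compared. *)
Lemma mdeg_uniq a b (L : 'M[E]_a) (Y : 'M[E]_(a, b)) :
  (forall i j, ecoef (L i j) set0 = 0) -> (forall i j, ecoef (Y i j) set0 = 0) ->
  mdeg Y = L *m Y -> Y = 0.
Proof.
move=> L0 Y0 DY; apply/matrixP => i j; rewrite [RHS]mxE.
apply: (edeg_uniq_fam natreg (y := fun i => Y i j) (l := fun i k => L i k)) => // k.
by have /matrixP/(_ k j) := DY; rewrite !mxE.
Qed.

Lemma hom2_coef0 a b (A : 'M[E]_(a, b)) i j : hom2 A -> ecoef (A i j) set0 = 0.
Proof. by move=> /matrixP/(_ i j); rewrite !mxE => /(edeg_hom0 natreg). Qed.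

Lemma hom2_expr_coef m (A : 'M[E]_m) j i k (S : {set 'I_n}) :
  hom2 A -> #|S| != (2 * j)%N -> ecoef ((A ^+ j) i k) S = 0.
Proof.
move=> A2; apply: (edeg_hom natreg).
by have /matrixP/(_ i k) := mdeg_expr j A2; rewrite !mxE.
Qed.

Lemma hom2_nilp m (A : 'M[E]_m) j : hom2 A -> (n < 2 * j)%N -> A ^+ j = 0.
Proof.
move=> A2 lt_nj; apply/matrixP => i k; apply: eform_ext => S.
rewrite [in RHS]mxE ecoef_zero hom2_expr_coef //.
apply: contraTneq lt_nj => <-; rewrite -leqNgt -[X in (_ <= X)%N]card_ord.
exact: max_card.
Qed.

Section Evaluation.
Variables (M : nat).
Hypothesis le_nM : (n <= M)%N.
Local Notation U := (tps C M).

Definition mev m (A : 'M[E]_m) (u : U) : 'M[E]_m :=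
  \sum_(j < M.+1) eC (tcoef u j) *: A ^+ j.

Variables (m : nat) (A : 'M[E]_m).
Hypothesis A2 : hom2 A.

Lemma mevD u v : mev A (u + v) = mev A u + mev A v.
Proof.
by rewrite -big_split; apply: eq_bigr => j _; rewrite tcoefD rmorphD scalerDl.
Qed.

Lemma mevC c : mev A (tC M c) = (eC c)%:M.
Proof.
rewrite /mev big_ord_recl big1 ?addr0 => [|j _].
  by rewrite tcoefC expr0 scalemx1.
by rewrite tcoefC rmorph0 scale0r.
Qed.

Lemma mev0 : mev A 0 = 0.
Proof. by rewrite -[0](rmorph0 (tC M)) mevC rmorph0 raddf0. Qed.

Lemma mev1 : mev A 1 = 1%:M.
Proof. by rewrite -[1](rmorph1 (tC M)) mevC rmorph1. Qed.

Lemma mevN u : mev A (- u) = - mev A u.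
Proof. by apply/eqP; rewrite -addr_eq0 -mevD addNr mev0. Qed.

Lemma mev_sum (I : Type) (r : seq I) (P : pred I) (x : I -> U) :
  mev A (\sum_(i <- r | P i) x i) = \sum_(i <- r | P i) mev A (x i).
Proof. exact: (big_morph _ mevD mev0). Qed.

Lemma mevM u v : mev A (u * v) = mev A u *m mev A v.
Proof.
(* The square of pairs i, j <= M may be replaced by the triangle i + j <= M, because A^(i+j) = 0 as
   soon as 2(i+j) > n, and n <= M. *)
have trunc (g : nat -> nat -> 'M[E]_m) :
    (forall i j, (M < i + j)%N -> g i j = 0) ->
    \sum_(i < M.+1) \sum_(j < M.+1) g i j =
    \sum_(k < M.+1) \sum_(i < k.+1) g i (k - i)%N.
  move=> g0; transitivity (\sum_(i < M.+1) \sum_(i <= k < M.+1) g i (k - i)%N).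
    apply: eq_bigr => i _.
    have := @big_addn _ 0 +%R 0 M.+1 i xpredT (fun k => g i (k - i)%N); rewrite add0n => ->.
    rewrite -(big_mkord xpredT (g i)) (big_cat_nat (n := M.+1 - i)) ?leq_subr //=.
    rewrite [X in _ + X]big_nat [X in _ + X]big1 ?addr0 => [|j /andP[le_j _]].
      by apply: eq_bigr => j _; rewrite addnK.
    by apply: g0; have := ltn_ord i; lia.
  under eq_bigr do rewrite big_geq_mkord.
  rewrite (exchange_big_dep xpredT) //=; apply: eq_bigr => k _.
  rewrite [RHS](big_ord_widen _ (fun i => g i (k - i)%N) (ltn_ord k)).
  by apply: eq_bigl => i; rewrite ltnS.
rewrite mulmx_suml; under [RHS]eq_bigr do rewrite mulmx_sumr.
rewrite (trunc (fun i j => (eC (tcoef u i) *: A ^+ i) *m (eC (tcoef v j) *: A ^+ j))).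
  apply: eq_bigr => k _; rewrite tcoefM; last by rewrite -ltnS.
  rewrite rmorph_sum scaler_suml; apply: eq_bigr => i _.
  rewrite -scalemxAl -scalemxAr scalerA rmorphM; congr (_ *: _).
  by rewrite -[RHS]/(A ^+ i * A ^+ (k - i)) -exprD subnKC // -ltnS.
move=> i j lt_M; rewrite -scalemxAl -scalemxAr.
rewrite -[A ^+ i *m A ^+ j]/(A ^+ i * A ^+ j) -exprD hom2_nilp ?scaler0 //; lia.
Qed.

Lemma mevX u j : mev A (u ^+ j) = mev A u ^+ j.
Proof.
elim: j => [|j IH]; first by rewrite !expr0 mev1.
by rewrite exprS mevM IH [RHS]exprS.
Qed.

Lemma mev_tX : (0 < M)%N -> mev A (tX C M) = A.
Proof.
move=> M0; rewrite /mev (bigD1 (Ordinal (M0 : 1 < M.+1)%N)) //= big1 ?addr0 => [|j].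
  by rewrite tcoefX // rmorph1 scale1r expr1.
rewrite -val_eqE /= => nj; rewrite tcoefX; last by rewrite -ltnS.
by rewrite (negPf nj) rmorph0 scale0r.
Qed.

(** The variable has degree 2, hence the factor 2 between the degree derivation and X d/dX. *)
Lemma mdeg_mev u : mdeg (mev A u) = 2%:R *: mev A (euler u).
Proof.
rewrite mdeg_sum scaler_sumr; apply: eq_bigr => j _.
rewrite mdegZ mdeg_expr // !scalerA tcoef_euler rmorphM rmorph_nat natrM.
by rewrite mulrC -mulrA.
Qed.

Lemma mev_coef0 u i j : ecoef (mev A u i j) set0 = tcoef u 0 *+ (i == j).
Proof.
rewrite summxE big_ord_recl ecoefD [X in _ + X](_ : _ = 0) ?addr0.
  by rewrite mxE ecoefCM expr0 mxE; case: eqP => _; rewrite ?ecoef1 ?eqxx ?mulr1 ?ecoef_zero ?mulr0.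
rewrite ecoef_sum big1 // => k _; rewrite mxE ecoefCM hom2_expr_coef ?mulr0 //.
by rewrite cards0 lift0; lia.
Qed.

Lemma trace_mev_coef u S :
  ecoef (\tr (mev A u)) S = \sum_(j < M.+1) tcoef u j * ecoef (\tr (A ^+ j)) S.
Proof.
rewrite raddf_sum ecoef_sum; apply: eq_bigr => j _.
by rewrite /= mxtraceZ ecoefCM.
Qed.
End Evaluation.
End FormMatrices.

(** * Exterior powers through traces on the Fock space *)

(* Creation and annihilation operators on the exterior algebra of K^m, as
   matrices in the basis e_T indexed by the subsets T of 'I_m. *)
Section Fock.
Variables (K : comNzRingType) (m : nat).
Local Notation N := #|{set 'I_m}|.
Implicit Types (S T V : {set 'I_m}) (s t u : 'I_m).

Definition fock_mx (k : {set 'I_m} -> {set 'I_m} -> K) : 'M[K]_N :=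
  \matrix_(a, b) k (enum_val a) (enum_val b).

Lemma fock_mxM k l :
  fock_mx k *m fock_mx l = fock_mx (fun S T => \sum_V k S V * l V T).
Proof.
apply/matrixP => a b; rewrite !mxE [RHS](reindex_onto enum_val enum_rank) /=; last first.
  by move=> V _; rewrite enum_rankK.
by apply: eq_big => [i|i _]; rewrite ?enum_valK ?eqxx // !mxE.
Qed.

Lemma fock_mx_ext k l : (forall S T, k S T = l S T) -> fock_mx k = fock_mx l.
Proof. by move=> H; apply/matrixP => a b; rewrite !mxE. Qed.

Definition below T s : nat := #|[set u in T | (u < s)%N]|.

Definition crea_fun s S T : K :=
  if (s \notin T) && (S == s |: T) then (-1) ^+ below T s else 0.

Definition crea s : 'M[K]_N := fock_mx (crea_fun s).
Definition anni s : 'M[K]_N := fock_mx (fun S T => crea_fun s T S).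

Lemma below_setU1 T u s : u \notin T -> below (u |: T) s = (below T s + (u < s))%N.
Proof.
move=> nuT; rewrite /below; case: (ltnP u s) => [lt_us|le_su].
  rewrite (_ : [set v in u |: T | (v < s)%N] = u |: [set v in T | (v < s)%N]).
    by rewrite cardsU1 inE (negPf nuT) add1n addn1.
  apply/setP => v; rewrite !inE andb_orl; case: eqP => [->|] //=.
  by rewrite lt_us.
rewrite addn0; congr #|pred_of_set _|; apply/setP => v; rewrite !inE.
by case: eqP => [->|] //=; rewrite ltnNge le_su andbF.
Qed.

Lemma sum_crea s T (f : {set 'I_m} -> K) :
  \sum_V f V * crea_fun s V T =
  if s \notin T then f (s |: T) * (-1) ^+ below T s else 0.
Proof.
rewrite (bigD1 (s |: T)) //= /crea_fun eqxx andbT big1 ?addr0 => [|V /negPf nV].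
  by case: ifP => //; rewrite mulr0.
by rewrite nV andbF mulr0.
Qed.

Lemma sum_anni s T (f : {set 'I_m} -> K) :
  \sum_V f V * crea_fun s T V =
  if s \in T then f (T :\ s) * (-1) ^+ below (T :\ s) s else 0.
Proof.
have nz V : crea_fun s T V != 0 -> s \in T /\ V = T :\ s.
  rewrite /crea_fun; case: ifP => [/andP[nsV /eqP ->] _|]; last by rewrite eqxx.
  by rewrite setU11 setU1K.
case: ifP => sT.
  rewrite (bigD1 (T :\ s)) //= big1 ?addr0 => [|V neV].
    by rewrite /crea_fun !inE eqxx setD1K // eqxx.
  case: (eqVneq (crea_fun s T V) 0) => [->|/nz [_ eV]]; first by rewrite mulr0.
  by rewrite eV eqxx in neV.
rewrite big1 // => V _.
case: (eqVneq (crea_fun s T V) 0) => [->|/nz [sT' _]]; first by rewrite mulr0.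
by rewrite sT' in sT.
Qed.

Lemma crea_anticomm s u : crea s *m crea u + crea u *m crea s = 0.
Proof.
rewrite /crea !fock_mxM; apply/matrixP => a b; rewrite !mxE !sum_crea.
set S := enum_val a; set T := enum_val b; rewrite /crea_fun !in_setU1.
case: (eqVneq s u) => [->|ne_su]; first by rewrite /= mul0r if_same addr0.
rewrite /= ?(eq_sym u s) ?(negPf ne_su) /=.
case: (boolP (u \in T)) => uT; case: (boolP (s \in T)) => sT //=;
  rewrite ?mul0r ?addr0 //.
rewrite setUCA; case: eqP => _; last by rewrite !mul0r addr0.
rewrite !below_setU1 // !exprD.
move: ((-1) ^+ below T s) ((-1) ^+ below T u) => x y.
have ne : (u : nat) != s by rewrite eq_sym.
by case: ltngtP ne => // _ _; rewrite expr0 expr1; ring.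
Qed.

(** The canonical anticommutation relation; the proof compares the signs of both orders on each
    basis vector. *)
Lemma anni_crea s t :
  anni t *m crea s + crea s *m anni t = ((t == s)%:R)%:M.
Proof.
rewrite /crea /anni !fock_mxM; apply/matrixP => a b; rewrite !mxE.
rewrite (sum_crea s _ (fun V => crea_fun t V _)) (sum_anni t _ (fun V => crea_fun s _ V)).
rewrite -(inj_eq enum_val_inj) -[X in _ *+ X]/(nat_of_bool _).
set S := enum_val a; set T := enum_val b; rewrite /crea_fun.
have sgn2 k : (-1) ^+ k * (-1) ^+ k = 1 :> K by rewrite -expr2 sqrr_sign.
case: (eqVneq t s) => [<-|ne_ts].
  rewrite !inE eqxx /=; case: (boolP (t \in T)) => tT /=.
    rewrite setD1K //; case: eqP => _; last by rewrite mul0r addr0.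
    by rewrite sgn2 add0r.
  rewrite addr0; case: (boolP (t \in S)) => tS /=.
    by rewrite mul0r (_ : S == T = false) //; apply: contraNF tT => /eqP <-.
  have -> : (t |: T == t |: S) = (S == T).
    apply/eqP/eqP => [e|->//].
    by rewrite -(setU1K tS) -e setU1K.
  by case: eqP => [->|_]; rewrite ?sgn2 // mul0r.
rewrite mul0rn !inE (eq_sym s t) (negPf ne_ts) /=.
case: (boolP (t \in T)) => tT; last first.
  rewrite addr0; case: ifP => // nsT; case: ifP => [/andP[_ /eqP e]|_]; last by rewrite mul0r.
  have := setU11 t S; rewrite -e !inE (negPf tT) (negPf ne_ts) //.
case: (boolP (s \in T)) => sT /=; first by rewrite mul0r addr0.
pose V := T :\ t; have TE : T = t |: V by rewrite setD1K.
have tV : t \notin V by rewrite !inE eqxx.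
have sV : s \notin V by rewrite !inE (negPf sT) andbF.
rewrite -/V; clearbody V; case: (eqVneq S (s |: V)) => [->|neS].
  rewrite !inE (negPf ne_ts) (negPf tV) /= {1}TE setUCA eqxx TE !below_setU1 //.
  have ne : (s : nat) != t by rewrite eq_sym.
  rewrite !exprD; move: ((-1) ^+ below V s) ((-1) ^+ below V t) => x y.
  by case: ltngtP ne => // _ _; rewrite expr0 expr1; ring.
rewrite mul0r addr0; case: ifP => [/andP[tS /eqP e]|_]; last by rewrite mul0r.
case/eqP: neS; rewrite -(setU1K tS) -e {1}TE setUCA setU1K //.
by rewrite !inE negb_or ne_ts.
Qed.

(** x to the power of the number operator: it weights the i-th exterior power by x^i. *)
Definition number (x : K) : 'M[K]_N :=
  fock_mx (fun S T => if S == T then x ^+ #|T| else 0).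

Lemma numberM x k :
  number x *m fock_mx k = fock_mx (fun S T => x ^+ #|S| * k S T).
Proof.
rewrite fock_mxM; apply: fock_mx_ext => S T.
by rewrite (bigD1 S) //= eqxx big1 ?addr0 // => V; rewrite eq_sym => /negPf ->; rewrite mul0r.
Qed.

Lemma Mnumber x k :
  fock_mx k *m number x = fock_mx (fun S T => x ^+ #|T| * k S T).
Proof.
rewrite fock_mxM; apply: fock_mx_ext => S T.
by rewrite (bigD1 T) //= eqxx big1 ?addr0 => [|V /negPf ->]; rewrite ?mulr0 // mulrC.
Qed.

Lemma number_crea x s : number x *m crea s = x *: (crea s *m number x).
Proof.
rewrite /crea numberM Mnumber; apply/matrixP => a b; rewrite !mxE /crea_fun.
case: ifP => [/andP[nsT /eqP ->]|_]; last by rewrite !mulr0.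
by rewrite cardsU1 nsT add1n exprS mulrA.
Qed.

Variable A : 'M[K]_m.

(** The second quantization of [A], its extension to the exterior algebra as a derivation. *)
Definition fock_der : 'M[K]_N := \sum_s \sum_t A s t *: (crea s *m anni t).

Lemma fock_der_crea u :
  fock_der *m crea u = crea u *m fock_der + \sum_s A s u *: crea s.
Proof.
have ac t : anni t *m crea u = (t == u)%:R%:M - crea u *m anni t.
  by rewrite -anni_crea addrK.
have cc s : crea s *m crea u = - (crea u *m crea s).
  by apply/eqP; rewrite -addr_eq0 crea_anticomm.
rewrite mulmx_suml mulmx_sumr -big_split; apply: eq_bigr => s _ /=.
have -> : A s u *: crea s = \sum_t A s t *: ((t == u)%:R *: crea s).
  rewrite (bigD1 u) //= eqxx scale1r big1 ?addr0 // => t /negPf ->.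
  by rewrite scale0r scaler0.
rewrite mulmx_suml mulmx_sumr -big_split; apply: eq_bigr => t _ /=.
rewrite -scalemxAl -scalemxAr -scalerDr -mulmxA ac mulmxBr mulmxA cc mulNmx opprK.
by rewrite mul_mx_scalar addrC mulmxA.
Qed.

(** In the basis e_T these are exactly the entries by which the curvature of an exterior power is
    defined. *)
Lemma fock_derE : fock_der = fock_mx (fun S T => \sum_(t in T)
  \sum_(s | (s \notin T :\ t) && (S == s |: (T :\ t)))
    (-1) ^+ (below (T :\ t) t + below (T :\ t) s) * A s t).
Proof.
apply/matrixP => a b; rewrite !mxE summxE.
transitivity (\sum_s \sum_t A s t * \sum_V crea_fun s (enum_val a) V *
    crea_fun t (enum_val b) V).
  by apply: eq_bigr => s _; rewrite summxE; apply: eq_bigr => t _; rewrite mxE fock_mxM mxE.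
rewrite exchange_big [RHS]big_mkcond; apply: eq_bigr => t _ /=.
under eq_bigr do rewrite sum_anni.
case: ifP => tT; last by rewrite big1 // => s _; rewrite mulr0.
rewrite [RHS]big_mkcond; apply: eq_bigr => s _; rewrite /crea_fun.
case: ifP => _; last by rewrite mul0r mulr0.
by rewrite exprD [RHS]mulrC; congr (_ * _); apply: mulrC.
Qed.
End Fock.

Section FockTrace.
Variables (F : numFieldType) (C : comNzRingType) (iota : {rmorphism F -> C}).
Variables (n M : nat).
Hypotheses (le_nM : (n <= M)%N) (M_gt0 : (0 < M)%N).
Local Notation E := (eform C n).
Local Notation ED := (@edeg_derivation C n).
Local Notation edeg := (@edeg C n).
Local Notation eC := (@eC C n).
Local Notation U := (tps C M).
Local Notation natreg := (natreg_alg iota).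

Definition mexp m (A : 'M[E]_m) : 'M[E]_m := mev A (texp iota M 1).

Lemma mdegZw a b (w : E) (A : 'M[E]_(a, b)) :
  mdeg (w *: A) = edeg w *: A + w *: mdeg A.
Proof. by apply/matrixP => i j; rewrite !mxE ED.2. Qed.

Lemma mdeg_mexp m (A : 'M[E]_m) : hom2 A -> mdeg (mexp A) = (2%:R *: A) *m mexp A.
Proof.
move=> A2; rewrite (mdeg_mev A2) euler_texp !rmorph1 mul1r (mevM natreg le_nM A2).
by rewrite mev_tX // scalemxAl.
Qed.

Lemma mexp_coef0 m (A : 'M[E]_m) i j : hom2 A ->
  ecoef (mexp A i j) set0 = (i == j)%:R.
Proof. by move=> A2; rewrite (mev_coef0 natreg) // texp_coef0. Qed.

Lemma mev_comm m (A : 'M[E]_m) (u : U) : A *m mev A u = mev A u *m A.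
Proof.
rewrite /mev mulmx_sumr mulmx_suml; apply: eq_bigr => j _.
rewrite -scalemxAl -scalemxAr; congr (_ *: _).
by rewrite -[LHS]/(A * A ^+ j) -exprS exprSr.
Qed.

Lemma mev_intertwine a b (A : 'M[E]_a) (B : 'M[E]_b) (J : 'M[E]_(a, b)) (u : U) :
  A *m J = J *m B -> mev A u *m J = J *m mev B u.
Proof.
move=> AJ; have AJX j : A ^+ j *m J = J *m B ^+ j.
  elim: j => [|j IH]; first by rewrite mul1mx mulmx1.
  by rewrite exprS -mulmxA IH mulmxA AJ -mulmxA exprS.
rewrite /mev mulmx_suml mulmx_sumr; apply: eq_bigr => j _.
by rewrite -scalemxAl -scalemxAr AJX.
Qed.

Variables (m : nat) (A : 'M[E]_m).
Hypothesis A2 : hom2 A.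
Local Notation L := (fock_der A).
Local Notation crea := (@crea E m).
Local Notation anni := (@anni E m).
Local Notation N := #|{set 'I_m}|.

Lemma edeg_crea_fun s S T : edeg (@crea_fun E m s S T) = 0.
Proof. by rewrite /crea_fun; case: ifP => _; rewrite ?(der_sign ED) ?(der0 ED). Qed.

Lemma mdeg_crea s : mdeg (crea s) = 0.
Proof. by apply/matrixP => i j; rewrite !mxE edeg_crea_fun. Qed.

Lemma mdeg_anni s : mdeg (anni s) = 0.
Proof. by apply/matrixP => i j; rewrite !mxE edeg_crea_fun. Qed.

Lemma hom2_fock_der : hom2 L.
Proof.
rewrite /hom2 mdeg_sum scaler_sumr; apply: eq_bigr => s _.
rewrite mdeg_sum scaler_sumr; apply: eq_bigr => t _.
rewrite mdegZw mdegM mdeg_crea mdeg_anni mul0mx mulmx0 addr0 scaler0 addr0.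
by have /matrixP/(_ s t) := A2; rewrite !mxE => ->; rewrite scalerA.
Qed.

(** The group version of [fock_der_crea]. The difference of the two sides satisfies a linear
    equation in the degree derivation and has no constant term, so it vanishes by [mdeg_uniq]. *)
Lemma fock_exp_crea u :
  mexp L *m crea u = \sum_s mexp A s u *: (crea s *m mexp L).
Proof.
have L2 := hom2_fock_der; apply/eqP; rewrite -subr_eq0; apply/eqP.
apply: (mdeg_uniq natreg (L := 2%:R *: L)).
- move=> i j; rewrite mxE -(rmorph_nat eC) ecoefCM.
  by rewrite (hom2_coef0 natreg _ _ L2) mulr0.
- move=> i j.
  have coef0 (Z : 'M[E]_N) : ecoef (Z i j) set0 = map_mx (@ecst0 C n) Z i j.
    by rewrite mxE.
  rewrite coef0.
  have exp0 : map_mx (@ecst0 C n) (mexp L) = 1%:M.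
    by apply/matrixP => k l; rewrite !mxE -[LHS]/(ecoef _ _) mexp_coef0.
  rewrite map_mxB map_mxM exp0 mul1mx raddf_sum (bigD1 u) //= big1 ?addr0 => [|s ne_su].
    rewrite map_mxZ map_mxM exp0 mulmx1 /= -[ecst0 _]/(ecoef _ _) mexp_coef0 // eqxx.
    by rewrite scale1r subrr mxE.
  rewrite map_mxZ /= -[ecst0 _]/(ecoef _ _) mexp_coef0 // (negPf ne_su).
  by rewrite scale0r.
rewrite mdegB mdegM mdeg_crea mulmx0 addr0 mdeg_mexp // mulmxBr mulmxA.
congr (_ - _); rewrite mdeg_sum.
transitivity (\sum_s (2%:R * (A *m mexp A) s u) *: (crea s *m mexp L) +
   \sum_s (2%:R * mexp A s u) *: (crea s *m L *m mexp L)).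
  rewrite -big_split; apply: eq_bigr => s _ /=.
  rewrite mdegZw mdegM mdeg_crea mul0mx add0r mdeg_mexp //; congr (_ + _).
    by have /matrixP/(_ s u) := mdeg_mexp A2; rewrite [X in X = _]mxE => ->;
      rewrite -scalemxAl mxE.
  by rewrite -scalemxAl -scalemxAr scalerA mulrC mulmxA.
transitivity (\sum_s (2%:R * mexp A s u) *: (L *m crea s *m mexp L)); last first.
  rewrite mulmx_sumr; apply: eq_bigr => s _.
  by rewrite -scalemxAr -scalemxAl scalerA mulrC mulmxA.
under [RHS]eq_bigr do rewrite fock_der_crea mulmxDl scalerDr.
rewrite big_split /= addrC; congr (_ + _).
under [RHS]eq_bigr do rewrite mulmx_suml scaler_sumr.
rewrite exchange_big; apply: eq_bigr => s _; rewrite mxE mulr_sumr scaler_suml.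
apply: eq_bigr => v _; rewrite -scalemxAl scalerA; congr (_ *: _).
by rewrite -mulrA [mexp A v u * _]mulrC.
Qed.

Definition fock_trace (t : C) : E := \tr (number m (eC t) *m mexp L).

(** Morally the trace is det(1 + t e^A), with logarithmic derivative 2 tr(A t e^A / (1 + t e^A)).
    This is obtained without eigenvalues: moving a creation operator past the density matrix,
    cycling the trace and anticommuting determines the two-point function [G] by G (1 + X) = tr(rho)
    X, with X = t e^A. *)
Lemma log_der_fock_trace (t : C) k : t ^+ k = 0 ->
  log_der edeg (2%:R * \tr (mev A (tlog k t (texp iota M 1)))) (fock_trace t).
Proof.
move=> tk; have L2 := hom2_fock_der.
set w := texp iota M 1; pose P := number m (eC t); pose rho := P *m mexp L.
pose X := eC t *: mexp A.
pose Xi := mev A (\sum_(j < k) (- (tC M t * w)) ^+ j).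
have XE : X = mev A (tC M t * w) by rewrite (mevM natreg le_nM A2) mevC mul_scalar_mx.
have XK : (1%:M + X) *m Xi = 1%:M.
  by rewrite XE -(mev1 M A) -mevD -(mevM natreg le_nM A2) tlogK // mev1.
have tlogE : mev A (tlog k t w) = A *m (X *m Xi).
  by rewrite /tlog 2!(mevM natreg le_nM A2) -XE mev_tX // mulmxA.
pose G : 'M[E]_m := \matrix_(j, i) \tr (rho *m crea i *m anni j).
have rho_crea u : rho *m crea u = \sum_s X s u *: (crea s *m rho).
  rewrite /rho -mulmxA fock_exp_crea mulmx_sumr; apply: eq_bigr => s _.
  rewrite -scalemxAr mulmxA number_crea -scalemxAl scalerA mxE -mulmxA.
  by rewrite mulrC.
have GE : G *m (1%:M + X) = fock_trace t *: X.
  have GX j u : G j u = \sum_s X s u * ((j == s)%:R * fock_trace t - G j s).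
    rewrite mxE rho_crea mulmx_suml raddf_sum /=; apply: eq_bigr => s _.
    rewrite -scalemxAl mxtraceZ; congr (_ * _).
    rewrite -mulmxA mxtrace_mulC -mulmxA.
    have -> : anni j *m crea s = (j == s)%:R%:M - crea s *m anni j.
      by rewrite -anni_crea addrK.
    by rewrite mulmxBr linearB /= mul_mx_scalar mxtraceZ mulmxA [G _ _]mxE.
  rewrite mulmxDr mulmx1; apply/matrixP => j u.
  rewrite [LHS]mxE GX [(G *m X) j u]mxE -big_split [RHS]mxE (bigD1 j) //= eqxx.
  rewrite big1 => [|s]; last by rewrite eq_sym => /negPf ->; rewrite mul0r; ring.
  by rewrite mul1r; ring.
have GX : G = fock_trace t *: (X *m Xi).
  by rewrite scalemxAl -GE -mulmxA XK mulmx1.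
rewrite /log_der edeg_trace mdegM.
have -> : mdeg P = 0.
  apply/matrixP => i j; rewrite !mxE; case: ifP => _; last exact: (der0 ED).
  by rewrite -rmorphXn edegC.
rewrite mul0mx add0r mdeg_mexp // -scalemxAl mev_comm -scalemxAr mxtraceZ mulmxA.
rewrite -/rho tlogE -mulrA; congr (_ * _).
transitivity (\tr (A *m G)); last by rewrite GX -scalemxAr mxtraceZ mulrC.
rewrite mulmx_sumr raddf_sum; apply: eq_bigr => s _ /=.
rewrite mulmx_sumr raddf_sum mxE; apply: eq_bigr => u _ /=.
by rewrite -scalemxAr mxtraceZ mulmxA [G _ _]mxE.
Qed.

(** At zero curvature the trace counts the subsets T with weight t^|T|. *)
Lemma fock_trace_coef0 (t : C) : ecoef (fock_trace t) set0 = (1 + t) ^+ m.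
Proof.
have L2 := hom2_fock_der; rewrite /fock_trace /mxtrace ecoef_sum.
transitivity (\sum_(T : {set 'I_m}) t ^+ #|T|).
  rewrite [RHS](reindex_onto enum_val enum_rank) /=; last first.
    by move=> T _; rewrite enum_rankK.
  apply: eq_big => [i|i _]; first by rewrite enum_valK eqxx.
  rewrite mxE ecoef_sum (bigD1 i) //= mxE eqxx ecoefM0 mexp_coef0 // eqxx mulr1.
  rewrite -rmorphXn ecoefC eqxx big1 ?addr0 // => j ne_ji.
  by rewrite mxE (inj_eq enum_val_inj) eq_sym (negPf ne_ji) mul0r ecoef_zero.
rewrite exprDn (partition_big (fun T : {set 'I_m} => inord #|T| : 'I_m.+1) predT) //=.
apply: eq_bigr => i _; rewrite expr1n mul1r.
have card_le (T : {set 'I_m}) : (#|T| < m.+1)%N.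
  by rewrite ltnS -[X in (_ <= X)%N]card_ord max_card.
rewrite (eq_bigr (fun=> t ^+ i)) => [|T /eqP <-]; last by rewrite inordK.
rewrite sumr_const -[X in 'C(X, _)](card_ord m) -card_draws; congr (_ *+ _).
by apply: eq_card => T; rewrite !inE unfold_in -[in RHS](inordK (card_le T)) val_eqE.
Qed.

Definition ext_power_mx (i : nat) : 'M[E]_#|ext_index m i| :=
  \matrix_(a, b)
    let S : {set 'I_m} := enum_val a in
    let T : {set 'I_m} := enum_val b in
    \sum_(t in T)
      \sum_(s | (s \notin T :\ t) && (S == s |: (T :\ t)))
         (-1) ^+ (below (T :\ t) t + below (T :\ t) s) * A s t.

Lemma hom2_ext_power i : hom2 (ext_power_mx i).
Proof.
apply/matrixP => a b; rewrite !mxE /= (der_sum ED) mulr_sumr; apply: eq_bigr => t _.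
rewrite (der_sum ED) mulr_sumr; apply: eq_bigr => s _.
rewrite (der_cst ED) ?(der_sign ED) //.
by have /matrixP/(_ s t) := A2; rewrite !mxE => ->; rewrite mulrCA.
Qed.

(** The Fock space is the direct sum of the exterior powers. The inclusions [J i] intertwine the two
    curvature actions, hence also their exponentials, and the projections onto the summands add up
    to the weight operator. *)
Lemma fock_trace_ext_power (t : C) :
  fock_trace t = \sum_(i < m.+1) eC t ^+ i * \tr (mexp (ext_power_mx i)).
Proof.
pose J i : 'M[E]_(#|ext_index m i|, N) :=
  \matrix_(a, b) (enum_val a == enum_val b)%:R.
have JJ i : J i *m (J i)^T = 1%:M.
  apply/matrixP => a b; rewrite !mxE (bigD1 (enum_rank (enum_val a))) //=.
  rewrite !mxE enum_rankK eqxx mul1r big1 ?addr0 => [|c nc].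
    by rewrite (inj_eq enum_val_inj) eq_sym.
  by rewrite !mxE -(inj_eq enum_rank_inj) enum_valK eq_sym (negPf nc) mul0r.
have LJ i : ext_power_mx i *m J i = J i *m L.
  apply/matrixP => a b; rewrite fock_derE mxE [RHS]mxE.
  rewrite [RHS](bigD1 (enum_rank (enum_val a))) //= !mxE enum_rankK eqxx mul1r.
  rewrite [X in _ = _ + X]big1 ?addr0 => [|c nc]; last first.
    by rewrite !mxE -(inj_eq enum_rank_inj) enum_valK eq_sym (negPf nc) mul0r.
  have Ja : #|enum_val a : {set 'I_m}| = i by have := enum_valP a; rewrite inE => /eqP.
  case: (eqVneq #|enum_val b : {set 'I_m}| i) => [cb|ncb].
    have bi : enum_val b \in ext_index m i by rewrite inE cb.
    rewrite (bigD1 (enum_rank_in bi (enum_val b))) //= !mxE enum_rankK_in // eqxx mulr1.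
    rewrite big1 ?addr0 // => c nc; rewrite !mxE (_ : (_ == _) = false) ?mulr0 //.
    apply: contraNF nc => /eqP e; apply/eqP/enum_val_inj.
    by rewrite enum_rankK_in.
  rewrite big1 => [|c _]; last first.
    rewrite !mxE (_ : (_ == _) = false) ?mulr0 //; apply: contraNF ncb => /eqP <-.
    by have := enum_valP c; rewrite inE.
  symmetry; rewrite big1 // => s sb; rewrite big1 // => u /andP[nu /eqP eS].
  case/eqP: ncb; rewrite -Ja eS cardsU1 nu.
  by rewrite [in LHS](cardsD1 s) sb.
have trJ i : \tr (mexp (ext_power_mx i)) = \tr ((J i)^T *m J i *m mexp L).
  rewrite -[mexp (ext_power_mx i)]mulmx1 -(JJ i) mulmxA (mev_intertwine _ (LJ i)).
  by rewrite mxtrace_mulC mulmxA.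
under eq_bigr do rewrite trJ -mxtraceZ scalemxAl.
rewrite -raddf_sum -mulmx_suml /=; congr (\tr (_ *m _)).
apply/matrixP => a b; rewrite summxE mxE.
have Jab i : ((J i)^T *m J i) a b =
    if (enum_val a == enum_val b) && (#|enum_val b : {set 'I_m}| == i) then 1 else 0.
  rewrite mxE; case: (eqVneq #|enum_val b : {set 'I_m}| i) => [cb|ncb].
    have bi : enum_val b \in ext_index m i by rewrite inE cb.
    rewrite (bigD1 (enum_rank_in bi (enum_val b))) //= !mxE enum_rankK_in // eqxx mulr1.
    rewrite big1 ?addr0 => [|c nc]; last first.
      rewrite !mxE [X in _ * X](_ : _ = 0) ?mulr0 // (_ : (_ == _) = false) //.
      apply: contraNF nc => /eqP e; apply/eqP/enum_val_inj.
    by rewrite enum_rankK_in.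
    by rewrite eq_sym andbT; case: eqP.
  rewrite andbF big1 // => c _; rewrite !mxE [X in _ * X](_ : _ = 0) ?mulr0 //.
  rewrite (_ : (_ == _) = false) //; apply: contraNF ncb => /eqP <-.
  by have := enum_valP c; rewrite inE.
have lt_b : (#|enum_val b : {set 'I_m}| < m.+1)%N.
  by rewrite ltnS -[X in (_ <= X)%N]card_ord max_card.
rewrite (bigD1 (Ordinal lt_b)) //= mxE Jab eqxx andbT big1 ?addr0 => [|i ni].
  by case: ifP => _; rewrite ?mulr1 ?mulr0.
rewrite mxE Jab (_ : (_ == i :> nat) = false) ?andbF ?mulr0 //.
by apply: contraNF ni => /eqP e; apply/eqP/val_inj.
Qed.
End FockTrace.

(** * Ahat and Lhat as even forms with known logarithmic derivatives *)

Section LowCoefficients.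
Variables (C : comNzRingType) (M : nat).

Lemma tcoefX_low (u : tps C M) k j : tcoef u 0 = 0 -> (j < k)%N -> tcoef (u ^+ k) j = 0.
Proof.
move=> u0; elim: k j => // k IH j; rewrite ltnS => le_jk.
case: (leqP j M) => [le_jM|lt_Mj]; last by rewrite tcoef_gt.
rewrite exprS tcoefM // big_ord_recl u0 mul0r add0r big1 // => i _.
by rewrite IH ?mulr0 // lift0; have := ltn_ord i; lia.
Qed.
End LowCoefficients.

Section Forget.
Variables (C : comNzRingType) (n : nat).

Definition eforget (w : eform C n) : extalg C n := eform_val w.

Lemma eforget_is_zmod_morphism : zmod_morphism eforget.
Proof. exact: (raddfB (\val : eform C n -> extalg C n)). Qed.
Lemma eforget_is_monoid_morphism : monoid_morphism eforget.
Proof.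
by split; [exact: (rmorph1 (\val : eform C n -> extalg C n)) |
           exact: (rmorphM (\val : eform C n -> extalg C n))].
Qed.
HB.instance Definition _ := GRing.isZmodMorphism.Build (eform C n) (extalg C n)
  eforget eforget_is_zmod_morphism.
HB.instance Definition _ := GRing.isMonoidMorphism.Build (eform C n) (extalg C n)
  eforget eforget_is_monoid_morphism.
End Forget.

Arguments eforget : simpl never.

Section DetHalf.
Variables (F : numClosedFieldType) (n : nat).
Local Notation E := (eform F n).
Local Notation ED := (@edeg_derivation F n).
Local Notation edeg := (@edeg F n).
Local Notation eC := (@eC F n).
Local Notation natreg := (natreg_alg (idfun : {rmorphism F -> F})).
Local Notation "\valmx A" := (map_mx (@eforget F n) A) (at level 10).

Lemma val_eC (c : F) (w : E) : eforget (eC c * w) = c *: eforget w.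
Proof. by rewrite rmorphM /= -scalerAl mul1r. Qed.

Lemma val_eC1 (c : F) : eforget (eC c) = c *: 1.
Proof. by []. Qed.

Lemma scale_formmx_val a (c : F) (A : 'M[E]_a) :
  scale_formmx c (\valmx A) = \valmx (eC c *: A).
Proof. by apply/matrixP => i j; rewrite !mxE val_eC. Qed.

(** [sqrt_form] transported to even forms. *)
Definition esqrt (w : E) : E :=
  eC (sqrtC (ecoef w set0)) * \sum_(j < n.+1)
    eC (binom_half F j) * (eC (ecoef w set0)^-1 * w - 1) ^+ j.

Lemma val_esqrt w : eforget (esqrt w) = sqrt_form (eforget w).
Proof.
rewrite /esqrt val_eC /sqrt_form; congr (_ *: _); rewrite raddf_sum.
apply: eq_bigr => j _; rewrite -[LHS]/(eforget _) val_eC; congr (_ *: _).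
rewrite rmorphXn; congr (_ ^+ j); rewrite rmorphB rmorph1; congr (_ - _).
exact: val_eC.
Qed.

Lemma binom_halfS j : j.+1%:R * binom_half F j.+1 = (2^-1 - j%:R) * binom_half F j.
Proof.
rewrite /binom_half big_ord_recr /= factS natrM; set P := \prod_(i < j) _.
have j0 : j.+1%:R != 0 :> F by rewrite pnatr_eq0.
have f0 : j`!%:R != 0 :> F by rewrite pnatr_eq0 -lt0n fact_gt0.
rewrite mulrC [j.+1%:R * _]mulrC invfM -!mulrA mulVf // mulr1.
by rewrite mulrCA.
Qed.

(** The square root halves the logarithmic derivative. With nu the nilpotent part, the recursion for
    binomial coefficients of 1/2 makes the derivative of the binomial series telescope. *)
Lemma log_der_esqrt (l w : E) : ecoef w set0 != 0 ->
  log_der edeg (2%:R * l) w -> log_der edeg l (esqrt w).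
Proof.
move=> w0 Dw; rewrite /log_der /esqrt (der_cst ED) ?edegC // mulrCA; congr (_ * _).
set nu := eC _ * w - 1.
have nuE : eC (ecoef w set0)^-1 * w = 1 + nu by rewrite /nu addrCA subrr addr0.
have nu0 : ecoef nu set0 = 0 by rewrite ecoefD ecoefN ecoefCM ecoef1 eqxx mulVf ?subrr.
have nuN : nu ^+ n.+1 = 0 by exact: eform_nilp.
have Dnu : edeg nu = 2%:R * l * (1 + nu).
  by rewrite (derB ED) (der1 ED) subr0 (der_cst ED) ?edegC // Dw mulrCA nuE.
(* This removes the boundary term of the telescoping sum; it comes from differentiating nu^(n+1) =
   0. *)
have lnu : l * nu ^+ n = 0.
  apply: (eform_natreg natreg (m := (2 * n).+1)).
  have := der_exp ED nu n; rewrite nuN (der0 ED) Dnu => e.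
  transitivity (n.+1%:R * nu ^+ n * (2%:R * l * (1 + nu)) -
    n.+1%:R * 2%:R * l * (nu ^+ n.+1)).
    rewrite exprSr (_ : (2 * n).+2 = (n.+1 * 2)%N) ?natrM; last by lia.
    by ring.
  by rewrite -e nuN mulr0 subrr.
rewrite (der_sum ED) mulr_sumr.
pose b j := eC (binom_half F j).
have bS j : 2%:R * (j.+1%:R * b j.+1) = b j - 2%:R * j%:R * b j.
  rewrite /b -!(rmorph_nat eC) -!rmorphM binom_halfS -rmorphB; congr (eC _).
  by field.
transitivity (\sum_(j < n.+1) b j * (j%:R * nu ^+ j.-1 * (2%:R * l * (1 + nu)))).
  apply: eq_bigr => -[[|j] lt_jn] _ /=.
    by rewrite expr0 mulr1 edegC !mul0r mulr0.
  by rewrite (der_cst ED) ?edegC // (der_exp ED) Dnu.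
rewrite big_ord_recl /= mul0r mul0r mulr0 add0r.
pose T j := l * (2%:R * j%:R * b j * nu ^+ j).
transitivity (\sum_(j < n) (l * (b j * nu ^+ j) + (T j.+1 - T j))).
  apply: eq_bigr => j _; rewrite /bump /= add1n.
  transitivity (l * (2%:R * (j.+1%:R * b j.+1)) * nu ^+ j + T j.+1).
    by rewrite /T exprS; ring.
  by rewrite bS /T; ring.
rewrite big_split /= -(big_mkord xpredT (fun j => T j.+1 - T j)) telescope_sumr //.
rewrite [RHS]big_ord_recr /=; congr (_ + _).
rewrite /T [RHS]mulrCA lnu [X in X - _]mulrCA lnu.
by rewrite !mulr0 !mul0r !mulr0 subrr.
Qed.
End DetHalf.

Section CharacteristicForms.
Variables (F : numClosedFieldType) (n M : nat).
Hypotheses (le_nM : (n <= M)%N) (M_gt0 : (0 < M)%N).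
Local Notation E := (eform F n).
Local Notation ED := (@edeg_derivation F n).
Local Notation edeg := (@edeg F n).
Local Notation eC := (@eC F n).
Local Notation iota := (idfun : {rmorphism F -> F}).
Local Notation natreg := (natreg_alg iota).
Local Notation U := (tps F M).
Local Notation "\valmx A" := (map_mx (@eforget F n) A) (at level 10).
Local Notation mexp := (mexp iota M).

Lemma val_scale (c : F) (w : E) : c *: eforget w = eforget (eC c * w).
Proof. by rewrite val_eC. Qed.

Lemma sum_mev_trunc m (A : 'M[E]_m) (g : nat -> 'M[E]_m) k :
  (forall j, (n < j)%N -> g j = 0) -> (n < k)%N ->
  \sum_(j < k) g j = \sum_(j < n.+1) g j.
Proof.
move=> g0 lt_nk; rewrite -!(big_mkord xpredT g) (big_cat_nat (n := n.+1)) //=.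
rewrite [X in _ + X]big_nat [X in _ + X]big1 ?addr0 // => j /andP[lt_nj _].
exact: g0.
Qed.

Lemma mev_trunc m (A : 'M[E]_m) (f : nat -> F) : hom2 A ->
  mev A (mktps M f) = \sum_(j < n.+1) eC (f j) *: A ^+ j.
Proof.
move=> A2; have e : mev A (mktps M f) = \sum_(j < M.+1) eC (f j) *: A ^+ j.
  by apply: eq_bigr => j _; rewrite tcoef_mk // -ltnS.
rewrite e (sum_mev_trunc A (g := fun j => eC (f j) *: A ^+ j)) // => j lt_nj.
by rewrite (hom2_nilp natreg A2) ?scaler0 //; lia.
Qed.

Lemma mev_trunc_even m (A : 'M[E]_m) (f : nat -> F) : hom2 A ->
  mev A (mktps M (fun j => if odd j then 0 else f j)) =
  \sum_(j < n.+1) eC (f (2 * j)%N) *: A ^+ (2 * j).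
Proof.
move=> A2; rewrite mev_trunc //.
pose g j := eC (if odd j then 0 else f j) *: A ^+ j.
rewrite -(sum_mev_trunc A (g := g) (k := (2 * n.+1)%N)); last by lia.
  elim: n.+1 => [|k IH]; first by rewrite muln0 !big_ord0.
  rewrite mulnS add2n 2!big_ord_recr /= IH [RHS]big_ord_recr /= /g /= mul2n odd_double.
  by rewrite /= rmorph0 scale0r addr0.
move=> j lt_nj; rewrite /g (hom2_nilp natreg A2) ?scaler0 //; lia.
Qed.

Lemma hom2Z m (A : 'M[E]_m) c : hom2 A -> hom2 (eC c *: A).
Proof. by move=> A2; rewrite /hom2 mdegZ A2 !scalerA mulrC. Qed.

Lemma exprZmx m (c : E) (A : 'M[E]_m) j : (c *: A) ^+ j = c ^+ j *: A ^+ j.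
Proof.
elim: j => [|j IH]; first by rewrite !expr0 scale1r.
by rewrite !exprS IH -[LHS]/((c *: A) *m (c ^+ j *: A ^+ j)) -scalemxAl -scalemxAr scalerA.
Qed.

Lemma val_expr m (A : 'M[E]_m) j : (\valmx A) ^+ j = \valmx (A ^+ j).
Proof.
elim: j => [|j IH]; first by rewrite !expr0 map_mx1.
by rewrite !exprS IH -[LHS]/((\valmx A) *m (\valmx (A ^+ j))) -map_mxM.
Qed.

Lemma val_exp_formmx m (B : 'M[E]_m) : hom2 B ->
  exp_formmx (\valmx B) = \valmx (mexp B).
Proof.
move=> B2; rewrite /mexp mev_trunc // raddf_sum; apply: eq_bigr => j _.
by rewrite val_expr scale_formmx_val expr1n div1r.
Qed.

Lemma trace_exp_val m (c : F) (B : 'M[E]_m) : hom2 B ->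
  \tr (exp_formmx (scale_formmx c (\valmx B))) = eforget (\tr (mexp (eC c *: B))).
Proof.
move=> B2; rewrite scale_formmx_val (val_exp_formmx (hom2Z _ B2)).
exact: trace_map_mx.
Qed.

(** 1 - u(A) has nilpotency order at most n+1, so the truncated geometric series is the inverse, and
    so is v(A). *)
Lemma geom_inv_mev m (A : 'M[E]_m) (u v : U) : hom2 A -> tcoef u 0 = 1 ->
  u * v = 1 -> geom_inv n.+1 (mev A u) = mev A v.
Proof.
move=> A2 u0 uv.
have uvA : mev A v *m mev A u = 1%:M by rewrite -(mevM natreg) // mulrC uv mev1.
have : mev A u * geom_inv n.+1 (mev A u) = 1.
  have := one_sub_nil_inv (x := 1 - mev A u) (N := n.+1).
  rewrite opprB addrCA subrr addr0; apply.
  have -> : 1 - mev A u = mev A (1 - u) by rewrite mevD mevN mev1.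
  rewrite -(mevX natreg) //; apply: big1 => j _.
  case: (leqP j n) => [le_jn|lt_nj]; last by rewrite (hom2_nilp natreg A2) ?scaler0 //; lia.
  by rewrite tcoefX_low ?rmorph0 ?scale0r // tcoefD tcoefN tcoef1 u0 subrr.
by move=> e; rewrite -[LHS]mul1r -[1](uvA) -[_ * _]mulrA e mulr1.
Qed.

Lemma val_geom_inv m (X : 'M[E]_m) N :
  geom_inv N (\valmx X) = \valmx (geom_inv N X).
Proof.
rewrite /geom_inv raddf_sum; apply: eq_bigr => j _ /=.
by rewrite -val_expr map_mxB map_mx1.
Qed.

Lemma val_sinhc m (B : 'M[E]_m) : hom2 B ->
  sinhc_formmx (\valmx (eC 2^-1 *: B)) = \valmx (mev B (tsinhc iota M)).
Proof.
move=> B2; rewrite /tsinhc mev_trunc_even // raddf_sum; apply: eq_bigr => j _.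
rewrite val_expr scale_formmx_val exprZmx scalerA -rmorphXn -rmorphM.
by rewrite [X in eC X]mulrC.
Qed.

Lemma val_cosh m (B : 'M[E]_m) : hom2 B ->
  cosh_formmx (\valmx (eC 2^-1 *: B)) = \valmx (mev B (tcosh iota M)).
Proof.
move=> B2; rewrite /tcosh mev_trunc_even // raddf_sum; apply: eq_bigr => j _.
rewrite val_expr scale_formmx_val exprZmx scalerA -rmorphXn -rmorphM.
by rewrite [X in eC X]mulrC.
Qed.

Variables (c : F) (Om : 'M[E]_n).
Hypothesis Om2 : hom2 Om.
Local Notation A := (eC c *: Om).

Lemma half_scale : scale_formmx (2^-1 * c) (\valmx Om) = \valmx (eC 2^-1 *: A).
Proof. by rewrite scale_formmx_val rmorphM -scalerA. Qed.



Lemma det_mev_log (u v G : U) : u * v = 1 -> log_der (@euler F M) G u ->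
  log_der edeg (2%:R * \tr (mev A G)) (\det (mev A u)).
Proof.
move=> uv Du; have A2 : hom2 A by exact: hom2Z.
have uvA : mev A u *m mev A v = 1%:M by rewrite -(mevM natreg) // uv mev1.
have := log_der_det ED uvA; congr (log_der _ _ _).
rewrite -[map_mx _ _]/(mdeg (mev A u)) mdeg_mev // Du -scalemxAr mxtraceZ.
have vGu : v * (G * u) = G by rewrite mulrCA [v * u]mulrC uv mulr1.
by rewrite -(mevM natreg) // vGu.
Qed.

Lemma det_mev_coef0 (u : U) : ecoef (\det (mev A u)) set0 = tcoef u 0 ^+ n.
Proof.
have A2 : hom2 A by exact: hom2Z.
have -> : ecoef (\det (mev A u)) set0 = \det (map_mx (@ecst0 F n) (mev A u)).
  by rewrite det_map_mx.
have -> : map_mx (@ecst0 F n) (mev A u) = (tcoef u 0)%:M.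
  by apply/matrixP => i j; rewrite !mxE -[LHS]/(ecoef _ _) (mev_coef0 natreg).
exact: det_scalar.
Qed.

(** The factor 2 of [det_mev_log] and the square root cancel: if [u] has logarithmic derivative [G],
    then det^(1/2) u(A) has logarithmic derivative tr G(A). *)
Lemma det_half_val (u v G : U) : u * v = 1 -> log_der (@euler F M) G u ->
  tcoef u 0 != 0 -> exists a : E,
  [/\ eforget a = det_half (\valmx (mev A u)), log_der edeg (\tr (mev A G)) a &
      ecoef a set0 = sqrtC (tcoef u 0 ^+ n)].
Proof.
move=> uv Du u0; exists (esqrt (\det (mev A u))); split.
- by rewrite val_esqrt /det_half det_map_mx.
- by apply: log_der_esqrt (det_mev_log uv Du); rewrite det_mev_coef0 expf_neq0.
rewrite /esqrt ecoefCM det_mev_coef0 ecoef_sum big_ord_recl.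
rewrite ecoefCM expr0 ecoef1 eqxx /binom_half big_ord0 fact0 divr1 mul1r.
rewrite big1 ?addr0 ?mulr1 // => j _; rewrite ecoefCM exprS ecoefM0.
by rewrite ecoefD ecoefN ecoefCM ecoef1 eqxx det_mev_coef0 mulVf ?expf_neq0 // subrr mul0r mulr0.
Qed.

Lemma Ahat_val : exists a : E, [/\ eforget a =
    det_half (x_over_sinh (scale_formmx (2^-1 * c) (\valmx Om))),
  log_der edeg (\tr (mev A (ahat_log iota M))) a & ecoef a set0 = 1].
Proof.
have A2 : hom2 A by exact: hom2Z.
have sK : tsinhc iota M * tinv (tsinhc iota M) = 1 := tinvK (tsinhc_coef0 iota M).
have Ls := log_derV (@euler_derivation F M) sK (log_der_sinhc iota M).
rewrite opprK in Ls.
have i0 : tcoef (tinv (tsinhc iota M)) 0 = 1.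
  have := congr1 (fun u => tcoef u 0) sK.
  by rewrite tcoefM0 tsinhc_coef0 mul1r tcoef1.
have [|a [va La a0]] := det_half_val (etrans (mulrC _ _) sK) Ls.
  by rewrite i0 oner_neq0.
exists a; split; [|exact: La|by rewrite a0 i0 expr1n sqrtC1].
rewrite va /x_over_sinh half_scale (val_sinhc A2) val_geom_inv.
by rewrite (geom_inv_mev A2 (tsinhc_coef0 iota M) sK).
Qed.

(** The scalar 2 inside the determinant does not affect the logarithmic derivative; it only shows in
    the constant term 2^(n/2). *)
Lemma Lhat_val : exists a : E, [/\ eforget a =
    det_half (scale_formmx 2 (x_over_tanh (scale_formmx (2^-1 * c) (\valmx Om)))),
  log_der edeg (\tr (mev A (lhat_log iota M))) a & ecoef a set0 = sqrtC (2 ^+ n)].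
Proof.
set t2 := (X in scale_formmx X (x_over_tanh _)); have t2E : t2 = 2%:R by [].
clearbody t2.
have A2 : hom2 A by exact: hom2Z.
have sK : tsinhc iota M * tinv (tsinhc iota M) = 1 := tinvK (tsinhc_coef0 iota M).
have cK : tcosh iota M * tinv (tcosh iota M) = 1 := tinvK (tcosh_coef0 iota M).
have i0 : tcoef (tinv (tsinhc iota M)) 0 = 1.
  have := congr1 (fun u => tcoef u 0) sK.
  by rewrite tcoefM0 tsinhc_coef0 mul1r tcoef1.
pose u := tC M t2 * (tcosh iota M * tinv (tsinhc iota M)).
pose v := tC M t2^-1 * (tinv (tcosh iota M) * tsinhc iota M).
have uv : u * v = 1.
  transitivity (tC M (t2 * t2^-1) * (tcosh iota M * tinv (tcosh iota M)) *
    (tsinhc iota M * tinv (tsinhc iota M))); first by rewrite rmorphM /u /v; ring.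
  by rewrite sK cK divff ?t2E ?pnatr_eq0 // rmorph1 !mulr1.
have EU := @euler_derivation F M.
have Lu : log_der (@euler F M) (lhat_log iota M) u.
  have Lt := log_derV EU (y := tcosh iota M * tinv (tsinhc iota M)) _ (log_der_tanhc iota M).
  rewrite opprK in Lt; rewrite /log_der /u (der_cst EU) ?eulerC // Lt; last first.
    by rewrite [tsinhc iota M * _]mulrC mulrACA sK mulr1 mulrC cK.
  by rewrite mulrCA.
have u0 : tcoef u 0 = t2.
  by rewrite tcoefCM tcoefM0 tcosh_coef0 i0 !mulr1.
have muE : mev A u = eC t2 *: (mev A (tcosh iota M) *m mev A (tinv (tsinhc iota M))).
  rewrite /u (mevM natreg le_nM A2) mevC mul_scalar_mx.
  by rewrite (mevM natreg le_nM A2).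
have [|a [va La a0]] := det_half_val uv Lu.
  by rewrite u0 t2E pnatr_eq0.
exists a; split; [|exact: La|by rewrite a0 u0 t2E].
rewrite va /x_over_tanh half_scale (val_cosh A2) (val_sinhc A2) val_geom_inv.
rewrite (geom_inv_mev A2 (tsinhc_coef0 iota M) sK) -[_ * _]/(_ *m _) -map_mxM.
rewrite muE scale_formmx_val; reflexivity.
Qed.
End CharacteristicForms.

(** * Multiplicativity of the Chern character and virtual bundles *)

Lemma tens11 (K : comNzRingType) a b :
  tensmx (1%:M : 'M[K]_a) (1%:M : 'M[K]_b) = 1%:M.
Proof.
apply/matrixP => i j; rewrite !mxE -[i in RHS]mxtens_unindexK -[j in RHS]mxtens_unindexK.
rewrite (inj_eq (can_inj (@mxtens_indexK a b))) xpair_eqE.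
by case: (_ == _); case: (_ == _); rewrite ?mul1r ?mul0r.
Qed.

Section TensorExp.
Variables (F : numFieldType) (C : comNzRingType) (iota : {rmorphism F -> C}).
Variables (n M : nat).
Hypotheses (le_nM : (n <= M)%N) (M_gt0 : (0 < M)%N).
Local Notation E := (eform C n).
Local Notation ED := (@edeg_derivation C n).
Local Notation natreg := (natreg_alg iota).
Local Notation mexp := (mexp iota M).

Lemma mdeg_tens a b (X : 'M[E]_a) (Y : 'M[E]_b) :
  mdeg (tensmx X Y) = tensmx (mdeg X) Y + tensmx X (mdeg Y).
Proof. by apply/matrixP => i j; rewrite !mxE ED.2. Qed.

Lemma tensDl a b (X X' : 'M[E]_a) (Y : 'M[E]_b) :
  tensmx (X + X') Y = tensmx X Y + tensmx X' Y.
Proof. by apply/matrixP => i j; rewrite !mxE mulrDl. Qed.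

Lemma tensZl a b k (X : 'M[E]_a) (Y : 'M[E]_b) : tensmx (k *: X) Y = k *: tensmx X Y.
Proof. by apply/matrixP => i j; rewrite !mxE mulrA. Qed.

Lemma tensZr a b k (X : 'M[E]_a) (Y : 'M[E]_b) : tensmx X (k *: Y) = k *: tensmx X Y.
Proof. by apply/matrixP => i j; rewrite !mxE mulrCA. Qed.

Lemma trace_tens a b (X : 'M[E]_a) (Y : 'M[E]_b) :
  \tr (tensmx X Y) = \tr X * \tr Y.
Proof. by rewrite mulr_sum; apply: eq_bigr => i _; rewrite mxE. Qed.

Definition tens_der a b (X : 'M[E]_a) (Y : 'M[E]_b) : 'M[E]_(a * b) :=
  tensmx X 1%:M + tensmx 1%:M Y.

Lemma hom2_tens_der a b (X : 'M[E]_a) (Y : 'M[E]_b) :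
  hom2 X -> hom2 Y -> hom2 (tens_der X Y).
Proof.
move=> X2 Y2; rewrite /hom2 /tens_der mdegD !mdeg_tens !mdeg1 X2 Y2.
by rewrite tensmx0 tens0mx addr0 add0r tensZl tensZr scalerDr.
Qed.

(** The exponential of X (x) 1 + 1 (x) Y is the tensor product of the exponentials: both solve the
    same linear equation and are the identity in degree 0. *)
Lemma mexp_tens_der a b (X : 'M[E]_a) (Y : 'M[E]_b) : hom2 X -> hom2 Y ->
  mexp (tens_der X Y) = tensmx (mexp X) (mexp Y).
Proof.
move=> X2 Y2; have T2 := hom2_tens_der X2 Y2.
apply/eqP; rewrite -subr_eq0; apply/eqP.
have exp0 m (Z : 'M[E]_m) : hom2 Z -> map_mx (@ecst0 C n) (mexp Z) = 1%:M.
  by move=> Z2; apply/matrixP => k l; rewrite !mxE -[LHS]/(ecoef _ _) (mexp_coef0 iota).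
apply: (mdeg_uniq natreg (L := 2%:R *: tens_der X Y)).
- move=> i j; rewrite mxE -(rmorph_nat (@eC C n)) ecoefCM.
  by rewrite (hom2_coef0 natreg _ _ T2) mulr0.
- move=> i j.
  have coef0 (Z : 'M[E]_(a * b)) : ecoef (Z i j) set0 = map_mx (@ecst0 C n) Z i j.
    by rewrite mxE.
  rewrite coef0 map_mxB exp0 // map_mxT !exp0 //.
  by rewrite tens11 subrr mxE.
rewrite mdegB mulmxBr (mdeg_mexp iota) //; congr (_ - _).
rewrite mdeg_tens !(mdeg_mexp iota) // -!scalemxAl tensZl tensZr -scalerDr.
by congr (_ *: _); rewrite /tens_der mulmxDl !tensmx_mul !mul1mx.
Qed.

Lemma trace_mexp_tens_der a b (X : 'M[E]_a) (Y : 'M[E]_b) (k : C) :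
  hom2 X -> hom2 Y -> \tr (mexp (eC n k *: tens_der X Y)) =
  \tr (mexp (eC n k *: X)) * \tr (mexp (eC n k *: Y)).
Proof.
move=> X2 Y2; rewrite -trace_tens -mexp_tens_der; last 2 first.
- by rewrite /hom2 mdegZ X2 !scalerA mulrC.
- by rewrite /hom2 mdegZ Y2 !scalerA mulrC.
by rewrite /tens_der tensZl tensZr scalerDr.
Qed.

Lemma ext_power_mxZ m (A : 'M[E]_m) k i :
  ext_power_mx (k *: A) i = k *: ext_power_mx A i.
Proof.
apply/matrixP => a b; rewrite !mxE /= mulr_sumr; apply: eq_bigr => t _.
by rewrite mulr_sumr; apply: eq_bigr => s _; rewrite mxE mulrCA.
Qed.
End TensorExp.

Section BundleLifts.
Variables (R : realType) (n M : nat).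
Hypotheses (le_nM : (n <= M)%N) (M_gt0 : (0 < M)%N).
Local Notation E := (eform R[i] n).
Local Notation iota := (idfun : {rmorphism R[i] -> R[i]}).
Local Notation mexp := (mexp iota M).
Local Notation eC := (@eC R[i] n).
Local Notation "\formmx A" := (map_mx (@eforget R[i] n) A) (at level 10).

Definition chern_cst : R[i] := imag_over (2 * pi).

(** Records that the curvature of a bundle comes from a matrix of even 2-forms and that its Chern
    character is [x]. The property is stable under the operations from which virtual bundles are
    formed. *)
Definition bundle_lift (b : bundle R n) (x : E) : Prop :=
  exists B : 'M[E]_(rank b),
    [/\ curv b = \formmx B, hom2 B & \tr (mexp (eC chern_cst *: B)) = x].

Lemma bundle_lift_trivial : bundle_lift (trivial_line R n) 1.
Proof.
exists 0; split; first by apply/matrixP => i j; rewrite !mxE rmorph0.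
  by rewrite /hom2 mdeg0 scaler0.
rewrite scaler0 /mexp /mev big_ord_recl big1 => [|j _].
  by rewrite texp_coef0 rmorph1 scale1r expr0 addr0 mxtrace1.
by rewrite exprS mul0r scaler0.
Qed.

Lemma bundle_lift_tensor b b' x x' :
  bundle_lift b x -> bundle_lift b' x' -> bundle_lift (tensor b b') (x * x').
Proof.
move=> [B [cB B2 <-]] [B' [cB' B'2 <-]].
exists (tens_der B B'); split; last exact: trace_mexp_tens_der.
  rewrite /= cB cB' /tens_der map_mxD !map_mxT.
  by rewrite !map_mx1.
exact: hom2_tens_der.
Qed.

Lemma bundle_lift_ext_power (Om : 'M[E]_n) i : hom2 Om ->
  bundle_lift (ext_power i (Bundle (\formmx Om)))
    (\tr (mexp (ext_power_mx (eC chern_cst *: Om) i))).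
Proof.
move=> Om2; exists (ext_power_mx Om i); split.
- apply/matrixP => a b; rewrite !mxE raddf_sum; apply: eq_bigr => t _ /=.
  rewrite raddf_sum; apply: eq_bigr => s _ /=.
  by rewrite -[RHS]/(eforget _) rmorphM rmorph_sign mxE.
- exact: hom2_ext_power.
by rewrite ext_power_mxZ.
Qed.

Lemma ch_lift b x : bundle_lift b x -> ch (curv b) = eforget x.
Proof.
move=> [B [-> B2 <-]].
exact: (@trace_exp_val (R[i] : numClosedFieldType) n M le_nM M_gt0 _ chern_cst B B2).
Qed.

Lemma monomial_bundle_lift (Om : 'M[E]_n) (m : multinom n) : hom2 Om ->
  bundle_lift (monomial_bundle (Bundle (\formmx Om)) m)
    (mmap1 (fun i : 'I_n => \tr (mexp (ext_power_mx (eC chern_cst *: Om) i.+1))) m).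
Proof.
move=> Om2; rewrite /monomial_bundle /mmap1 -big_enum /=.
elim: (enum 'I_n) => [|i r IH] /=.
  by rewrite big_nil; apply: bundle_lift_trivial.
rewrite big_cons foldr_cat; elim: (m i) => [|k IHk] /=; first by rewrite expr0 mul1r.
by rewrite exprS -mulrA; apply: bundle_lift_tensor => //; apply: bundle_lift_ext_power.
Qed.

(** As [virtual n] is a polynomial ring on the exterior powers, fixing the Chern characters of these
    determines a ring morphism; [ch_virtual_lift] identifies it with the Chern character of the
    definitions. *)
Definition chern_character (Om : 'M[E]_n) : virtual n -> E :=
  mmap (intr : int -> E)
    (fun i : 'I_n => \tr (mexp (ext_power_mx (eC chern_cst *: Om) i.+1))).

HB.instance Definition _ (Om : 'M[E]_n) := GRing.RMorphism.copy (chern_character Om)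
  (mmap (intr : int -> E)
    (fun i : 'I_n => \tr (mexp (ext_power_mx (eC chern_cst *: Om) i.+1)))).

Lemma ch_virtual_lift (Om : 'M[E]_n) (x : virtual n) : hom2 Om ->
  ch_virtual (Bundle (\formmx Om)) x = eforget (chern_character Om x).
Proof.
move=> Om2; rewrite /ch_virtual /chern_character /mmap raddf_sum.
apply: eq_bigr => m _; rewrite (ch_lift (monomial_bundle_lift m Om2)).
rewrite -[RHS]/(eforget (_ * _)) [RHS]rmorphM /= [in RHS]rmorph_int.
by rewrite scaler_int -mulrzl.
Qed.
End BundleLifts.

(** * Change of coefficients, and the reflection x -> -x *)

Section CoefficientChange.
Variables (C C' : comNzRingType) (f : {rmorphism C -> C'}).

Section SeriesChange.
Variable M : nat.

Definition tmap (u : tps C M) : tps C' M := mktps M (fun j => f (tcoef u j)).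

Lemma tcoef_map u j : tcoef (tmap u) j = f (tcoef u j).
Proof.
case: (leqP j M) => [le_jM|lt_Mj]; first by rewrite tcoef_mk.
by rewrite !tcoef_gt // rmorph0.
Qed.

Lemma tmap_is_zmod_morphism : zmod_morphism tmap.
Proof.
move=> u v; apply: tps_ext => j _.
by rewrite !(tcoef_map, tcoefD, tcoefN) rmorphB.
Qed.

Lemma tmap_is_monoid_morphism : monoid_morphism tmap.
Proof.
split=> [|u v]; apply: tps_ext => j le_jM.
  by rewrite tcoef_map !tcoef1 rmorph_nat.
rewrite tcoef_map !tcoefM // rmorph_sum; apply: eq_bigr => i _.
by rewrite rmorphM !tcoef_map.
Qed.

HB.instance Definition _ :=
  GRing.isZmodMorphism.Build (tps C M) (tps C' M) tmap tmap_is_zmod_morphism.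
HB.instance Definition _ :=
  GRing.isMonoidMorphism.Build (tps C M) (tps C' M) tmap tmap_is_monoid_morphism.

Lemma tmap_mk (a : nat -> C) : tmap (mktps M a) = mktps M (fun j => f (a j)).
Proof. by apply: tps_ext => j le_jM; rewrite tcoef_map !tcoef_mk. Qed.

Lemma tmap_euler u : tmap (euler u) = euler (tmap u).
Proof.
by apply: tps_ext => j _; rewrite !(tcoef_map, tcoef_euler) rmorphM rmorph_nat.
Qed.

Lemma tmap_tinv u : tmap (tinv u) = tinv (tmap u).
Proof. by rewrite rmorph_sum; apply: eq_bigr => j _; rewrite rmorphXn rmorphB rmorph1. Qed.
End SeriesChange.

Section FormChange.
Variable n : nat.

Fact emap_subproof (w : eform C n) :
  ([ffun S : {set 'I_n} => f (ecoef w S)] : extalg C' n) \in @even_form C' n.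
Proof. by apply/even_formP => S oS; rewrite ffunE ecoef_odd // rmorph0. Qed.

Definition emap (w : eform C n) : eform C' n := EForm (emap_subproof w).

Lemma ecoef_map w S : ecoef (emap w) S = f (ecoef w S).
Proof. by rewrite /ecoef /= ffunE. Qed.

Lemma emap_is_zmod_morphism : zmod_morphism emap.
Proof.
move=> u v; apply: eform_ext => S.
by rewrite !(ecoef_map, ecoefD, ecoefN) rmorphB.
Qed.

Lemma emap_is_monoid_morphism : monoid_morphism emap.
Proof.
split=> [|u v]; apply: eform_ext => S.
  by rewrite ecoef_map !ecoef1 rmorph_nat.
rewrite ecoef_map !ecoefM rmorph_sum; apply: eq_bigr => A _.
by rewrite !rmorphM rmorph_sign !ecoef_map.
Qed.

HB.instance Definition _ :=
  GRing.isZmodMorphism.Build (eform C n) (eform C' n) emap emap_is_zmod_morphism.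
HB.instance Definition _ :=
  GRing.isMonoidMorphism.Build (eform C n) (eform C' n) emap emap_is_monoid_morphism.

Lemma emapC c : emap (eC n c) = eC n (f c).
Proof.
apply: eform_ext => S; rewrite ecoef_map !ecoefC.
by case: eqP; rewrite ?rmorph0.
Qed.

Lemma emap_deg w : emap (edeg w) = edeg (emap w).
Proof.
by apply: eform_ext => S; rewrite !(ecoef_map, ecoef_deg) rmorphM rmorph_nat.
Qed.

Lemma emap_hom2 a b (A : 'M[eform C n]_(a, b)) : hom2 A -> hom2 (map_mx emap A).
Proof.
move=> /matrixP A2; apply/matrixP => i j; have := A2 i j; rewrite !mxE.
by rewrite -emap_deg => ->; rewrite rmorphM rmorph_nat.
Qed.

Lemma map_mxX m (A : 'M[eform C n]_m) j : map_mx emap (A ^+ j) = map_mx emap A ^+ j.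
Proof.
elim: j => [|j IH]; first by rewrite !expr0 map_mx1.
by rewrite !exprS -IH -[LHS]/(map_mx emap (A *m A ^+ j)) map_mxM.
Qed.

Lemma emap_mev M m (A : 'M[eform C n]_m) (u : tps C M) :
  map_mx emap (mev A u) = mev (map_mx emap A) (tmap u).
Proof.
rewrite /mev raddf_sum; apply: eq_bigr => j _ /=.
by rewrite map_mxZ map_mxX tcoef_map /= emapC.
Qed.

Lemma emap_trace_mev M m (A : 'M[eform C n]_m) (u : tps C M) :
  emap (\tr (mev A u)) = \tr (mev (map_mx emap A) (tmap u)).
Proof. by rewrite -emap_mev trace_map_mx. Qed.

Lemma emap_log_der l x : log_der (@edeg C n) l x ->
  log_der (@edeg C' n) (emap l) (emap x).
Proof. by rewrite /log_der -emap_deg => ->; rewrite rmorphM. Qed.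

Lemma emap_ext_power m (A : 'M[eform C n]_m) i :
  map_mx emap (ext_power_mx A i) = ext_power_mx (map_mx emap A) i.
Proof.
apply/matrixP => a b; rewrite !mxE raddf_sum; apply: eq_bigr => t _.
rewrite raddf_sum; apply: eq_bigr => s _.
by rewrite -[LHS]/(emap (_ * _)) [LHS]rmorphM rmorph_sign mxE.
Qed.
End FormChange.
End CoefficientChange.

Section Reflection.
Variables (C : comNzRingType) (M : nat).
Local Notation U := (tps C M).

Definition trefl (u : U) : U := mktps M (fun j => (-1) ^+ j * tcoef u j).

Lemma tcoef_refl u j : tcoef (trefl u) j = (-1) ^+ j * tcoef u j.
Proof.
case: (leqP j M) => [le_jM|lt_Mj]; first by rewrite tcoef_mk.
by rewrite !tcoef_gt // mulr0.
Qed.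

Lemma trefl_is_zmod_morphism : zmod_morphism trefl.
Proof.
move=> u v; apply: tps_ext => j _.
by rewrite !(tcoef_refl, tcoefD, tcoefN) mulrBr.
Qed.

Lemma trefl_is_monoid_morphism : monoid_morphism trefl.
Proof.
split=> [|u v]; apply: tps_ext => j le_jM.
  by rewrite tcoef_refl !tcoef1; case: j {le_jM} => [|j]; rewrite ?mul1r ?mulr0.
rewrite tcoef_refl !tcoefM // mulr_sumr; apply: eq_bigr => i _.
rewrite !tcoef_refl mulrACA -exprD subnKC //.
by rewrite -ltnS.
Qed.

HB.instance Definition _ := GRing.isZmodMorphism.Build U U trefl trefl_is_zmod_morphism.
HB.instance Definition _ :=
  GRing.isMonoidMorphism.Build U U trefl trefl_is_monoid_morphism.

Lemma treflC c : trefl (tC M c) = tC M c.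
Proof.
apply: tps_ext => -[|j] _; rewrite tcoef_refl tcoefC ?mul1r //=.
by rewrite mulr0.
Qed.

Lemma trefl_tX : trefl (tX C M) = - tX C M.
Proof.
apply: tps_ext => j le_jM; rewrite tcoef_refl tcoefN tcoefX //.
by case: eqP => [->|_]; rewrite ?mulr0 ?oppr0 // mulr1 expr1.
Qed.

Lemma trefl_texp (F : numFieldType) (iota : {rmorphism F -> C}) c :
  trefl (texp iota M c) = texp iota M (- c).
Proof.
apply: tps_ext => j le_jM; rewrite tcoef_refl !tcoef_mk // [in RHS]exprNn.
by rewrite -mulrA [RHS]rmorphM (rmorphXn iota j (-1)) rmorphN1.
Qed.

Lemma trefl_tlog (F : numFieldType) (iota : {rmorphism F -> C}) N t :
  trefl (tlog N t (texp iota M 1)) = - tlog N t (texp iota M (- 1)).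
Proof.
rewrite /tlog !rmorphM /= rmorph_sum /= trefl_tX treflC trefl_texp !mulNr.
congr (- (_ * _)); apply: eq_bigr => j _.
by rewrite rmorphXn /= rmorphN rmorphM /= treflC trefl_texp.
Qed.

(** Only even powers of [A] have a trace, so u(x) and u(-x) give the same one. This expresses that
    the roots of [A] come in pairs of opposite sign. *)
Lemma trace_mev_refl n m (A : 'M[eform C n]_m) (u : U) :
  (forall j, odd j -> \tr (A ^+ j) = 0) -> \tr (mev A (trefl u)) = \tr (mev A u).
Proof.
move=> Aodd; rewrite /mev !raddf_sum; apply: eq_bigr => j _ /=.
rewrite !mxtraceZ tcoef_refl; case oj: (odd j); first by rewrite Aodd // !mulr0.
by rewrite -signr_odd oj mul1r.
Qed.
End Reflection.

(** * Transfer of the weighted relation from series to forms *)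

Section FormRelation.
Variables (F : numFieldType) (C1 C2 : comNzRingType) (n : nat).
Variables (iota1 : {rmorphism F -> C1}) (iota2 : {rmorphism F -> C2}).
Variables (d1 e1 : C1) (d2 e2 : C2).
Local Notation hrel := (hrel iota1 iota2 d1 e1 d2 e2).

Definition frel (x1 : eform C1 n) (x2 : eform C2 n) : Prop :=
  forall S : {set 'I_n}, hrel #|S| (ecoef x1 S) (ecoef x2 S).

(** The traces of powers of [A] are scalars in [F] and are shared by both sides. In degree 2j only
    the coefficient of index j of the series occurs, and its weight 2j is the degree of the form. *)
Lemma trace_rel (M m : nat) (A : 'M[eform F n]_m) (G1 : tps C1 M) (G2 : tps C2 M) :
  hom2 A -> (n <= 2 * (M - 2))%N -> srel iota1 iota2 d1 e1 d2 e2 (M - 2) G1 G2 ->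
  frel (\tr (mev (map_mx (@emap _ _ iota1 n) A) G1))
       (\tr (mev (map_mx (@emap _ _ iota2 n) A) G2)).
Proof.
move=> A2 le_nM HG S; rewrite !trace_mev_coef; apply: hrel_sum => j _.
have trE (C : comNzRingType) (iota : {rmorphism F -> C}) :
    ecoef (\tr (map_mx (@emap _ _ iota n) A ^+ j)) S = iota (ecoef (\tr (A ^+ j)) S).
  by rewrite -map_mxX trace_map_mx ecoef_map.
rewrite !trE; case: (eqVneq #|S| (2 * j)%N) => [cS|ncS]; last first.
  have -> : ecoef (\tr (A ^+ j)) S = 0.
    rewrite /mxtrace ecoef_sum big1 // => i _.
    by rewrite (hom2_expr_coef (natreg_alg (idfun : {rmorphism F -> F}))).
  by rewrite !rmorph0 !mulr0; apply: hrel0.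
rewrite cS ![_ * _ (ecoef _ _)]mulrC; apply/hrelZ/HG.
by have := max_card (mem S); rewrite card_ord => le_Sn; move: (leq_trans le_Sn le_nM); rewrite cS; lia.
Qed.

(** The equation edeg P = T P determines the components of P by recursion on the degree, and the
    recursion respects weights. *)
Lemma log_der_frel (T1 P1 : eform C1 n) (T2 P2 : eform C2 n) :
  frel T1 T2 -> ecoef P1 set0 = 1 -> ecoef P2 set0 = 1 ->
  log_der (@edeg C1 n) T1 P1 -> log_der (@edeg C2 n) T2 P2 -> frel P1 P2.
Proof.
move=> HT P10 P20 D1 D2 S.
have [m] := ubnP #|S|; elim: m S => // m IH S; rewrite ltnS => le_Sm.
have [->|nS] := eqVneq S set0; first by rewrite P10 P20 cards0; apply: hrel1.
have S0 : #|S|%:R != 0 :> F by rewrite pnatr_eq0 cards_eq0.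
have eqn (C : comNzRingType) (iota : {rmorphism F -> C}) (T P : eform C n) :
    ecoef P set0 = 1 -> log_der (@edeg C n) T P ->
    ecoef P S = iota #|S|%:R^-1 * \sum_(A in powerset S | A != set0)
      (-1) ^+ inversions A (S :\: A) * (ecoef T A * ecoef P (S :\: A)).
  move=> P0 D; have T0 : ecoef T set0 = 0.
    by rewrite -[LHS]mulr1 -P0 -ecoefM0 -D ecoef_deg cards0 mul0r.
  transitivity (iota #|S|%:R^-1 * ecoef (edeg P) S).
    by rewrite ecoef_deg mulrA -(rmorph_nat iota) -rmorphM mulVf // rmorph1 mul1r.
  congr (_ * _); rewrite D ecoefM (bigD1 set0) ?inE ?sub0set //=.
  by rewrite T0 mul0r mulr0 add0r.
rewrite (eqn _ iota1 _ _ P10 D1) (eqn _ iota2 _ _ P20 D2); apply: hrelZ.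
apply: hrel_sum => A; rewrite inE => /andP[sAS nA].
have sgn c x1 x2 : hrel #|S| x1 x2 -> hrel #|S| ((-1) ^+ c * x1) ((-1) ^+ c * x2).
  by move/(hrelZ ((-1) ^+ c)); rewrite !rmorph_sign.
apply: sgn; rewrite (card_split sAS); apply: hrelM; first exact: HT.
apply: IH; apply: leq_trans le_Sm; rewrite (card_split sAS).
by rewrite -[X in (X < _)%N]add0n ltn_add2r card_gt0.
Qed.
End FormRelation.

(** * The logarithmic derivative of ch(Theta_2) *)

Lemma geom_inv_stable (K : pzRingType) (a N : nat) (x : K) :
  (1 - x) ^+ a = 0 -> (a <= N)%N -> geom_inv N x = geom_inv a x.
Proof.
move=> xa le_aN; rewrite /geom_inv -!(big_mkord xpredT (fun j => (1 - x) ^+ j)).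
rewrite (big_cat_nat (n := a)) //= [X in _ + X]big_nat [X in _ + X]big1 ?addr0 //.
by move=> j /andP[le_aj _]; apply: expr_nil xa le_aj.
Qed.

Lemma geom_invK (K : pzRingType) (N : nat) (x : K) :
  (1 - x) ^+ N = 0 -> x * geom_inv N x = 1.
Proof. by move/one_sub_nil_inv; rewrite opprB addrCA subrr addr0. Qed.

Lemma rmorph_geom_inv (K K' : pzRingType) (f : {rmorphism K -> K'}) (N : nat) (x : K) :
  f (geom_inv N x) = geom_inv N (f x).
Proof.
by rewrite rmorph_sum; apply: eq_bigr => j _; rewrite rmorphXn rmorphB rmorph1.
Qed.

Lemma geom_inv_sub1 (K : comPzRingType) (N : nat) (s y : K) :
  exists z, geom_inv N.+1 (1 + s * y) = 1 + s * z.
Proof.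
exists (- y * geom_inv N (1 + s * y)).
rewrite /geom_inv big_ord_recl expr0; congr (1 + _).
rewrite !mulr_sumr; apply: eq_bigr => j _; rewrite lift0 exprS.
by rewrite opprD addrA subrr sub0r; ring.
Qed.

Section ThetaEvaluation.
Variables (n : nat) (K : comNzRingType) (ev : {rmorphism {poly virtual n} -> K}).

Definition lambda_eval (N : nat) (s : K) : K :=
  (\sum_(i < n.+1) ev (Lambda n i)%:P * s ^+ i) * geom_inv N ((1 + s) ^+ n).

Definition sym_eval (N : nat) (s : K) : K := geom_inv N (lambda_eval N (- s)).

Lemma rmorph_Lambda_tilde N t : ev (Lambda_tilde N t) = lambda_eval N (ev t).
Proof.
rewrite /Lambda_tilde rmorphM rmorph_geom_inv rmorphXn rmorphD rmorph1.
by congr (_ * _); rewrite rmorph_sum; apply: eq_bigr => i _; rewrite rmorphM rmorphXn.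
Qed.

Lemma rmorph_S_tilde N t : ev (S_tilde N t) = sym_eval N (ev t).
Proof. by rewrite rmorph_geom_inv rmorph_Lambda_tilde rmorphN. Qed.

Lemma rmorph_Theta2 N : ev (Theta2 n N) =
  \prod_(1 <= m < N.+1) sym_eval N (ev 'X ^+ (2 * m)) *
  \prod_(1 <= m < N.+1) lambda_eval N (- ev 'X ^+ (2 * m - 1)).
Proof.
rewrite rmorphM !rmorph_prod; congr (_ * _); apply: eq_bigr => m _.
  by rewrite rmorph_S_tilde rmorphXn.
by rewrite rmorph_Lambda_tilde rmorphN rmorphXn.
Qed.

Lemma binom_sub1 (s : K) : exists y, (1 + s) ^+ n = 1 + s * y.
Proof.
exists (\sum_(i < n) (1 + s) ^+ i); rewrite -[LHS](subrK 1) subrX1 addrC.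
by rewrite [1 + s]addrC addrK.
Qed.

Lemma one_sub_binom_nilp (s : K) a : s ^+ a = 0 -> (1 - (1 + s) ^+ n) ^+ a = 0.
Proof.
move=> sa; have [y ->] := binom_sub1 s.
by rewrite opprD addrA subrr sub0r -mulrN exprMn sa mul0r.
Qed.

Lemma lambda_eval_sub1 N (s : K) : exists y, lambda_eval N.+1 s = 1 + s * y.
Proof.
have [y Hy] := binom_sub1 s; have [z Hz] := geom_inv_sub1 N s y.
rewrite /lambda_eval Hy Hz big_ord_recl polyC1 rmorph1 mulr1.
pose u := \sum_(i < n) ev (Lambda n i.+1)%:P * s ^+ i.
exists (z + u * (1 + s * z)).
have -> : \sum_(i < n) ev (Lambda n i.+1)%:P * s ^+ i.+1 = s * u.
  by rewrite mulr_sumr; apply: eq_bigr => i _; rewrite exprS mulrCA.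
by ring.
Qed.

Lemma one_sub_lambda_nilp N (s : K) a :
  s ^+ a = 0 -> (1 - lambda_eval N.+1 s) ^+ a = 0.
Proof.
move=> sa; have [y ->] := lambda_eval_sub1 N s.
by rewrite opprD addrA subrr sub0r -mulrN exprMn sa mul0r.
Qed.

Lemma lambda_eval0 N : lambda_eval N.+1 0 = 1.
Proof. by have [y ->] := lambda_eval_sub1 N 0; rewrite mul0r addr0. Qed.

Lemma sym_evalK N (s : K) : s ^+ N.+1 = 0 ->
  lambda_eval N.+1 (- s) * sym_eval N.+1 s = 1.
Proof.
by move=> sN; apply/geom_invK/one_sub_lambda_nilp; rewrite exprNn sN mulr0.
Qed.

Lemma lambda_eval_stable a N (s : K) : s ^+ a = 0 -> (a <= N)%N ->
  lambda_eval N s = lambda_eval a s.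
Proof.
by move=> sa le_aN; congr (_ * _); apply: geom_inv_stable (one_sub_binom_nilp sa) le_aN.
Qed.

Lemma sym_eval_stable a N (s : K) : s ^+ a.+1 = 0 -> (a < N)%N ->
  sym_eval N s = sym_eval a.+1 s.
Proof.
move=> sa lt_aN; have sNa : (- s) ^+ a.+1 = 0 by rewrite exprNn sa mulr0.
rewrite /sym_eval (lambda_eval_stable sNa lt_aN).
by apply: geom_inv_stable lt_aN; apply: one_sub_lambda_nilp.
Qed.

(** Once the variable is sent to an element with vanishing (j+1)-st power, the factors beyond j+1
    become 1 and longer geometric series add nothing. *)
Lemma Theta2_stable j N : ev 'X ^+ j.+1 = 0 -> (j < N)%N ->
  ev (Theta2 n N) = ev (Theta2 n j.+1).
Proof.
move=> Xj lt_jN; rewrite !rmorph_Theta2.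
have pow_nil b : (0 < b)%N -> (ev 'X ^+ b) ^+ j.+1 = 0.
  by move=> b0; rewrite -exprM (expr_nil Xj) // leq_pmull.
have split_prod (f : nat -> nat -> K) :
    (forall m, (0 < m)%N -> f N m = f j.+1 m) ->
    (forall m, (j.+1 < m)%N -> f j.+1 m = 1) ->
    \prod_(1 <= m < N.+1) f N m = \prod_(1 <= m < j.+2) f j.+1 m.
  move=> fN f1; rewrite (big_cat_nat (n := j.+2)) //= [X in _ * X]big_nat.
  rewrite [X in _ * X]big1 ?mulr1 => [|m /andP[lt_jm _]]; last first.
    by rewrite fN ?f1 // (leq_trans _ lt_jm).
  by rewrite big_nat [RHS]big_nat; apply: eq_bigr => m /andP[m0 _]; apply: fN.
congr (_ * _).
  apply: (split_prod (fun N m => sym_eval N (ev 'X ^+ (2 * m)))) => [m m0|m lt_jm].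
    by apply: sym_eval_stable => //; apply: pow_nil; lia.
  rewrite (_ : ev 'X ^+ (2 * m) = 0); last by apply: expr_nil Xj _; lia.
  have := sym_evalK (N := j) (s := 0); rewrite oppr0 lambda_eval0 mul1r; apply.
  by rewrite expr0n.
apply: (split_prod (fun N m => lambda_eval N (- ev 'X ^+ (2 * m - 1)))) => [m m0|m lt_jm].
  by apply: lambda_eval_stable => //; rewrite exprNn pow_nil ?mulr0 //; lia.
rewrite (_ : ev 'X ^+ (2 * m - 1) = 0) ?oppr0 ?lambda_eval0 //.
by apply: expr_nil Xj _; lia.
Qed.
End ThetaEvaluation.

Section Coefficients.
Variables (C : comNzRingType) (M : nat).

Lemma tcoef_tXn i b : (i <= M)%N -> tcoef (tX C M ^+ b) i = (i == b)%:R.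
Proof.
elim: b i => [|b IH] i le_iM; first by rewrite expr0 tcoef1.
rewrite exprS; case: i le_iM => [|i] le_iM; first by rewrite tcoefXM0.
by rewrite tcoefXMS // IH ?(ltnW le_iM).
Qed.

Lemma tcoef_sum (I : Type) (r : seq I) (P : pred I) (x : I -> tps C M) j :
  tcoef (\sum_(i <- r | P i) x i) j = \sum_(i <- r | P i) tcoef (x i) j.
Proof.
exact: (big_morph (fun u : tps C M => tcoef u j) (fun a b => tcoefD a b j) (tcoef0 _ _ j)).
Qed.

Lemma tcoef_horner (P : {poly C}) j : (j <= M)%N ->
  tcoef (map_poly (tC M) P).[tX C M] j = P`_j.
Proof.
move=> le_jM; rewrite (horner_coef_wide _ (size_poly _ _)) tcoef_sum.
under eq_bigr => i _ do rewrite coef_map tcoefCM tcoef_tXn //.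
case: (ltnP j (size P)) => [lt_jP|le_Pj].
  rewrite (bigD1 (Ordinal lt_jP)) //= eqxx mulr1 big1 ?addr0 // => i ni.
  by rewrite (negPf (_ : j != i)) ?mulr0 // eq_sym.
rewrite nth_default // big1 // => i _.
by rewrite gtn_eqF ?mulr0 // (leq_trans _ le_Pj).
Qed.
End Coefficients.

Section ThetaClass.
Variables (F : numFieldType) (C : comNzRingType) (iota : {rmorphism F -> C}).
Variables (n M : nat).
Hypotheses (le_nM : (n <= M)%N) (M_gt0 : (0 < M)%N).
Local Notation eC := (@eC C n).
Local Notation edeg := (@edeg C n).
Local Notation ED := (@edeg_derivation C n).
Local Notation w := (texp iota M 1).
Variable A : 'M[eform C n]_n.
Hypotheses (A2 : hom2 A) (Aodd : forall j, odd j -> \tr (A ^+ j) = 0).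
Variable ev : {rmorphism {poly virtual n} -> eform C n}.
Hypothesis ev_Lambda : forall i, (i <= n)%N ->
  ev (Lambda n i)%:P = \tr (mexp iota M (ext_power_mx A i)).

Lemma lambda_eval_fock (N : nat) (s : C) : s ^+ N.+1 = 0 ->
  lambda_eval ev N.+1 (eC s) = fock_trace iota M A s * eC (geom_inv N.+1 ((1 + s) ^+ n)).
Proof.
move=> sN; rewrite fock_trace_ext_power /lambda_eval.
congr (_ * _); last by rewrite rmorph_geom_inv rmorphXn rmorphD rmorph1.
by apply: eq_bigr => i _; rewrite mulrC ev_Lambda // -ltnS.
Qed.

Lemma log_der_lambda_eval (N : nat) (s : C) : s ^+ N.+1 = 0 ->
  log_der edeg (2%:R * \tr (mev A (tlog N.+1 s w))) (lambda_eval ev N.+1 (eC s)).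
Proof.
move=> sN; rewrite lambda_eval_fock // -[X in log_der _ X]addr0.
apply: (log_derM ED (log_der_fock_trace iota le_nM M_gt0 A2 sN)).
by apply: log_der_cst; rewrite edegC.
Qed.

Lemma lambda_eval_coef0 (N : nat) (s : C) : s ^+ N.+1 = 0 ->
  ecoef (lambda_eval ev N.+1 (eC s)) set0 = 1.
Proof.
move=> sN; rewrite lambda_eval_fock // ecoefM0 (fock_trace_coef0 iota le_nM A2).
by rewrite ecoefC eqxx geom_invK // one_sub_binom_nilp.
Qed.

(** The factors in e^x and e^(-x) contribute equally under the trace. The trace of the paired series
    thus matches the single factor 1 + s e^x coming from the exterior powers, for which the degree
    derivation supplies the 2. *)
Lemma trace_theta_log (N : nat) (s : C) :
  \tr (mev A (theta_log iota M N s)) = 2%:R * \tr (mev A (tlog N s w)).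
Proof.
rewrite /theta_log -trefl_tlog mevD mxtraceD trace_mev_refl //.
by rewrite mulr_natl mulr2n.
Qed.

Lemma log_der_sym_eval (N : nat) (s : C) : s ^+ N.+1 = 0 ->
  log_der edeg (- \tr (mev A (theta_log iota M N.+1 (- s)))) (sym_eval ev N.+1 (eC s)).
Proof.
move=> sN; have sN' : (- s) ^+ N.+1 = 0 by rewrite exprNn sN mulr0.
rewrite trace_theta_log; apply: (log_derV ED) (log_der_lambda_eval sN').
by rewrite rmorphN sym_evalK // -rmorphXn sN rmorph0.
Qed.

Lemma sym_eval_coef0 (N : nat) (s : C) : s ^+ N.+1 = 0 ->
  ecoef (sym_eval ev N.+1 (eC s)) set0 = 1.
Proof.
move=> sN; have sN' : (- s) ^+ N.+1 = 0 by rewrite exprNn sN mulr0.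
have eN : eC s ^+ N.+1 = 0 by rewrite -rmorphXn sN rmorph0.
have := congr1 (fun x => ecoef x set0) (sym_evalK ev eN).
by rewrite ecoefM0 -rmorphN lambda_eval_coef0 // mul1r ecoef1 eqxx.
Qed.

Variables (p : C) (N : nat).
Hypotheses (pN : p ^+ N.+1 = 0) (evX : ev 'X = eC p).

Lemma powp_nil m : (0 < m)%N -> (p ^+ m) ^+ N.+1 = 0.
Proof. by move=> m0; rewrite -exprM (expr_nil pN) // leq_pmull. Qed.

Lemma Theta2_prod : ev (Theta2 n N.+1) =
  (\prod_(i < N.+1) sym_eval ev N.+1 (eC (p ^+ (2 * i).+2))) *
  \prod_(i < N.+1) lambda_eval ev N.+1 (eC (- p ^+ (2 * i).+1)).
Proof.
rewrite rmorph_Theta2 evX; congr (_ * _); rewrite big_add1 big_mkord.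
  by apply: eq_bigr => i _; rewrite -rmorphXn mulnS.
apply: eq_bigr => i _; rewrite -rmorphXn -rmorphN; do 4!congr (_ _).
by rewrite mulnS addSn subn1.
Qed.

(** The symmetric powers contribute the even exponents of p with a minus sign, as inverses, and the
    exterior powers the odd ones: this is [Theta_log] without its Ahat part. *)
Lemma log_der_Theta2 : log_der edeg
  (\tr (mev A (Theta_log iota M p N.+1 - ahat_log iota M))) (ev (Theta2 n N.+1)).
Proof.
rewrite Theta2_prod /Theta_log addrC addKr mev_sum raddf_sum /=.
under eq_bigr => i _ do rewrite mevD mevN mxtraceD raddfN /= addrC.
rewrite big_split; apply: (log_derM ED).
  apply: (log_der_prod ED
    (l := fun i => - \tr (mev A (theta_log iota M N.+1 (- p ^+ (2 * i).+2))))
    (x := fun i => sym_eval ev N.+1 (eC (p ^+ (2 * i).+2)))) => i _.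
  by apply: log_der_sym_eval; apply: powp_nil.
apply: (log_der_prod ED
  (l := fun i => \tr (mev A (theta_log iota M N.+1 (- p ^+ (2 * i).+1))))
  (x := fun i => lambda_eval ev N.+1 (eC (- p ^+ (2 * i).+1)))) => i _.
rewrite trace_theta_log; apply: log_der_lambda_eval.
by rewrite exprNn powp_nil ?mulr0.
Qed.

Lemma Theta2_coef0 : ecoef (ev (Theta2 n N.+1)) set0 = 1.
Proof.
rewrite Theta2_prod -[LHS]/(ecst0 _) rmorphM !rmorph_prod.
rewrite !big1 ?mulr1 // => i _.
  by apply: lambda_eval_coef0; rewrite exprNn powp_nil ?mulr0.
by apply: sym_eval_coef0; apply: powp_nil.
Qed.
End ThetaClass.

(** * The integral series delta_2 and eps_2 as elliptic parameters *)

Section IntegralSeries.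
Variables (K : comNzRingType) (p : K).

Definition int_eval : {poly int} -> K := horner_eval p \o map_poly intr.
HB.instance Definition _ := GRing.RMorphism.copy int_eval (horner_eval p \o map_poly intr).
Arguments int_eval : simpl never.

Lemma int_evalX : int_eval 'X = p.
Proof. by rewrite /int_eval /= map_polyX /horner_eval hornerX. Qed.

Lemma int_eval_theta3 N : int_eval (theta3 N) = theta3_cst p N.
Proof.
rewrite /theta3_cst /qfact /theta_prod -big_split /theta3 rmorph_prod.
rewrite big_add1 big_mkord; apply: eq_bigr => i _.
rewrite !(rmorphM, rmorphB, rmorphXn, rmorphD) !rmorph1 /= int_evalX !expr1n !mulr1 mul1r.
by rewrite -exprM (_ : (2 * i.+1 - 1 = (2 * i).+1)%N) //; lia.
Qed.

Lemma int_eval_theta1 N : int_eval (theta1_red N) = theta1_cst p N.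
Proof.
rewrite /theta1_cst /qfact /phi_prod -big_split /theta1_red rmorph_prod.
rewrite big_add1 big_mkord; apply: eq_bigr => i _.
rewrite !(rmorphM, rmorphB, rmorphXn, rmorphD) !rmorph1 /= int_evalX !expr1n !mulr1 mul1r.
by rewrite -exprM mulnS.
Qed.

(** Together with [int_eval_eps2], identifies the integral series that define the b_r with the
    parameters of [Theta_elliptic]. *)
Lemma int_eval_delta2 N : int_eval (delta2_8 N) =
  - (16%:R * p * theta1_cst p N ^+ 4 + theta3_cst p N ^+ 4).
Proof.
rewrite /delta2_8 rmorphN rmorphD !(rmorphXn, rmorphM) /= int_eval_theta1 int_eval_theta3.
by rewrite int_evalX (_ : 16%:P = 16%:R) ?rmorph_nat // -polyC_natr.
Qed.

Lemma int_eval_eps2 N : int_eval (eps2 N) =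
  p * theta1_cst p N ^+ 4 * theta3_cst p N ^+ 4.
Proof.
by rewrite !(rmorphXn, rmorphM) /= int_evalX int_eval_theta1 int_eval_theta3.
Qed.
End IntegralSeries.

Lemma tcoef_int_eval (C : comNzRingType) (M : nat) (P : {poly int}) j :
  (j <= M)%N -> tcoef (int_eval (tX C M) P) j = (P`_j)%:~R.
Proof.
move=> le_jM; rewrite -coef_map -(tcoef_horner (map_poly intr P) le_jM) -map_poly_comp.
by congr (tcoef _.[_] _); apply: eq_map_poly => c /=; rewrite rmorph_int.
Qed.

(** [eps2] starts with X, and the constant term -1 of [delta2_8] is raised to an odd power. The
    system that defines the b_r is therefore triangular with diagonal -1. *)
Lemma bcoef_lower k r j : (r <= k)%N -> (j <= r)%N ->
  bcoef k r j = if j == r then -1 else 0.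
Proof.
move=> le_rk le_jr.
have exp0 m : (0 < m)%N -> 0 ^+ m = 0 :> int by case: m => // m _; rewrite exprS mul0r.
have theta1_0 N : (theta1_red N).[0] = 1.
  rewrite horner_prod big_nat big1 // => m /andP[m0 _].
  by rewrite !hornerE /= exp0 ?muln_gt0 // subr0 addr0 !mulr1.
have theta3_0 N : (theta3 N).[0] = 1.
  rewrite horner_prod big_nat big1 // => m /andP[m0 _].
  by rewrite !hornerE /= !exp0 ?subr0 ?addr0 ?mulr1 //; lia.
rewrite /bcoef /eps2 -mulrA exprMn mulrCA coefXnM.
have [->|ne_jr] := eqVneq j r; last by rewrite ltn_neqAle ne_jr le_jr.
rewrite ltnn subnn -horner_coef0 !hornerE /= theta1_0 theta3_0 !expr1n !mulr1.
rewrite (_ : 2 * k + 1 - 2 * r = 2 * (k - r) + 1)%N; last by lia.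
by rewrite exprD exprM sqrrN !expr1n mul1r.
Qed.

Section SeriesChangeE.
Variables (F : numFieldType) (C : comNzRingType) (iota : {rmorphism F -> C}) (M : nat).
Local Notation base := (idfun : {rmorphism F -> F}).

Lemma tmap_texp c : tmap iota (texp base M c) = texp iota M c.
Proof. exact: tmap_mk. Qed.

Lemma tmap_tsinhc : tmap iota (tsinhc base M) = tsinhc iota M.
Proof. by apply: tps_ext => j le_jM; rewrite tcoef_map !tcoef_mk //; case: ifP; rewrite ?rmorph0. Qed.

Lemma tmap_tcosh : tmap iota (tcosh base M) = tcosh iota M.
Proof. by apply: tps_ext => j le_jM; rewrite tcoef_map !tcoef_mk //; case: ifP; rewrite ?rmorph0. Qed.

Lemma tmap_ahat_log : tmap iota (ahat_log base M) = ahat_log iota M.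
Proof. by rewrite rmorphN rmorphM /= tmap_euler tmap_tinv tmap_tsinhc. Qed.

Lemma tmap_lhat_log : tmap iota (lhat_log base M) = lhat_log iota M.
Proof.
by rewrite rmorphD rmorphN !rmorphM /= !tmap_euler !tmap_tinv tmap_tsinhc tmap_tcosh.
Qed.
End SeriesChangeE.

Lemma ecoef_eform_comb (C : comNzRingType) (n : nat) (c : C) (x : eform C n) S :
  ecoef (x * eC n c) S = c * ecoef x S.
Proof. by rewrite mulrC ecoefCM. Qed.

(** * The two genera as series of forms *)

Section GenusSeries.
Variables (F : numFieldType) (n M k : nat).
Hypotheses (le_nM : (n <= M)%N) (M_gt0 : (0 < M)%N).
Local Notation base := (idfun : {rmorphism F -> F}).
Local Notation edeg C := (@edeg C n).
Local Notation ED := (@edeg_derivation _ n).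
Variable A : 'M[eform F n]_n.
Hypotheses (A2 : hom2 A) (Aodd : forall j, odd j -> \tr (A ^+ j) = 0).

Lemma map_trace_odd (C : comNzRingType) (iota : {rmorphism F -> C}) j :
  odd j -> \tr (map_mx (@emap _ _ iota n) A ^+ j) = 0.
Proof. by move=> oj; rewrite -map_mxX trace_map_mx Aodd ?rmorph0. Qed.

Section Spinor.
Variable chi : {rmorphism virtual n -> eform F n}.
Hypothesis chi_Lambda : forall i, (i <= n)%N ->
  chi (Lambda n i) = \tr (mexp base M (ext_power_mx A i)).
Variable a : eform F n.
Hypotheses (a0 : ecoef a set0 = 1).
Hypothesis Da : log_der (edeg F) (\tr (mev A (ahat_log base M))) a.
Local Notation C := (tps F k).
Local Notation iota := (@tC F k : {rmorphism F -> tps F k}).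
Local Notation p := (tX F k).
Local Notation lift := (@emap _ _ iota n).

Definition spinor_eval : {poly virtual n} -> eform C n :=
  horner_eval (eC n p) \o map_poly (lift \o chi).
HB.instance Definition _ := GRing.RMorphism.copy spinor_eval
  (horner_eval (eC n p) \o map_poly (lift \o chi)).
Arguments spinor_eval : simpl never.

(** Ahat ch(Theta_2), with coefficients in the series in p = q^(1/2) modulo p^(k+1). *)
Definition spinor_series : eform C n := lift a * spinor_eval (Theta2 n k.+1).

Lemma tX_nil : p ^+ k.+1 = 0.
Proof. by apply: tps_nilp; have := tcoefXM0 (1 : C); rewrite mulr1. Qed.

Lemma spinor_evalX : spinor_eval 'X = eC n p.
Proof. by rewrite /spinor_eval /= map_polyX /horner_eval hornerX. Qed.

Lemma spinor_eval_Lambda i : (i <= n)%N -> spinor_eval (Lambda n i)%:P =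
  \tr (mexp iota M (ext_power_mx (map_mx lift A) i)).
Proof.
move=> le_in; rewrite /spinor_eval /= map_polyC /horner_eval hornerC /=.
by rewrite chi_Lambda // emap_trace_mev emap_ext_power tmap_texp.
Qed.

Lemma log_der_spinor_series :
  log_der (edeg C) (\tr (mev (map_mx lift A) (Theta_log iota M p k.+1))) spinor_series.
Proof.
have A2' := emap_hom2 iota A2.
have := log_derM ED (emap_log_der iota Da) (log_der_Theta2 le_nM M_gt0 A2'
  (map_trace_odd iota) spinor_eval_Lambda tX_nil spinor_evalX).
rewrite emap_trace_mev tmap_ahat_log -mxtraceD -mevD.
by rewrite addrC subrK.
Qed.

Lemma spinor_series_coef0 : ecoef spinor_series set0 = 1.
Proof.
have A2' := emap_hom2 iota A2.
rewrite ecoefM0 ecoef_map a0 rmorph1 mul1r.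
exact: (Theta2_coef0 le_nM A2' spinor_eval_Lambda tX_nil spinor_evalX).
Qed.

Lemma tcoef_spinor_eval (P : {poly virtual n}) S j : (j <= k)%N ->
  tcoef (ecoef (lift a * spinor_eval P) S) j = ecoef (a * chi P`_j) S.
Proof.
move=> le_jk; pose Q := \poly_(i < size P) ecoef (a * chi P`_i) S.
have -> : ecoef (lift a * spinor_eval P) S = (map_poly (tC k) Q).[p].
  rewrite /spinor_eval /= /horner_eval (horner_coef_wide _ (size_poly _ _)).
  rewrite [RHS](horner_coef_wide _ (leq_trans (size_poly _ _) (size_poly _ _))).
  rewrite mulr_sumr ecoef_sum; apply: eq_bigr => i _.
  rewrite !coef_map /= coef_poly ltn_ord mulrA -rmorphXn -rmorphM.
  by rewrite ecoef_eform_comb ecoef_map mulrC.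
rewrite tcoef_horner // coef_poly; case: ltnP => // le_Pj.
by rewrite nth_default // rmorph0 mulr0 ecoef_zero.
Qed.

(** [B_class] reads its coefficient from a shorter truncation of the product; the two agree modulo
    X^(j+1). *)
Lemma coef_Theta2 j : (j <= k)%N -> (Theta2 n k.+1)`_j = B_class n j.
Proof.
move=> le_jk.
pose ev := horner_eval (tX (virtual n) j) \o map_poly (tC j).
have evP P : tcoef (ev P) j = P`_j by exact: tcoef_horner.
rewrite /B_class -[LHS]evP -[RHS]evP; congr (tcoef _ j).
apply: (Theta2_stable (ev := ev : {rmorphism _ -> _})) => //.
rewrite /ev /= map_polyX /horner_eval hornerX; apply: tps_nilp.
by have := tcoefXM0 (1 : tps (virtual n) j); rewrite mulr1.
Qed.

Lemma tcoef_spinor_series S j : (j <= k)%N ->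
  tcoef (ecoef spinor_series S) j = ecoef (a * chi (B_class n j)) S.
Proof. by move=> le_jk; rewrite tcoef_spinor_eval // coef_Theta2. Qed.
End Spinor.

Section Signature.
Variable l : eform F n.
Hypothesis l0 : ecoef l set0 = 1.
Hypothesis Dl : log_der (edeg F) (\tr (mev A (lhat_log base M))) l.
Local Notation x := (\tr (mexp base M A)).

Lemma chern_coef0 : ecoef x set0 = n%:R.
Proof.
rewrite /mxtrace ecoef_sum; under eq_bigr => i _ do rewrite (mexp_coef0 base) // eqxx.
by rewrite sumr_const card_ord.
Qed.

Section SignatureSeries.
Variables (C : comNzRingType) (iota : {rmorphism F -> C}) (q : C).
Hypothesis q2 : q ^+ 2 = 0.
Local Notation lift := (@emap _ _ iota n).

(** The first order expansion at the signature cusp: normalized Lhat, twisted by 1 + 2q (T_C M -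
    n). *)
Definition signature_series : eform C n := lift l * (1 + eC n (2%:R * q) * lift (x - n%:R)).

Lemma signature_series_coef0 : ecoef signature_series set0 = 1.
Proof.
rewrite ecoefM0 ecoefD ecoefM0 ecoef1 eqxx !ecoef_map l0 rmorph1 mul1r.
by rewrite ecoefD ecoefN chern_coef0 -(rmorph_nat (@eC F n)) !ecoefC !eqxx subrr rmorph0 mulr0 addr0.
Qed.

(** The trace of x (e^x - e^(-x)) at the curvature is, by reflection, twice that of x e^x, which is
    the degree derivative of ch(T_C M). The remaining terms carry q^2 = 0. *)
Lemma log_der_signature_series :
  log_der (edeg C) (\tr (mev (map_mx lift A) (sign_log iota M q))) signature_series.
Proof.
have A2' := emap_hom2 iota A2; have Aodd' := map_trace_odd iota.
set B := map_mx lift A in A2' Aodd' *.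
set w := texp iota M 1; set w' := texp iota M (- 1); set X := tX C M.
have trE : \tr (mev B (X * (w - w'))) = edeg C (lift x).
  rewrite emap_trace_mev tmap_texp -/B -/w edeg_trace mdeg_mev //.
  have -> : mev B (X * (w - w')) = mev B (X * w) + mev B (trefl (X * w)).
    by rewrite rmorphM /= trefl_tX trefl_texp -mevD mulrBr mulNr.
  rewrite mxtraceD (trace_mev_refl _ Aodd') euler_texp !rmorph1 mul1r.
  by rewrite mxtraceZ mulr_natl mulr2n.
have q2' : eC n q * eC n q = 0 by rewrite -rmorphM -expr2 q2 rmorph0.
rewrite /sign_log mevD mxtraceD.
have -> : \tr (mev B (2%:R * tC M q * X * (w - w'))) = eC n (2%:R * q) * edeg C (lift x).
  rewrite -trE -mulrA -(rmorph_nat (tC M)) -(rmorphM (tC M)) (mevM (natreg_alg iota) le_nM A2').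
  by rewrite mevC mul_scalar_mx mxtraceZ.
apply: (log_derM ED).
  by have := emap_log_der iota Dl; rewrite emap_trace_mev tmap_lhat_log.
rewrite /log_der ED.1 (der1 ED) add0r (der_cst ED) ?edegC //.
rewrite rmorphB rmorph_nat (derB ED) (der_nat ED) subr0 mulrDr mulr1.
set y := edeg C (lift x); set z := lift x - _.
transitivity (eC n (2%:R * q) * y + 4%:R * (eC n q * eC n q) * y * z).
  by rewrite q2' mulr0 !mul0r addr0.
by rewrite rmorphM rmorph_nat; ring.
Qed.
End SignatureSeries.

Local Notation q := (tX F 1).
Local Notation P := (signature_series (@tC F 1 : {rmorphism F -> tps F 1}) q).

Lemma tcoef_signature_series0 S : tcoef (ecoef P S) 0 = ecoef l S.
Proof.
rewrite /signature_series mulrDr mulr1 mulrCA ecoefD ecoefCM -rmorphM !ecoef_map.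
by rewrite tcoefD tcoefC -mulrA mulrCA tcoefXM0 addr0.
Qed.

Lemma tcoef_signature_series1 S :
  tcoef (ecoef P S) 1 = 2%:R * ecoef (l * (x - n%:R)) S.
Proof.
rewrite /signature_series mulrDr mulr1 mulrCA ecoefD ecoefCM -rmorphM !ecoef_map.
rewrite tcoefD tcoefC add0r -(rmorph_nat (tC 1)) -mulrA tcoefCM.
by rewrite tcoefXMS // tcoefC.
Qed.
End Signature.
End GenusSeries.

(** * Comparison of coefficients in the top degree *)

Lemma bcoef_inj (F : numFieldType) (k : nat) (x y : nat -> F) :
  (forall j, (j <= k)%N ->
    \sum_(r < k.+1) x r * (bcoef k r j)%:~R = \sum_(r < k.+1) y r * (bcoef k r j)%:~R) ->
  forall j, (j <= k)%N -> x j = y j.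
Proof.
move=> E; elim/ltn_ind => j IH le_jk; have /eqP := E j le_jk.
rewrite -subr_eq0 -sumrB (bigD1 (inord j)) //= inordK ?ltnS // big1 => [|r ne_rj].
  rewrite bcoef_lower // eqxx addr0 -mulrBl rmorphN1 mulrN1 oppr_eq0 subr_eq0.
  by move/eqP.
have {}ne_rj : nat_of_ord r != j.
  by apply: contraNneq ne_rj => <-; rewrite inord_val.
have le_rk : (r <= k)%N by rewrite -ltnS.
case: (ltngtP r j) ne_rj => // [lt_rj|lt_jr] _; first by rewrite IH ?subrr.
by rewrite bcoef_lower ?(ltnW lt_jr) // (ltn_eqF lt_jr) rmorph0 !mulr0 subrr.
Qed.

(** Modulo q^2 the logarithmic derivatives of 2 + 48q and 1/16 - q are 24q and -16q, which gives the
    linear term of any monomial. *)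
Lemma dual_monomial (F : numFieldType) m r :
  let u : tps F 1 := (2%:R + 48%:R * tX F 1) ^+ m * (tC 1 16^-1 - tX F 1) ^+ r in
  tcoef u 0 = 2%:R ^+ m * 16^-1 ^+ r /\
  tcoef u 1 = (24%:R * m%:R - 16%:R * r%:R) * (2%:R ^+ m * 16^-1 ^+ r).
Proof.
set X := tX F 1; move=> u; have ED := @euler_derivation F 1.
have X2 : X ^+ 2 = 0 by apply: tps_nilp; have := tcoefXM0 (1 : tps F 1); rewrite mulr1.
have X0 : tcoef X 0 = 0 by have := tcoefXM0 (1 : tps F 1); rewrite mulr1.
have nat0 i : tcoef (i%:R : tps F 1) 0 = i%:R by rewrite -(rmorph_nat (tC 1)) tcoefC.
have u0 : tcoef u 0 = 2%:R ^+ m * 16^-1 ^+ r.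
  rewrite tcoefM0 !tcoefX0 tcoefD tcoefM0 (tcoefD _ (- X)) tcoefN X0 mulr0 oppr0 !addr0.
  by rewrite tcoefC nat0.
have Dd : log_der (@euler F 1) (24%:R * X) (2%:R + 48%:R * X).
  rewrite /log_der ED.1 (der_nat ED) ED.2 (der_nat ED) eulerX mul0r !add0r.
  transitivity (48%:R * X + 1152%:R * X ^+ 2); first by rewrite X2 mulr0 addr0.
  by ring.
have De : log_der (@euler F 1) (- (16%:R * X)) (tC 1 16^-1 - X).
  rewrite /log_der (derB ED) eulerC eulerX sub0r.
  transitivity (- (16%:R * tC 1 16^-1 * X) + 16%:R * X ^+ 2); last by ring.
  by rewrite X2 mulr0 addr0 -(rmorph_nat (tC 1)) -(rmorphM (tC 1)) mulfV ?pnatr_eq0 // rmorph1 mul1r.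
split=> //.
transitivity (tcoef (euler u) 1); first by rewrite tcoef_euler mul1r.
have := log_derM ED (der_log_exp ED m Dd) (der_log_exp ED r De).
rewrite /log_der -/u => ->.
have -> : m%:R * (24%:R * X) + r%:R * - (16%:R * X) =
    tC 1 (24%:R * m%:R - 16%:R * r%:R) * X.
  by rewrite rmorphB !rmorphM !rmorph_nat; ring.
by rewrite -mulrA tcoefCM tcoefXMS ?u0.
Qed.

(** The source of the constants of the theorem. The linear terms give 12 (2k+1-2r) - 8r + (8k+4) -
    16 = 32 (k-r), and the powers of 2 combine to 2^(6(k-r)+3); when r = k both sides vanish. *)
Lemma weight_identity (F : numFieldType) (k r : nat) (c : F) : (r <= k)%N ->
  let w := 2%:R ^+ (2 * k + 1 - 2 * r) * 16^-1 ^+ r in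
  (2%:R^-1 * (c * ((24%:R * (2 * k + 1 - 2 * r)%:R - 16%:R * r%:R) * w)) +
   ((8 * k + 4)%:R - 16%:R) * (c * w)) * 2%:R ^+ (4 * k + 2) =
  2%:R ^+ 14 * ((k - r)%:R * 2%:R ^+ (6 * (k - r - 1))) * c.
Proof.
move=> le_rk /=; set d := (k - r)%N; have kE : k = (r + d)%N by rewrite subnKC.
have -> : (2 * k + 1 - 2 * r = 2 * d + 1)%N by rewrite kE; lia.
set w := _ * _ ^+ r.
have wE : w * 2%:R ^+ (4 * k + 2) = 2%:R ^+ (6 * d + 3).
  rewrite /w (_ : 4 * k + 2 = 4 * r + (4 * d + 2))%N; last by rewrite kE; lia.
  have -> : 2%:R ^+ (4 * r + (4 * d + 2)) = 16%:R ^+ r * 2%:R ^+ (4 * d + 2) :> F.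
    by rewrite exprD exprM -natrX.
  have e16 : 16^-1 ^+ r * 16%:R ^+ r = 1 :> F.
    by rewrite -exprMn mulVf ?pnatr_eq0 // expr1n.
  transitivity ((16^-1 ^+ r * 16%:R ^+ r) * (2%:R ^+ (2 * d + 1) * 2%:R ^+ (4 * d + 2)) : F).
    by ring.
  by rewrite e16 mul1r -exprD; congr (_ ^+ _); lia.
transitivity (32%:R * d%:R * (w * 2%:R ^+ (4 * k + 2)) * c).
  by rewrite kE !(natrD, natrM); field.
rewrite wE; case: (d) => [|e]; first by rewrite mulr0 !mul0r mulr0 mul0r.
rewrite (_ : 6 * e.+1 + 3 = 6 * (e.+1 - 1) + 9)%N; last by lia.
by rewrite exprD; ring.
Qed.

Section GenusRelation.
Variables (F : numFieldType) (k M : nat).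
Local Notation n := (8 * k + 4)%N.
Hypotheses (le_nM : (n <= M)%N) (M_gt0 : (0 < M)%N) (le_n2M : (n <= 2 * (M - 2))%N).
Local Notation base := (idfun : {rmorphism F -> F}).
Variable A : 'M[eform F n]_n.
Hypotheses (A2 : hom2 A) (Aodd : forall j, odd j -> \tr (A ^+ j) = 0).
Variable chi : {rmorphism virtual n -> eform F n}.
Hypothesis chi_Lambda : forall i, (i <= n)%N ->
  chi (Lambda n i) = \tr (mexp base M (ext_power_mx A i)).
Variables a l : eform F n.
Hypotheses (a0 : ecoef a set0 = 1) (l0 : ecoef l set0 = 1).
Hypothesis Da : log_der (@edeg F n) (\tr (mev A (ahat_log base M))) a.
Hypothesis Dl : log_der (@edeg F n) (\tr (mev A (lhat_log base M))) l.
Local Notation x := (\tr (mexp base M A)).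
Local Notation h r := (ecoef (a * chi (b_class n k r)) setT).
Local Notation top y := (ecoef y setT).

(** One family of scalars describes both genera in degree 8k+4. The first two equations are the
    coefficients of 1 and q at the signature cusp, the last one lists those of p^j at the other
    cusp. *)
Lemma genus_coefficients : exists c : nat -> F,
  [/\ top l = \sum_(r < k.+1) c r * (2%:R ^+ (2 * k + 1 - 2 * r) * 16^-1 ^+ r),
      2%:R * top (l * (x - n%:R)) = \sum_(r < k.+1) c r *
        ((24%:R * (2 * k + 1 - 2 * r)%:R - 16%:R * r%:R) *
         (2%:R ^+ (2 * k + 1 - 2 * r) * 16^-1 ^+ r)) &
      forall j, (j <= k)%N ->
        top (a * chi (B_class n j)) = \sum_(r < k.+1) c r * (bcoef k r j)%:~R].
Proof.
pose iota1 := @tC F 1 : {rmorphism F -> tps F 1}.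
pose iota2 := @tC F k : {rmorphism F -> tps F k}.
have q2 : tX F 1 ^+ 2 = 0.
  by apply: tps_nilp; have := tcoefXM0 (1 : tps F 1); rewrite mulr1.
have [f1 [f10 Lf1 E1]] := sign_elliptic iota1 M q2.
have [f2 [f20 Lf2 E2]] := Theta_elliptic iota2 M_gt0 (tX_nil F k).
have R := log_der_frel (trace_rel A2 le_n2M (log_der_rel f10 f20 E1 E2 Lf1 Lf2))
  (signature_series_coef0 le_nM A2 l0 iota1 (tX F 1))
  (spinor_series_coef0 k le_nM A2 chi_Lambda a0)
  (log_der_signature_series le_nM A2 Aodd Dl iota1 q2)
  (log_der_spinor_series k le_nM M_gt0 A2 Aodd chi_Lambda Da).
have := R setT; rewrite cardsT card_ord => /hrelP[c [c1 c2]]; exists c; split.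
- rewrite -(tcoef_signature_series0 M A) c1 tcoef_sum; apply: eq_bigr => r _.
  by rewrite tcoefCM (dual_monomial _ _ _).1.
- rewrite -(tcoef_signature_series1 M A) c1 tcoef_sum; apply: eq_bigr => r _.
  by rewrite tcoefCM (dual_monomial _ _ _).2.
move=> j le_jk; rewrite -(tcoef_spinor_series chi a _ le_jk) c2 tcoef_sum.
apply: eq_bigr => r _; rewrite tcoefCM -int_eval_delta2 -int_eval_eps2.
by rewrite -!rmorphXn -rmorphM tcoef_int_eval.
Qed.

(** The scalars of [genus_coefficients] satisfy the triangular system of the b_r, so they are the
    h_r. The factor 2^(4k+2) is the constant term removed from Lhat. *)
Lemma genus_top :
  2%:R ^+ (4 * k + 2) * top (l * (x - 16%:R)) =
  \sum_(r < k) 2%:R ^+ 14 * ((k - r)%:R * 2%:R ^+ (6 * (k - r - 1))) * h r.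
Proof.
have [c [lE xE BE]] := genus_coefficients.
have hE r : (r <= k)%N -> h r = c r.
  move: r; apply: bcoef_inj => j le_jk; rewrite -BE // -(@b_class_congr n k j) //.
  rewrite coef_sum rmorph_sum mulr_sumr ecoef_sum; apply: eq_bigr => r _.
  rewrite coefCM coef_map rmorphM rmorph_int mulrA mulrC -(rmorph_int (@eC F n)).
  by rewrite ecoef_eform_comb.
(* The expansion in q yields ch - n, so the difference n - 16 is charged to Lhat itself. *)
have -> : l * (x - 16%:R) = l * (x - n%:R) + eC n (n%:R - 16%:R) * l.
  by rewrite rmorphB !rmorph_nat; ring.
rewrite ecoefD ecoefCM.
have -> : top (l * (x - n%:R)) = 2%:R^-1 * (2%:R * top (l * (x - n%:R))).
  by rewrite mulKf ?pnatr_eq0.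
rewrite lE xE !mulr_sumr -big_split mulr_sumr.
transitivity (\sum_(r < k.+1) 2%:R ^+ 14 * ((k - r)%:R * 2%:R ^+ (6 * (k - r - 1))) * c r).
  apply: eq_bigr => r _ /=; have le_rk : (r <= k)%N by rewrite -ltnS.
  by rewrite [LHS]mulrC (weight_identity _ le_rk); ring.
rewrite big_ord_recr /= subnn mul0r mulr0 mul0r addr0.
by apply: eq_bigr => r _; rewrite hE // ltnW.
Qed.
End GenusRelation.

(** * The identity for a curvature matrix with vanishing odd traces *)

Section TopForm.
Variables (C : comNzRingType) (n : nat).

Definition top_form : extalg C n := [ffun S : {set 'I_n} => (S == setT)%:R].

Lemma ext_part_top (w : eform C n) : ext_part n (eforget w) = ecoef w setT *: top_form.
Proof.
apply/ffunP => S; rewrite !ffunE /GRing.scale /= -[n in #|S| == n]card_ord -cardsT.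
have -> : (#|S| == #|[set: 'I_n]|) = (S == setT).
  by rewrite eqEcard subsetT eqn_leq (subset_leq_card (subsetT S)).
by case: eqP => [->|_]; [rewrite mulr1 | rewrite mulr0].
Qed.
End TopForm.

Section GenusIdentity.
Variables (R : realType) (k : nat).
Local Notation n := (8 * k + 4)%N.
Local Notation eC := (@eC R[i] n).
Local Notation base := (idfun : {rmorphism R[i] -> R[i]}).
Variable Om : 'M[eform R[i] n]_n.
Hypotheses (Om2 : hom2 Om) (Om_odd : forall j, odd j -> \tr (Om ^+ j) = 0).
Local Notation M := n.+2.
Local Notation A := (eC (chern_cst R) *: Om).
Local Notation Om_form := (map_mx (@eforget R[i] n) Om).

Lemma chern_character_Lambda i : (i <= n)%N ->
  chern_character M Om (Lambda n i) = \tr (mexp base M (ext_power_mx A i)).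
Proof.
case: i => [|i] le_in.
  rewrite rmorph1 (_ : ext_power_mx A 0 = 0); last first.
    apply/matrixP => s t; rewrite !mxE /= big1 // => u.
    have := enum_valP t; rewrite inE cards_eq0 => /eqP->.
    by rewrite inE.
  rewrite /mexp /mev big_ord_recl big1 => [|j _].
    rewrite texp_coef0 rmorph1 scale1r expr0 addr0 mxtrace1.
    rewrite (_ : #|ext_index n 0| = 1%N) // (_ : ext_index n 0 = [set set0]) ?cards1 //.
    by apply/setP => S; rewrite !inE cards_eq0.
  by rewrite exprS mul0r scaler0.
rewrite /= insubT /chern_character mmapX mmap1U.
by [].
Qed.

(** The arguments of Ahat and Lhat are half of the matrix used for ch, hence the series in x/2. *)
Lemma imag_over_four_pi : imag_over (4 * pi) = 2^-1 * chern_cst R.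
Proof.
rewrite /chern_cst /imag_over (_ : 4 * pi = 2 * (2 * pi) :> R); last by ring.
rewrite [(2 * (2 * pi))%:C%C](rmorphM (real_complex R)) /= invfM mulrCA; congr (_ * _).
by rewrite rmorph_nat.
Qed.

Lemma genus_identity :
  ext_part n (Lhat Om_form * ch Om_form - 16 *: Lhat Om_form) =
  2 ^+ 14 *: \sum_(r < k) ((k - r)%:R * 2 ^+ (6 * (k - r - 1))) *: h_form k Om_form r.
Proof.
have le_nM : (n <= M)%N by lia.
(* The working precision is M = n + 2, as the differential equation loses two orders. *)
have le_n2M : (n <= 2 * (M - 2))%N by lia.
have A2 : hom2 A by exact: hom2Z.
have Aodd j : odd j -> \tr (A ^+ j) = 0.
  by move=> oj; rewrite exprZmx mxtraceZ Om_odd ?mulr0.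
have [a [aE Da a0]] := Ahat_val (F := R[i]) le_nM (ltn0Sn _) (chern_cst R) Om2.
have [l [lE Dl l0]] := Lhat_val (F := R[i]) le_nM (ltn0Sn _) (chern_cst R) Om2.
(* The constant term 2^(n/2) of Lhat, with n = 8k+4; [l'] below is Lhat divided by it. *)
have lam : sqrtC (2 ^+ n) = 2 ^+ (4 * k + 2) :> R[i].
  rewrite (_ : n = (4 * k + 2) * 2)%N ?exprM ?sqrCK ?exprn_ge0 ?ler0n //; lia.
rewrite lam in l0.
have lam0 : 2 ^+ (4 * k + 2) != 0 :> R[i] by rewrite expf_neq0 ?pnatr_eq0.
pose l' := eC (2 ^+ (4 * k + 2))^-1 * l.
have l'0 : ecoef l' set0 = 1 by rewrite ecoefCM l0 mulVf.
have Dl' : log_der (@edeg R[i] n) (\tr (mev A (lhat_log base M))) l'.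
  by rewrite /log_der (der_cst (@edeg_derivation _ n)) ?edegC // Dl mulrCA.
have H := genus_top le_nM (ltn0Sn _) le_n2M A2 Aodd chern_character_Lambda a0 l'0 Da Dl'.
rewrite /Ahat -?imag_over_four_pi in aE; rewrite /Lhat -imag_over_four_pi in lE.
rewrite /h_form /Ahat /Lhat -aE -lE /ch -/(chern_cst R).
rewrite (trace_exp_val (F := R[i]) le_nM (ltn0Sn _) (chern_cst R) Om2).
under eq_bigr => r _ do rewrite (ch_virtual_lift le_nM (ltn0Sn _) _ Om2) -rmorphM ext_part_top scalerA.
rewrite -scaler_suml scalerA.
have -> : 16 *: eforget l = eforget (l * 16%:R).
  by rewrite val_scale mulrC -(rmorph_nat eC).
rewrite -rmorphM -rmorphB -mulrBr ext_part_top; congr (_ *: _).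
have lE' : l = eC (2 ^+ (4 * k + 2)) * l' by rewrite mulrA -rmorphM mulfV // rmorph1 mul1r.
rewrite {1}lE' -mulrA ecoefCM H mulr_sumr; apply: eq_bigr => r _.
exact: esym (mulrA _ _ _).
Qed.
End GenusIdentity.

(** * Two-forms in coordinates *)

Section TwoForms.
Variables (C : comNzRingType) (n : nat).
Local Notation dx := (dx C).

Lemma dx_mul (i j : 'I_n) : dx i * dx j =
  [ffun S : {set 'I_n} => if (i != j) && (S == [set i; j]) then (-1) ^+ (j < i)%N else 0].
Proof.
apply/ffunP => S; rewrite !ffunE.
have term0 A T : ~~ ((A == [set i]) && (T :\: A == [set j])) ->
    (-1) ^+ inversions A (T :\: A) * (dx i A * dx j (T :\: A)) = 0.
  by rewrite !ffunE; case: eqP; case: eqP => // _ _; rewrite ?mul0r ?mulr0 // mulr0.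
case: ifP => [/andP[ne_ij /eqP->]|nS]; last first.
  rewrite big1 // => A; rewrite inE => sAS; apply: term0; apply/negP.
  case/andP => /eqP AE /eqP SA; move/negP: nS; apply; apply/andP; split.
    by apply/eqP => ij; have := set11 j; rewrite -SA AE ij !inE eqxx.
  by rewrite -(setID S A) (setIidPr sAS) SA AE.
have DS : [set i; j] :\: [set i] = [set j].
  apply/setP => t; rewrite !inE; case: (eqVneq t i) => //= ->.
  by rewrite (negPf ne_ij).
rewrite (bigD1 [set i]) /=; last by rewrite inE subsetUl.
rewrite big1 => [|A /andP[_ nA]]; last by apply: term0; rewrite (negPf nA).
by rewrite DS !ffunE !eqxx !mulr1 addr0 /inversions !big_set1.
Qed.

Lemma dx_anticomm (i j : 'I_n) : dx i * dx j = - (dx j * dx i).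
Proof.
apply/ffunP => S; rewrite !dx_mul !ffunE eq_sym setUC.
case: (eqVneq j i) => [|ne_ji] /=; first by rewrite oppr0.
case: eqP => _; last by rewrite oppr0.
by move: ne_ji; rewrite -val_eqE /=; case: ltngtP => // _ _; rewrite expr0 expr1 ?opprK.
Qed.

Lemma dx_mul_even (i j : 'I_n) : dx i * dx j \in @even_form C n.
Proof.
apply/even_formP => S; rewrite dx_mul ffunE; case: ifP => // /andP[ne_ij /eqP->].
by rewrite cards2 ne_ij.
Qed.

Definition dx2 (i j : 'I_n) : eform C n := EForm (dx_mul_even i j).

Lemma edeg_dx2 i j : edeg (dx2 i j) = 2%:R * dx2 i j.
Proof.
apply: eform_ext => S; rewrite ecoef_deg -(rmorph_nat (@eC C n)) ecoefCM /ecoef.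
rewrite /= dx_mul ffunE; case: ifP => [/andP[ne_ij /eqP->]|_]; last by rewrite !mulr0.
by rewrite cards2 ne_ij.
Qed.

Lemma dx2_sym (i j : 'I_n) : dx2 i j = - dx2 j i.
Proof. by apply/val_inj; exact: dx_anticomm. Qed.

Definition two_form (s : 'I_n -> 'I_n -> C) : eform C n :=
  \sum_i \sum_j eC n (s i j) * dx2 i j.

Lemma eq_two_form s s' : (forall i j, s i j = s' i j) -> two_form s = two_form s'.
Proof. by move=> E; apply: eq_bigr => i _; apply: eq_bigr => j _; rewrite E. Qed.

Lemma edeg_two_form s : edeg (two_form s) = 2%:R * two_form s.
Proof.
have ED := @edeg_derivation C n.
rewrite (der_sum ED) mulr_sumr; apply: eq_bigr => i _.
rewrite (der_sum ED) mulr_sumr; apply: eq_bigr => j _.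
by rewrite (der_cst ED) ?edegC // edeg_dx2 mulrCA.
Qed.

Lemma two_formD s s' : two_form s + two_form s' = two_form (fun i j => s i j + s' i j).
Proof.
rewrite -big_split; apply: eq_bigr => i _; rewrite -big_split.
by apply: eq_bigr => j _; rewrite rmorphD mulrDl.
Qed.

Lemma two_formZ c s : eC n c * two_form s = two_form (fun i j => c * s i j).
Proof.
rewrite mulr_sumr; apply: eq_bigr => i _; rewrite mulr_sumr; apply: eq_bigr => j _.
by rewrite rmorphM mulrA.
Qed.

Lemma two_form_sum (I : Type) (r : seq I) (s : I -> 'I_n -> 'I_n -> C) :
  \sum_(t <- r) two_form (s t) = two_form (fun i j => \sum_(t <- r) s t i j).
Proof.
rewrite exchange_big; apply: eq_bigr => i _; rewrite exchange_big.
by apply: eq_bigr => j _; rewrite rmorph_sum mulr_suml.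
Qed.

(** A symmetric array of coefficients against the alternating dx_i dx_j equals its own negative. *)
Lemma two_form_symmetric s : (forall c : C, c + c = 0 -> c = 0) ->
  (forall i j, s i j = s j i) -> two_form s = 0.
Proof.
move=> reg2 ssym; have E : two_form s = - two_form s.
  rewrite {1}/two_form exchange_big -sumrN; apply: eq_bigr => i _.
  rewrite -sumrN; apply: eq_bigr => j _.
  by rewrite ssym dx2_sym mulrN.
apply: eform_ext => S; rewrite ecoef_zero; apply: reg2.
by rewrite -ecoefD {1}E addNr ecoef_zero.
Qed.

Lemma eforget_two_form s :
  eforget (two_form s) = \sum_i \sum_j s i j *: (dx i * dx j).
Proof.
rewrite rmorph_sum; apply: eq_bigr => i _; rewrite rmorph_sum; apply: eq_bigr => j _.
by rewrite rmorphM /= -[dx i * dx j in RHS]mul1r scalerAl.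
Qed.
End TwoForms.

From mathcomp Require Import boolp classical_sets functions.
Import numFieldTopology.Exports numFieldNormedType.Exports.
Local Open Scope classical_set_scope.

(** * Differentiability of inverse matrices and symmetry of mixed derivatives *)

Section DirectionalDerivatives.
Variables (R : realType) (V : normedModType R).
Implicit Types (f : V -> R) (x y u v w : V).

Lemma derivable_bigsum (I : Type) (r : seq I) (P : pred I) (f : I -> V -> R) x v :
  (forall i, derivable (f i) x v) ->
  derivable (fun y => \sum_(i <- r | P i) f i y) x v.
Proof.
move=> df; elim: r => [|i r IH].
  by rewrite (_ : (fun _ => _) = cst 0) //; apply/funext => y; rewrite big_nil.
case Pi: (P i); last first.
  by rewrite (_ : (fun _ => _) = (fun y => \sum_(j <- r | P j) f j y)) //;
    apply/funext => y; rewrite big_cons Pi.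
rewrite (_ : (fun _ => _) = f i + (fun y => \sum_(j <- r | P j) f j y)).
  exact: derivableD.
by apply/funext => y; rewrite big_cons Pi.
Qed.

Lemma derivable_bigprod (I : Type) (r : seq I) (P : pred I) (f : I -> V -> R) x v :
  (forall i, derivable (f i) x v) ->
  derivable (fun y => \prod_(i <- r | P i) f i y) x v.
Proof.
move=> df; elim: r => [|i r IH].
  by rewrite (_ : (fun _ => _) = cst 1) //; apply/funext => y; rewrite big_nil.
case Pi: (P i); last first.
  by rewrite (_ : (fun _ => _) = (fun y => \prod_(j <- r | P j) f j y)) //;
    apply/funext => y; rewrite big_cons Pi.
rewrite (_ : (fun _ => _) = f i * (fun y => \prod_(j <- r | P j) f j y)).
  exact: derivableM.
by apply/funext => y; rewrite big_cons Pi.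
Qed.

Lemma derive_bigsum (I : Type) (r : seq I) (f : I -> V -> R) x v :
  (forall i, derivable (f i) x v) ->
  'D_v (fun y => \sum_(i <- r) f i y) x = \sum_(i <- r) 'D_v (f i) x.
Proof.
move=> df; elim: r => [|i r IH].
  rewrite big_nil (_ : (fun _ => _) = cst 0) ?derive_cst //.
  by apply/funext => y; rewrite big_nil.
rewrite big_cons -IH (_ : (fun _ => _) = f i + (fun y => \sum_(j <- r) f j y)).
  by rewrite deriveD //; apply: derivable_bigsum.
by apply/funext => y; rewrite big_cons.
Qed.

Lemma derivable_det m (A : V -> 'M[R]_m) x v :
  (forall i j, derivable (fun y => A y i j) x v) ->
  derivable (fun y => \det (A y)) x v.
Proof.
move=> dA; apply: derivable_bigsum => s.
apply: (derivableM (f := cst _)) => //.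
exact: derivable_bigprod.
Qed.

(** Near x the inverse is given by cofactors over the determinant, which are differentiable. *)
Lemma derivable_invmx m (A : V -> 'M[R]_m) x v i j :
  (\near x, A x \in unitmx) -> (forall i j, derivable (fun y => A y i j) x v) ->
  derivable (fun y => invmx (A y) i j) x v.
Proof.
move=> uA dA.
have : derivable (fun y => (\det (A y))^-1 * cofactor (A y) j i) x v.
  apply: derivableM.
    apply: derivableV; last exact: derivable_det.
    by rewrite -unitfE -unitmxE; apply: nbhs_singleton uA.
  apply: (derivableM (f := cst _)) => //; apply: derivable_det => k l.
  rewrite (_ : (fun _ => _) = fun y => A y (fintype.lift j k) (fintype.lift i l)) //.
  by apply/funext => y; rewrite !mxE.
apply: near_eq_derivable; near=> y; rewrite /invmx ifT ?mxE //.
by near: y.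
Unshelve. all: by end_near. Qed.

Lemma is_derive_line f y u (s : R) : derivable f (y + s *: u) u ->
  is_derive s 1 (fun r : R => f (y + r *: u)) ('D_u f (y + s *: u)).
Proof.
have E : (fun h : R => h^-1 *: (((fun r : R => f (y + r *: u)) \o shift s) (h *: 1)
    - f (y + s *: u))) =
    (fun h : R => h^-1 *: ((f \o shift (y + s *: u)) (h *: u) - f (y + s *: u))).
  apply/funext => h /=; congr (_ *: (f _ - _)).
  by rewrite scalerDl [h *: 1]mulr1 addrCA.
by move=> df; split; rewrite /derivable /derive E.
Qed.

(** The mean value theorem applied twice, along u to the increment in the direction w, then along
    w. *)
Lemma second_difference (U : set V) f x u w (h : R) : 0 < h ->
  (forall s t, 0 <= s <= h -> 0 <= t <= h -> U (x + s *: u + t *: w)) ->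
  (forall y, U y -> derivable f y u) ->
  (forall y, U y -> derivable (fun z => 'D_u f z) y w) ->
  exists s t, [/\ 0 <= s <= h, 0 <= t <= h &
    f (x + h *: u + h *: w) - f (x + h *: u) - (f (x + h *: w) - f x) =
    'D_w (fun z => 'D_u f z) (x + s *: u + t *: w) * h * h].
Proof.
move=> h0 boxU df ddf.
have mvt (g dg : R -> R) : (forall s, 0 <= s <= h -> is_derive s 1 g (dg s)) ->
    exists2 c, 0 <= c <= h & g h - g 0 = dg c * h.
  move=> Dg; have [||c ch E] := MVT_segment (f := g) (df := dg) (ltW h0).
  - by move=> s; rewrite in_itv /= => /andP[? ?]; apply: Dg; rewrite !ltW.
  - apply: derivable_within_continuous => s; rewrite in_itv /= => sh.
    by have := Dg s sh; case.
  by exists c; [move: ch; rewrite in_itv | rewrite E subr0].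
pose phi (s : R) := f (x + h *: w + s *: u) - f (x + s *: u).
have Dphi s : 0 <= s <= h -> is_derive s 1 phi
    ('D_u f (x + h *: w + s *: u) - 'D_u f (x + s *: u)).
  move=> sh; apply: is_deriveB; apply: is_derive_line; apply: df.
    by rewrite addrAC; apply: boxU => //; rewrite lexx ltW.
  by rewrite -[X in U X]addr0 -[0](scale0r w); apply: boxU; rewrite // lexx ltW.
have [c ch phiE] := mvt phi _ Dphi.
pose psi (t : R) := 'D_u f (x + c *: u + t *: w).
have Dpsi t : 0 <= t <= h -> is_derive t 1 psi
    ('D_w (fun z => 'D_u f z) (x + c *: u + t *: w)).
  by move=> th; apply: is_derive_line; apply: ddf; apply: boxU.
have [t th psiE] := mvt psi _ Dpsi.
exists c, t; split=> //; rewrite -psiE /psi scale0r addr0.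
move: phiE; rewrite /phi !scale0r !addr0.
by rewrite [x + h *: u + h *: w]addrAC [x + c *: u + h *: w]addrAC.
Qed.

Lemma continuous_common_values (F G : V -> R) x :
  {for x, continuous F} -> {for x, continuous G} ->
  (forall d : R, 0 < d -> exists y z, [/\ ball x d y, ball x d z & F y = G z]) ->
  F x = G x.
Proof.
move=> cF cG FG; apply: contrapT => /eqP neFG.
pose e := `|F x - G x| / 2; have e0 : 0 < e by rewrite divr_gt0 ?normr_gt0 ?subr_eq0.
have : \forall y \near x, `|F x - F y| < e /\ `|G x - G y| < e.
  near=> y; split; near: y.
    by move/cvgrPdist_lt: cF; apply.
  by move/cvgrPdist_lt: cG; apply.
case/nbhs_ballP => d /= d0 Hd; have [y [z [yd zd E]]] := FG d d0.
have [F1 _] := Hd y yd; have [_ G1] := Hd z zd.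
have : `|F x - G x| < e + e.
  rewrite (_ : F x - G x = (F x - F y) - (G x - G z)); last by rewrite E; ring.
  by apply: le_lt_trans (ler_normB _ _) _; apply: ltrD.
by rewrite /e -splitr ltxx.
Unshelve. all: by end_near. Qed.

(** The second difference is symmetric in u and w, so on arbitrarily small parallelograms the two
    mixed derivatives take a common value, each at its own point; continuity at x finishes. *)
Lemma schwarz (U : set V) f x u w : open U -> U x ->
  (forall y, U y -> derivable f y u) -> (forall y, U y -> derivable f y w) ->
  (forall y, U y -> derivable (fun z => 'D_u f z) y w) ->
  (forall y, U y -> derivable (fun z => 'D_w f z) y u) ->
  {for x, continuous (fun z => 'D_w (fun z => 'D_u f z) z)} ->
  {for x, continuous (fun z => 'D_u (fun z => 'D_w f z) z)} ->
  'D_w (fun z => 'D_u f z) x = 'D_u (fun z => 'D_w f z) x.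
Proof.
move=> oU Ux dfu dfw dfuw dfwu cF cG.
apply: (continuous_common_values cF cG) => d' d'0.
have [d [d0 le_dd' dU]] : exists d, [/\ 0 < d, d <= d' & ball x d `<=` U].
  have /nbhs_ballP[d1 /= d10 H] : nbhs x U by apply: open_nbhs_nbhs.
  exists (Num.min d1 d'); split; rewrite ?lt_min ?d10 ?ge_min ?lexx ?orbT //.
  by apply: subset_trans H; apply: le_ball; rewrite ge_min lexx.
pose K := `|u| + `|w| + 1; have K0 : 0 < K by rewrite ltr_wpDl // addr_ge0.
(* The side h is chosen so that the whole parallelogram stays in the ball of radius d. *)
pose h := d / K / 2; have h0 : 0 < h by rewrite !divr_gt0.
have box s t u' w' : `|u'| + `|w'| + 1 = K -> 0 <= s <= h -> 0 <= t <= h ->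
    ball x d (x + s *: u' + t *: w').
  move=> KE /andP[s0 sh] /andP[t0 th]; rewrite -ball_normE /ball_ /=.
  rewrite -addrA opprD addrA subrr sub0r normrN.
  apply: le_lt_trans (ler_normD _ _) _; rewrite !normrZ !ger0_norm //.
  apply: (@le_lt_trans _ _ (h * K)).
    rewrite -KE !mulrDr mulr1 ler_wpDr ?(ltW h0) //.
    by apply: lerD; apply: ler_wpM2r.
  by rewrite /h mulrAC divfK ?gt_eqF // ltr_pdivrMr // ltr_pMr // ltr1n.
have KC : `|w| + `|u| + 1 = K by rewrite [`|w| + _]addrC.
have inU u' w' (KE : `|u'| + `|w'| + 1 = K) s t :
    0 <= s <= h -> 0 <= t <= h -> U (x + s *: u' + t *: w').
  by move=> sh th; apply/dU/box.
have [s [t [sh th E1]]] := second_difference h0 (inU u w erefl) dfu dfuw.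
have [s' [t' [sh' th' E2]]] := second_difference h0 (inU w u KC) dfw dfwu.
exists (x + s *: u + t *: w), (x + s' *: w + t' *: u); split.
- by apply: (le_ball le_dd'); apply: box.
- by apply: (le_ball le_dd'); apply: box.
have cancel (X Y a b : R) : a = X * h * h -> b = Y * h * h -> a = b -> X = Y.
  by move=> -> -> /mulIf-/(_ (lt0r_neq0 h0)) /mulIf-/(_ (lt0r_neq0 h0)).
apply: (cancel _ _ _ _ E1 E2); rewrite [x + h *: w + h *: u]addrAC.
by rewrite [RHS]addrAC opprB addrCA opprD; ring.
Qed.
End DirectionalDerivatives.

(** * Skew symmetry of the Levi-Civita curvature *)

Section LeviCivita.
Variables (R : realType) (n : nat) (U : set 'rV[R]_n) (g : 'rV[R]_n -> 'M[R]_n).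
Hypothesis oU : open U.
Hypothesis g_smooth : forall i j, smooth U (fun y => g y i j).
Hypothesis g_sym : forall y, U y -> (g y)^T = g y.
Hypothesis g_unit : forall y, U y -> g y \in unitmx.
Variable x : 'rV[R]_n.
Hypothesis Ux : U x.
Local Notation e i := (delta_mx 0 i : 'rV[R]_n).
Local Notation Gam := (christoffel g).

Lemma metric_symE y a b : U y -> g y a b = g y b a.
Proof. by move=> Uy; rewrite -[in LHS]g_sym // mxE. Qed.

Lemma derivable_metric a b i y : U y -> derivable (fun y => g y a b) y (e i).
Proof. by move=> Uy; have [_ /(_ i)[H _]] := g_smooth a b 1%N; apply: H. Qed.

Lemma derivable_partial_metric a b i j y : U y ->
  derivable (partial j (fun y => g y a b)) y (e i).
Proof.
by move=> Uy; have [_ /(_ j)[_ [_ /(_ i)[H _]]]] := g_smooth a b 2%N; apply: H.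
Qed.

Lemma continuous_second_partial_metric a b i j :
  {for x, continuous (partial i (partial j (fun y => g y a b)))}.
Proof.
by have [_ /(_ j)[_ [_ /(_ i)[_ [H _]]]]] := g_smooth a b 2%N; apply: H.
Qed.

Lemma partial_comm_metric a b i j :
  partial i (partial j (fun y => g y a b)) x = partial j (partial i (fun y => g y a b)) x.
Proof.
apply: (schwarz oU Ux).
- by move=> y; apply: derivable_metric.
- by move=> y; apply: derivable_metric.
- by move=> y; apply: derivable_partial_metric.
- by move=> y; apply: derivable_partial_metric.
- exact: continuous_second_partial_metric.
- exact: continuous_second_partial_metric.
Qed.

Lemma derivable_christoffel l j k i : derivable (Gam l j k) x (e i).
Proof.
apply: (derivableM (f := cst _)) => //; apply: derivable_bigsum => m.
apply: derivableM; last first.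
  by apply: derivableB; [apply: derivableD|]; apply: derivable_partial_metric.
apply: derivable_invmx => [|a b]; last exact: derivable_metric.
by near=> y; apply: g_unit; near: y; apply: open_nbhs_nbhs.
Unshelve. all: by end_near. Qed.

(** The Christoffel symbols of the first kind. *)
Definition lowered a j k y : R := \sum_l g y a l * Gam l j k y.

Lemma partial_lowered i a j k : partial i (lowered a j k) x =
  \sum_l (partial i (fun y => g y a l) x * Gam l j k x
          + g x a l * partial i (Gam l j k) x).
Proof.
rewrite /partial /lowered derive_bigsum => [|l]; last first.
  apply: derivableM; first exact: derivable_metric.
  exact: derivable_christoffel.
apply: eq_bigr => l _.
have dg : derivable (fun y => g y a l) x (e i) by exact: derivable_metric.
have dG : derivable (Gam l j k) x (e i) by exact: derivable_christoffel.
rewrite (deriveM dg dG).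
by rewrite addrC; congr (_ + _); rewrite mulrC.
Qed.

(** Metric compatibility, differentiated once more. *)
Lemma lowered_sum i a j k :
  partial i (lowered a j k) x + partial i (lowered k j a) x =
  partial i (partial j (fun y => g y a k)) x.
Proof.
have dL b c : derivable (lowered b j c) x (e i).
  apply: derivable_bigsum => l; apply: derivableM; first exact: derivable_metric.
  exact: derivable_christoffel.
rewrite /partial -deriveD //; apply: near_eq_derive; near=> y.
have Uy : U y by near: y; apply: open_nbhs_nbhs.
rewrite -[RHS]/(partial j (fun y => g y a k) y).
rewrite (christoffel_metric j a k oU Uy g_sym (g_unit Uy)).
rewrite -[LHS]/(lowered a j k y + lowered k j a y) /lowered addrC -big_split.
by apply: eq_bigr => l _ /=; rewrite (metric_symE k l Uy); congr (_ + _); rewrite mulrC.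
Unshelve. all: by end_near. Qed.

(** The coefficient of dx_i dx_j in d omega + omega omega, not antisymmetrized in i and j; only its
    antisymmetric part reaches the curvature form. *)
Definition riemann l k i j : R :=
  partial i (Gam l j k) x + \sum_m Gam l i m x * Gam m j k x.

Definition riemann_low a k i j : R := \sum_l g x a l * riemann l k i j.

Definition gamma_sq a k i j : R :=
  \sum_l \sum_r Gam r i a x * g x r l * Gam l j k x.

(** Moving the metric inside the derivative costs a term in the first derivative of the metric,
    which compatibility rewrites through Christoffel symbols. One half cancels the quadratic term of
    the curvature, the other half is [gamma_sq]. *)
Lemma riemann_lowE a k i j :
  riemann_low a k i j = partial i (lowered a j k) x - gamma_sq a k i j.
Proof.
rewrite partial_lowered /gamma_sq /riemann_low.
have -> : \sum_l g x a l * riemann l k i j =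
    \sum_l g x a l * partial i (Gam l j k) x +
    \sum_l \sum_r g x a r * Gam r i l x * Gam l j k x.
  rewrite [X in _ + X]exchange_big -big_split; apply: eq_bigr => l _ /=.
  rewrite mulrDr mulr_sumr; congr (_ + _).
  by apply: eq_bigr => m _; rewrite mulrA.
rewrite -sumrB -big_split; apply: eq_bigr => l _ /=.
rewrite (christoffel_metric i a l oU Ux g_sym (g_unit Ux)) mulr_suml.
have -> : \sum_r (Gam r i a x * g x r l + Gam r i l x * g x a r) * Gam l j k x =
  \sum_r Gam r i a x * g x r l * Gam l j k x + \sum_r g x a r * Gam r i l x * Gam l j k x.
  by rewrite -big_split; apply: eq_bigr => r _ /=; ring.
ring.
Qed.

Lemma gamma_sq_swap a k i j : gamma_sq a k j i = gamma_sq k a i j.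
Proof.
rewrite /gamma_sq exchange_big; apply: eq_bigr => l _; apply: eq_bigr => r _.
by rewrite (metric_symE r l Ux); ring.
Qed.

(** Symmetrized in a and k, the derivative terms become second derivatives of the metric, symmetric
    in i and j by Schwarz, and [gamma_sq] is symmetric under exchanging both pairs. *)
Lemma riemann_low_sym a k i j :
  riemann_low a k i j + riemann_low k a i j = riemann_low a k j i + riemann_low k a j i.
Proof.
have E i' j' : riemann_low a k i' j' + riemann_low k a i' j' =
    partial i' (partial j' (fun y => g y a k)) x - (gamma_sq a k i' j' + gamma_sq k a i' j').
  by rewrite !riemann_lowE -lowered_sum opprD addrACA.
rewrite !E partial_comm_metric (gamma_sq_swap a k i j) -(gamma_sq_swap a k j i).
by congr (_ - _); rewrite addrC.
Qed.

Local Notation toC := (@real_complex R).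

Definition curvature_lift : 'M[eform R[i] n]_n :=
  \matrix_(l, k) two_form (fun i j => (riemann l k i j)%:C%C).

Lemma curvature_liftE : map_mx (@eforget R[i] n) curvature_lift = lc_curvature g x.
Proof.
apply/matrixP => l k; rewrite !mxE eforget_two_form.
transitivity (\sum_i \sum_j ((partial i (Gam l j k) x)%:C%C *: (dx R[i] i * dx R[i] j) +
    \sum_m ((Gam l i m x)%:C%C *: dx R[i] i) * ((Gam m j k x)%:C%C *: dx R[i] j))).
  apply: eq_bigr => i _; apply: eq_bigr => j _.
  rewrite rmorphD rmorph_sum scalerDl scaler_suml; congr (_ + _).
  by apply: eq_bigr => m _; rewrite rmorphM -scalerAl -scalerAr scalerA.
under eq_bigr => i _ do rewrite big_split.
rewrite big_split; congr (_ + _).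
under eq_bigr => i _ do rewrite exchange_big.
rewrite exchange_big; apply: eq_bigr => m _; rewrite !mxE mulr_suml.
by apply: eq_bigr => i _; rewrite mulr_sumr.
Qed.

Lemma hom2_curvature_lift : hom2 curvature_lift.
Proof. by apply/matrixP => l k; rewrite !mxE edeg_two_form. Qed.

(** The lowered curvature is skew in a and k: its symmetric part is a 2-form with coefficients
    symmetric in i and j, hence 0. *)
Lemma curvature_lift_antisym (G : 'M[eform R[i] n]_n) :
  G = map_mx (fun r => eC n r%:C%C) (g x) ->
  curvature_lift^T *m G = - (G *m curvature_lift).
Proof.
move=> GE; have GT : G^T = G by apply/matrixP => a b; rewrite GE !mxE metric_symE.
rewrite -{1}GT -trmx_mul; apply/matrixP => k a.
have low a' k' : (G *m curvature_lift) a' k' =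
    two_form (fun i j => (riemann_low a' k' i j)%:C%C).
  rewrite GE mxE; under eq_bigr => l _ do rewrite !mxE two_formZ.
  rewrite two_form_sum; apply: eq_two_form => i j.
  rewrite /riemann_low (rmorph_sum (real_complex R)); apply: eq_bigr => l _.
  by rewrite -(rmorphM (real_complex R)).
rewrite [LHS]mxE [RHS]mxE !low; apply/eqP; rewrite -addr_eq0 two_formD.
apply/eqP/two_form_symmetric => [c /eqP|i j].
  by rewrite -mulr2n mulrn_eq0 /= => /eqP.
by rewrite -!rmorphD riemann_low_sym.
Qed.

(** The transpose of the curvature is conjugate, through the metric, to its negative. An odd power
    therefore has a trace equal to its own opposite. *)
Lemma trace_curvature_lift_odd j : odd j -> \tr (curvature_lift ^+ j) = 0.
Proof.
move=> oj; pose f := @eC R[i] n \o real_complex R.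
pose G := map_mx f (g x); pose Gi := map_mx f (invmx (g x)); set B := curvature_lift.
have GGi : G *m Gi = 1%:M by rewrite -map_mxM mulmxV ?g_unit // map_mx1.
have GiG : Gi *m G = 1%:M by rewrite -map_mxM mulVmx ?g_unit // map_mx1.
have BG : B^T *m G = G *m (- B) by rewrite mulmxN; apply: curvature_lift_antisym.
have trX i : (B ^+ i)^T = B^T ^+ i.
  elim: i => [|i IH]; first by rewrite !expr0 trmx1.
  by rewrite exprS [RHS]exprSr -IH -[LHS]/((B *m B ^+ i)^T) trmx_mul.
have BGX i : B^T ^+ i *m G = G *m (- B) ^+ i.
  elim: i => [|i IH]; first by rewrite !expr0 mul1mx mulmx1.
  rewrite exprS [in RHS]exprSr -[LHS]/((B^T *m B^T ^+ i) *m G).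
  by rewrite -mulmxA IH mulmxA BG -!mulmxA; congr (_ *m _); rewrite -[LHS]/(- B * _) -exprS exprSr.
have E : \tr (B ^+ j) = - \tr (B ^+ j).
  rewrite -{1}mxtrace_tr trX -[B^T ^+ j]mulmx1 -GGi mulmxA BGX mxtrace_mulC mulmxA.
  by rewrite GiG mul1mx exprNn -signr_odd oj expr1 mulN1r raddfN.
apply: (eform_natreg (m := 1) (natreg_alg (idfun : {rmorphism R[i] -> R[i]}))).
by rewrite mulr_natl mulr2n {1}E addNr.
Qed.
End LeviCivita.

(** * The theorem at a point of the manifold *)

Lemma metric_unit (R : realType) (n : nat) (M : riemannianManifold R n) (c : chart M) x :
  chart_cod c x -> metric c x \in unitmx.
Proof.
move=> cx; rewrite unitmxE unitfE; apply/negP => /det0P[v v0 vg].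
by have := metric_pos cx v0; rewrite vg mul0mx mxE ltxx.
Qed.

Theorem theorem2p1 (R : realType) (k : nat)
    (M : riemannianManifold R (8 * k + 4)) (c : chart M) (p : M)
    (cp : chart_dom c p) :
  let Om := curvature c p in
  ext_part (8 * k + 4) (Lhat Om * ch Om - 16 *: Lhat Om) =
  2 ^+ 14 *: \sum_(r < k)
    ((k - r)%:R * 2 ^+ (6 * (k - r - 1))) *: h_form k Om r.
Proof.
have smo i j := @metric_smooth R _ M c i j.
have sym y (cy : chart_cod c y) := Defs.metric_sym cy.
have unt y (cy : chart_cod c y) := metric_unit cy.
have cx := coordsP cp; have oU := @open_chart_cod R _ M c.
move=> Om; rewrite /Om /curvature -(curvature_liftE (metric c) (coords c p)).
apply: genus_identity; first exact: hom2_curvature_lift.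
exact: (trace_curvature_lift_odd oU smo sym unt cx).
Qed.
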